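(* Let $G$ be a graph with no $\mathcal{K}_8^{-4}$ minor, i.e. such that no graph obtained from $K_8$ by deleting four edges is a minor of $G$. Then $G$ is $7$-colorable.
   Context: All graphs are finite and simple. A graph $H$ is a minor of a graph $G$ if $H$ can be obtained from a subgraph of $G$ by contracting edges. For positive integers $t,s$, $\mathcal{K}_t^{-s}$ denotes the family of all graphs obtained from the complete graph $K_t$ by deleting $s$ edges. A graph $G$ has no $\mathcal{K}_t^{-s}$ minor if it has no $H$ minor for every $H\in\mathcal{K}_t^{-s}$; otherwise $G$ has a $\mathcal{K}_t^{-s}$ minor. *)

(* Defs.v *)
From mathcomp Require Import all_boot.
Set Implicit Arguments.
Unset Strict Implicit.
Unset Printing Implicit Defensive.

Record sgraph := SGraph {
  vertex :> finType;
  adj : rel vertex;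
  adj_sym : symmetric adj;
  adj_irrefl : irreflexive adj
}.

Notation "x -- y" := (adj x y) (at level 30).

Definition edges (G : sgraph) : {set {set G}} :=
  [set [set p.1; p.2] | p : G * G & p.1 -- p.2].

Definition iso (G H : sgraph) : Prop :=
  exists2 f : G -> H, bijective f & forall x y : G, f x -- f y = x -- y.

(* [S] is a subgraph of [G] up to isomorphism: some vertices and edges of [G]
   may be missing in [S] (it need not be induced). *)
Definition subgraph (S G : sgraph) : Prop :=
  exists2 f : S -> G, injective f & forall x y : S, x -- y -> f x -- f y.

(* [contract x y] is G/xy, meaningful when [x -- y]: [y] is removed and [x]
   plays the role of the new vertex, which is adjacent to every other vertex
   that was adjacent to [x] or to [y]. *)
Section Contract.
Variables (G : sgraph) (x y : G).

Definition contract_rel : rel {z : G | z != y} := fun u v =>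
  (u != v) &&
  [|| val u -- val v, (val u == x) && (y -- val v) | (val v == x) && (val u -- y)].

Lemma contract_sym : symmetric contract_rel.
Proof.
move=> u v; rewrite /contract_rel eq_sym (adj_sym (val u) (val v)).
by rewrite (adj_sym y (val v)) (adj_sym y (val u)); congr (_ && (_ || _)); exact: orbC.
Qed.

Lemma contract_irrefl : irreflexive contract_rel.
Proof. by move=> u; rewrite /contract_rel eqxx. Qed.

Definition contract : sgraph := SGraph contract_sym contract_irrefl.
End Contract.

Inductive contracts_to : sgraph -> sgraph -> Prop :=
| contracts_refl G : contracts_to G G
| contracts_step (G H : sgraph) (x y : G) :
    x -- y -> contracts_to (contract x y) H -> contracts_to G H.

Definition minor (H G : sgraph) : Prop :=
  exists S S' : sgraph, [/\ subgraph S G, contracts_to S S' & iso S' H].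

Definition complete_rel (t : nat) : rel 'I_t := fun x y => x != y.

Lemma complete_sym t : symmetric (@complete_rel t).
Proof. by move=> x y; rewrite /complete_rel eq_sym. Qed.

Lemma complete_irrefl t : irreflexive (@complete_rel t).
Proof. by move=> x; rewrite /complete_rel eqxx. Qed.

Definition complete (t : nat) : sgraph :=
  SGraph (@complete_sym t) (@complete_irrefl t).

Section DeleteEdges.
Variables (G : sgraph) (F : {set {set G}}).

Definition delete_rel : rel G := fun x y => (x -- y) && ([set x; y] \notin F).

Lemma delete_sym : symmetric delete_rel.
Proof. by move=> x y; rewrite /delete_rel adj_sym setUC. Qed.

Lemma delete_irrefl : irreflexive delete_rel.
Proof. by move=> x; rewrite /delete_rel adj_irrefl. Qed.

Definition delete_edges : sgraph := SGraph delete_sym delete_irrefl.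
End DeleteEdges.

Definition Kminus (t s : nat) (H : sgraph) : Prop :=
  exists F : {set {set complete t}},
    [/\ F \subset edges (complete t), #|F| = s & iso H (delete_edges F)].

Definition has_no_minor_in (K : sgraph -> Prop) (G : sgraph) : Prop :=
  forall H : sgraph, K H -> ~ minor H G.

Definition colorable (k : nat) (G : sgraph) : Prop :=
  exists c : G -> 'I_k, forall x y : G, x -- y -> c x != c y.

(* Main.v *)
(** A counterexample with as few vertices as possible is colour-critical: it has
    minimum degree 8, and in the neighbourhood of a vertex [x] of degree 8 there
    are no three independent vertices, because contracting them with [x] would
    leave a colour for [x].

    Vertices of degree 8 abound by an extremal bound: a graph on [n >= 8] vertices
    with at least [9n/2 - 12] edges has a K_8^{-4} minor. In a minimal
    counterexample to this bound every edge lies in four triangles; a vertex [y]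
    of degree at most 8 is chosen such that each of its neighbours either has the
    closed neighbourhood of [y] or is adjacent to one fixed component of the rest.
    Contracting that component and at most one more edge gives the minor, unless
    [y] has degree 5; then its closed neighbourhood is a clique, and the rest of
    the graph splits into two connected sets that together have eight adjacencies
    with the five neighbours of [y].

    Let [x] have degree 8. If the complement of the graph induced on N(x) is not
    bipartite it contains an odd cycle of length 5 or 7. Kempe chains make some
    vertex [u] of N(x) adjacent to all others after contracting outside
    components into it, and contracting one further edge gives the minor. Hence
    N(x) is the union of two cliques, with sides 4, 4 or 3, 5, for every vertex
    [x] of degree 8, and there is a 5-clique [L] not containing [x] and not
    nearly contained in either side.

    Recolouring shows that a separator of two cliques which is no larger than
    either of them is one of them. So Menger's theorem gives five disjoint
    paths, the rails, from [L] to N(x), and the ends can be balanced between the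
    two sides. Two more disjoint paths from one side to the rails of the other
    side complete a K_8^{-4} minor. *)

Require Import Defs.
From mathcomp Require Import all_boot fingroup perm.
From mathcomp Require Import zify.

Set Implicit Arguments.
Unset Strict Implicit.
Unset Printing Implicit Defensive.

(** * Connected sets and models *)

(** The constants fit together through [K_8^{-4}]. It has 28 - 4 = 24 edges, which is 9n/2 - 12 for
    n = 8, so the extremal bound is exactly what eight vertices require. In a critical graph the
    degree sum stays more than 24 below 9n, so more than 24 vertices have degree 8; the search for
    the third clique needs only three of them. In the final minor the branch sets are five rails,
    [x] and two new paths. The rails are pairwise adjacent through [L], and the sets starting in the
    second side are pairwise adjacent there. Only a new path and one of the at most three rails
    ending in the first side can fail to be adjacent. Each new path stops on such a rail and so
    touches it, which leaves at most 2 + 2 = 4 missing pairs. The obstacle on the colouring side is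
    that minimality only colours smaller minors. Each separation argument therefore picks
    contractions which force the colourings of both sides to induce the same partition of the
    separator, and then permutes colours. *)

Section Connectivity.
Variable G : sgraph.
Implicit Types (A B X : {set G}) (u v w x y z : G).

(** Connectedness is stated through cuts because a cut of a union, of a model or of a quotient pulls
    back to a cut of the parts; no paths have to be concatenated. *)
Definition conn A :=
  A != set0 /\ forall X, A :&: X != set0 -> A :\: X != set0 ->
  exists u v, [/\ u \in A :&: X, v \in A :\: X & u -- v].

Definition adjs A B := [exists u in A, exists v in B, u -- v].

Lemma adjsP A B : reflect (exists u v, [/\ u \in A, v \in B & u -- v]) (adjs A B).
Proof.
apply: (iffP existsP) => [[u /andP[uA /existsP[v /andP[vB uv]]]]|[u [v [uA vB uv]]]].
  by exists u, v.
by exists u; rewrite uA /=; apply/existsP; exists v; rewrite vB.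
Qed.

Lemma adjs_sym A B : adjs A B = adjs B A.
Proof. by apply/adjsP/adjsP => -[u [v [uA vB uv]]]; exists v, u; rewrite adj_sym. Qed.

Lemma adjs_sub A B A' B' : A \subset A' -> B \subset B' -> adjs A B -> adjs A' B'.
Proof.
move=> /subsetP sA /subsetP sB /adjsP[u [v [uA vB uv]]].
by apply/adjsP; exists u, v; rewrite sA ?sB.
Qed.

Lemma adjs1 u B : adjs [set u] B = [exists v in B, u -- v].
Proof.
apply/adjsP/existsP => [[u' [v [/set1P-> vB uv]]]|[v /andP[vB uv]]].
  by exists v; rewrite vB.
by exists u, v; rewrite inE eqxx.
Qed.

Lemma adjs11 u v : adjs [set u] [set v] = u -- v.
Proof.
apply/adjsP/idP => [[u' [v' [/set1P-> /set1P->]]]//|uv].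
by exists u, v; rewrite !inE !eqxx.
Qed.

Lemma conn1 u : conn [set u].
Proof.
split; first by apply/set0Pn; exists u; rewrite inE.
move=> X /set0Pn[v]; rewrite !inE => /andP[/eqP-> uX] /set0Pn[w].
by rewrite !inE => /andP[wX /eqP wu]; rewrite wu uX in wX.
Qed.

Lemma connU A B : conn A -> conn B -> (A :&: B != set0) || adjs A B -> conn (A :|: B).
Proof.
move=> [A0 cA] [B0 cB] AB; split.
  by case/set0Pn: A0 => a aA; apply/set0Pn; exists a; rewrite inE aA.
move=> X; have [AX0|AX0] := eqVneq (A :&: X) set0; have [BX0|BX0] := eqVneq (B :&: X) set0.
- by rewrite setIUl AX0 BX0 setU0 eqxx.
- move=> _ _; have [BX1|BX1] := eqVneq (B :\: X) set0; last first.
    case: (cB X BX0 BX1) => u [v [uBX vBX uv]]; exists u, v; split=> //.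
      by move: uBX; rewrite !inE => /andP[-> ->]; rewrite orbT.
    by move: vBX; rewrite !inE => /andP[-> ->]; rewrite orbT.
  have sBX b : b \in B -> b \in X.
    by move=> bB; apply: contraT => bX; move/setP/(_ b): BX1; rewrite !inE bB bX.
  have sAX a : a \in A -> a \notin X.
    by move=> aA; apply/negP => aX; move/setP/(_ a): AX0; rewrite !inE aA aX.
  case/orP: AB => [/set0Pn[w /setIP[wA wB]]|/adjsP[u [v [uA vB uv]]]].
    by case/negP: (sAX _ wA); apply: sBX.
  by exists v, u; rewrite adj_sym !inE vB uA sBX // sAX // orbT.
- move=> _ _; have [AX1|AX1] := eqVneq (A :\: X) set0; last first.
    case: (cA X AX0 AX1) => u [v [uBX vBX uv]]; exists u, v; split=> //.
      by move: uBX; rewrite !inE => /andP[-> ->].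
    by move: vBX; rewrite !inE => /andP[-> ->].
  have sAX b : b \in A -> b \in X.
    by move=> bB; apply: contraT => bX; move/setP/(_ b): AX1; rewrite !inE bB bX.
  have sBX a : a \in B -> a \notin X.
    by move=> aA; apply/negP => aX; move/setP/(_ a): BX0; rewrite !inE aA aX.
  case/orP: AB => [/set0Pn[w /setIP[wA wB]]|/adjsP[u [v [uA vB uv]]]].
    by case/negP: (sBX _ wB); apply: sAX.
  by exists u, v; rewrite !inE vB uA sAX // sBX // orbT.
- move=> _ /set0Pn[w]; rewrite !inE => /andP[wX /orP[wA|wB]].
    case: (cA X AX0) => [|u [v [uBX vBX uv]]].
      by apply/set0Pn; exists w; rewrite !inE wX.
    exists u, v; split=> //.
      by move: uBX; rewrite !inE => /andP[-> ->].
    by move: vBX; rewrite !inE => /andP[-> ->].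
  case: (cB X BX0) => [|u [v [uBX vBX uv]]].
    by apply/set0Pn; exists w; rewrite !inE wX.
  exists u, v; split=> //.
    by move: uBX; rewrite !inE => /andP[-> ->]; rewrite orbT.
  by move: vBX; rewrite !inE => /andP[-> ->]; rewrite orbT.
Qed.

Lemma connU1 A u : conn A -> [exists v in A, u -- v] -> conn (u |: A).
Proof.
move=> cA uA; apply: connU => //; first exact: conn1.
by rewrite adjs1 uA orbT.
Qed.

Lemma conn2 u v : u -- v -> conn [set u; v].
Proof. by move=> uv; apply: connU; rewrite ?adjs11 ?uv ?orbT //; exact: conn1. Qed.

Definition restr A := [rel u v | [&& u \in A, v \in A & u -- v]].
(* Contains [x] even when [x \notin A]. *)
Definition component A x := locked [set y | connect (restr A) x y].

Lemma componentE A x y : (y \in component A x) = connect (restr A) x y.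
Proof. by rewrite /component -lock inE. Qed.

Lemma component_self A x : x \in component A x.
Proof. by rewrite componentE connect0. Qed.

Lemma component_sub A x : x \in A -> component A x \subset A.
Proof.
move=> xA; apply/subsetP => y; rewrite componentE => /connectP[p].
elim/last_ind: p y => [|p z _] y /=; first by move=> _ ->.
by rewrite rcons_path last_rcons => /andP[_ /and3P[_ zA _]] ->.
Qed.

Lemma component_closed A x y z : x \in A -> y \in component A x -> z \in A -> y -- z -> z \in component A x.
Proof.
move=> xA yC zA yz; have yA := subsetP (component_sub xA) _ yC.
move: yC; rewrite !componentE => yC; apply: connect_trans yC (connect1 _).
by rewrite /= yA zA.
Qed.

Lemma component_conn A x : conn (component A x).
Proof.
split; first by apply/set0Pn; exists x; rewrite component_self.
move=> X X1 X2; wlog xX : X X1 X2 / x \in X => [H|].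
  have [xX|xX] := boolP (x \in X); first exact: H.
  case: (H (~: X)); rewrite ?inE ?xX // ?setDE ?setCK -?setDE // => u [v [uX vX uv]].
  by exists v, u; rewrite adj_sym.
case/set0Pn: X2 => y; rewrite !inE componentE => /andP[yX /connectP[p]].
elim/last_ind: p y yX => [|p z IH] y yX /=; first by move=> _ yx; rewrite yx xX in yX.
rewrite rcons_path last_rcons => /andP[pp pz] yz; subst y.
have [lX|lX] := boolP (last x p \in X); last exact: (IH _ lX).
exists (last x p), z; split; last by case/and3P: pz.
  by rewrite !inE componentE lX andbT; apply/connectP; exists p.
rewrite !inE componentE yX /=; apply/connectP; exists (rcons p z); rewrite ?last_rcons //.
by rewrite rcons_path pp.
Qed.

Lemma conn_component A x : conn A -> x \in A -> component A x = A.
Proof.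
move=> [_ cA] xA; apply/eqP; rewrite eqEsubset component_sub //=.
apply: contraT => nsub; case: (cA (component A x)).
- by apply/set0Pn; exists x; rewrite inE xA component_self.
- by rewrite setD_eq0.
move=> u [v [/setIP[uA uC] /setDP[vA vC] uv]].
by rewrite (component_closed xA uC vA uv) in vC.
Qed.

Lemma component_max A x B : x \in A -> conn B -> B \subset A -> x \in B -> B \subset component A x.
Proof.
move=> xA [_ cB] sBA xB; apply: contraT => nsub.
case: (cB (component A x)).
- by apply/set0Pn; exists x; rewrite inE xB component_self.
- by rewrite setD_eq0.
move=> u [v [/setIP[uA uC] /setDP[vA vC] uv]].
by rewrite (component_closed xA uC (subsetP sBA _ vA) uv) in vC.
Qed.

Lemma component_eq A x y : x \in A -> y \in component A x -> component A y = component A x.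
Proof.
move=> xA yC; have yA := subsetP (component_sub xA) _ yC.
have s1 : component A x \subset component A y.
  by apply: component_max => //; [apply: component_conn | apply: component_sub].
apply/eqP; rewrite eqEsubset s1 andbT.
apply: component_max => //; [exact: component_conn | exact: component_sub |].
by apply: (subsetP s1); apply: component_self.
Qed.

Lemma conn_path x p : path (fun u v : G => u -- v) x p -> conn [set y in x :: p].
Proof.
elim: p x => [|y p IH] x /=.
  by move=> _; rewrite (_ : [set _ in _] = [set x]); [exact: conn1 | apply/setP => z; rewrite !inE].
case/andP=> xy /IH c; rewrite (_ : [set _ in _] = x |: [set z in y :: p]); last first.
  by apply/setP => z; rewrite !inE.
by apply: connU1 => //; apply/existsP; exists y; rewrite !inE eqxx xy.
Qed.

End Connectivity.

Definition model (H G : sgraph) (m : H -> {set G}) :=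
  [/\ forall x, conn (m x), forall x y, x != y -> [disjoint m x & m y]
    & forall x y, x -- y -> adjs (m x) (m y)].

(** A cut of the union either splits some branch set, which is connected, or consists of whole
    branch sets and comes from a cut of [A]; an edge of [H] across that cut is realised between two
    branch sets. *)
Lemma model_conn (H G : sgraph) (m : H -> {set G}) (A : {set H}) :
  model m -> conn A -> conn (\bigcup_(x in A) m x).
Proof.
move=> [cm _ am] [A0 cA]; split.
  case/set0Pn: A0 => a aA; case: (cm a) => /set0Pn[u um] _.
  by apply/set0Pn; exists u; apply/bigcupP; exists a.
move=> X /set0Pn[u /setIP[/bigcupP[a aA ua] uX]] /set0Pn[v /setDP[/bigcupP[b bA vb] vX]].
have [[c cIA cX]|nsplit] : (exists2 c, c \in A & (m c :&: X != set0) && (m c :\: X != set0))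
   \/ forall c, c \in A -> ~~ ((m c :&: X != set0) && (m c :\: X != set0)).
- have [/existsP[c /andP[cA' cX]]|/existsPn n] :=
    boolP [exists c in A, (m c :&: X != set0) && (m c :\: X != set0)]; first by left; exists c.
  by right=> c cA'; have := n c; rewrite cA'.
- case/andP: cX => c1 c2; case: (cm c) => _ /(_ X c1 c2)[w [t [/setIP[wc wX] /setDP[tc tX] wt]]].
  by exists w, t; split=> //; [rewrite inE wX andbT | rewrite inE tX /=]; apply/bigcupP; exists c.
have mono c w t : c \in A -> w \in m c -> w \in X -> t \in m c -> t \in X.
  move=> cA' wc wX tc; apply: contraT => tX; case/negP: (nsplit c cA'); apply/andP; split.
    by apply/set0Pn; exists w; rewrite inE wc.
  by apply/set0Pn; exists t; rewrite inE tX.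
case: (cA [set c | m c \subset X]).
- apply/set0Pn; exists a; rewrite !inE aA; apply/subsetP => t; exact: (mono a u).
- apply/set0Pn; exists b; rewrite !inE bA andbT.
  by apply/subsetPn; exists v.
move=> c [d [/setIP[cA' +] /setDP[dA +] cd]]; rewrite !inE => /subsetP cX /subsetPn[t td tX].
case/adjsP: (am _ _ cd) => w [s [wc sd ws]].
exists w, s; split=> //; first by rewrite inE (cX _ wc) andbT; apply/bigcupP; exists c.
rewrite inE; apply/andP; split; last by apply/bigcupP; exists d.
by apply/negP => sX; case/negP: tX; apply: (mono d s).
Qed.

Lemma adj_neq (G : sgraph) (x y : G) : x -- y -> x != y.
Proof. by move=> xy; apply/eqP => e; rewrite e adj_irrefl in xy. Qed.

(** Passage from branch sets to the inductive contractions: if [phi] is not injective, some fibre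
    has two vertices and is connected, hence contains an edge; contracting it leaves a map with the
    same properties on fewer vertices. *)
Lemma contracts_quotient (G H : sgraph) (phi : G -> H) :
  (forall h, exists x, phi x = h) ->
  (forall h, conn [set x | phi x == h]) ->
  (forall x y, x -- y -> phi x != phi y -> phi x -- phi y) ->
  (forall h h', h -- h' -> exists x y, [/\ phi x = h, phi y = h' & x -- y]) ->
  exists S, contracts_to G S /\ iso S H.
Proof.
move: {2}#|G| (leqnn #|G|) => n; elim: n => [|n IH] in G phi *.
  rewrite leqn0 => /eqP G0 sur _ _ _.
  have noG (x : G) : False by move: (card0_eq G0 x).
  exists G; split; first exact: contracts_refl.
  exists phi; last by move=> x; case: (noG x).
  apply: inj_card_bij => [x|]; first by case: (noG x).
  rewrite G0 leqNgt; apply/negP => /card_gt0P[h _].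
  by case: (sur h) => x; case: (noG x).
move=> Gn sur cn e1 e2.
have [/injectiveP inj|/injectivePn[u [v uv puv]]] := boolP (injectiveb phi).
  exists G; split; first exact: contracts_refl.
  exists phi.
    apply: inj_card_bij => //; rewrite -(card_codom inj); apply: subset_leq_card.
    by apply/subsetP => h _; case: (sur h) => x <-; apply: codom_f.
  move=> x y; apply/idP/idP => xy; last first.
    by apply: e1 => //; apply/eqP => /inj e; rewrite e adj_irrefl in xy.
  by case: (e2 _ _ xy) => x' [y' [/inj -> /inj -> //]].
have [y uy py] : exists2 y, u -- y & phi y = phi u.
  case: (cn (phi u)) => _ /(_ [set u])[||u' [y []]].
  - by apply/set0Pn; exists u; rewrite !inE !eqxx.
  - by apply/set0Pn; exists v; rewrite !inE puv eqxx eq_sym uv.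
  by rewrite !inE => /andP[_ /eqP->] /andP[_ /eqP py] uy; exists y.
have uNy := adj_neq uy.
pose C := contract u y.
(* [rho] is the quotient map onto [contract u y]: the default of [insubd] is taken exactly at [y],
   which is moved to [u]. *)
pose rho (z : G) : C := insubd (Sub u uNy : C) z.
have rhoE z : val (rho z) = if z == y then u else z.
  by rewrite /rho val_insubd; case: eqP.
have phirho z : phi (val (rho z)) = phi z by rewrite rhoE; case: eqP => // ->.
have rhoK (z : C) : rho (val z) = z by apply: val_inj; rewrite rhoE (negPf (valP z)).
have rhoadj a b : a -- b -> rho a != rho b -> (rho a : C) -- rho b.
  move=> ab ne; rewrite /adj /= /contract_rel ne /=.
  rewrite !rhoE; move: ne; rewrite -val_eqE !rhoE.
  have [ay|nay] := eqVneq a y; have [bY|nby] := eqVneq b y; rewrite ?eqxx //= => _.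
  - by move: ab; rewrite ay => ->; rewrite orbT.
  - by move: ab; rewrite bY => ->; rewrite !orbT.
  - by rewrite ab.
have [S [cS iS]] : exists S, contracts_to C S /\ iso S H.
  apply: (IH C (fun z => phi (val z))).
  - have E : #|C| = #|G|.-1 by rewrite card_sig -(cardC1 y); apply: eq_card.
    have : 0 < #|G| by apply/card_gt0P; exists y.
    by rewrite E; lia.
  - by move=> h; case: (sur h) => x <-; exists (rho x); rewrite phirho.
  - move=> h; split.
      by case: (sur h) => x px; apply/set0Pn; exists (rho x); rewrite inE phirho px.
    move=> X /set0Pn[a]; rewrite !inE => /andP[pa aX] /set0Pn[b]; rewrite !inE => /andP[bX pb].
    case: (cn h) => _ /(_ [set z | rho z \in X])[||a' [b' []]].
    - by apply/set0Pn; exists (val a); rewrite !inE pa rhoK.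
    - by apply/set0Pn; exists (val b); rewrite !inE pb rhoK bX.
    rewrite !inE => /andP[pa' aX'] /andP[bX' pb'] ab.
    exists (rho a'), (rho b'); split; rewrite ?inE ?phirho ?pa' ?pb' ?aX' ?bX' //.
    by apply: rhoadj => //; apply: contraNneq bX' => <-.
  - move=> a b; rewrite {1}/adj /= /contract_rel => /andP[_ /or3P[ab|/andP[/eqP ea yb]|/andP[/eqP eb ya]]] ne.
    + exact: e1.
    + by rewrite ea -py; apply: e1; rewrite // py -ea.
    + by rewrite eb -py; apply: e1; rewrite // py -eb.
  - move=> h h' hh; case: (e2 _ _ hh) => a [b [pa pb ab]].
    exists (rho a), (rho b); rewrite !phirho; split=> //.
    apply: rhoadj => //; apply/eqP => e; have := phirho a; rewrite e phirho pa pb => e'.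
    by rewrite e' adj_irrefl in hh.
by exists S; split=> //; apply: contracts_step uy cS.
Qed.

(* Adjacent pairs of branch sets are counted in order, so 48 stands for the
   24 edges of K_8^{-4}. *)
Definition hasK (G : sgraph) := exists m : 'I_8 -> {set G},
  [/\ forall i, conn (m i), forall i j, i != j -> [disjoint m i & m j]
    & 48 <= #|[set p : 'I_8 * 'I_8 | (p.1 != p.2) && adjs (m p.1) (m p.2)]|].

Lemma hasK_model (H G : sgraph) (m : H -> {set G}) : model m -> hasK H -> hasK G.
Proof.
move=> M [k [ck dk nk]].
exists (fun i => \bigcup_(x in k i) m x); split.
- by move=> i; apply: model_conn.
- move=> i j ij; case: M => _ d2 _; apply/pred0P => z /=; apply/negP.
  case/andP=> /bigcupP[a ax za] /bigcupP[b bx zb].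
  have ab : a != b.
    by apply/eqP => eab; subst b; have := disjointFr (dk _ _ ij) ax; rewrite bx.
  by have := disjointFr (d2 _ _ ab) za; rewrite zb.
- apply: leq_trans nk _; apply: subset_leq_card; apply/subsetP => -[i j].
  rewrite !inE /= => /andP[-> /adjsP[u [v [ui vj uv]]]] /=; case: M => _ _ /(_ _ _ uv).
  by apply: adjs_sub; apply: bigcup_sup.
Qed.

Lemma exists_subset_card (T : finType) (A B : {set T}) k :
  A \subset B -> #|A| <= k <= #|B| -> exists2 F : {set T}, A \subset F & F \subset B /\ #|F| = k.
Proof.
move=> AB /andP[Ak kB]; elim: k Ak kB => [|k IH] Ak kB.
  by exists A => //; split=> //; lia.
have [Ak'|] := leqP #|A| k; last by move=> ?; exists A => //; split=> //; lia.
case: (IH Ak' (ltnW kB)) => F AF [FB Fk].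
have /subsetPn[b bB bF] : ~~ (B \subset F).
  by apply/negP => /subset_leq_card; lia.
exists (b |: F); first exact: subset_trans AF (subsetUr _ _).
by rewrite subUset sub1set bB FB cardsU1 bF Fk.
Qed.

Lemma edges_complete t (x y : complete t) : x != y -> [set x; y] \in edges (complete t).
Proof. by move=> xy; apply/imsetP; exists (x, y); rewrite ?inE. Qed.

(** Lets a set of fewer than four missing pairs be enlarged to exactly four deleted edges; the seven
    edges at one vertex suffice. *)
Lemma four_le_edges : 4 <= #|edges (complete 8)|.
Proof.
pose o : complete 8 := ord0.
have inj : {in [set~ o] &, injective (fun i => [set o; i])}.
  move=> i j; rewrite !inE => /negPf io /negPf jo /setP/(_ i).
  by rewrite !inE eqxx io /= => /esym/eqP.
have : [set [set o; i] | i in [set~ o]] \subset edges (complete 8).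
  by apply/subsetP => e /imsetP[i]; rewrite !inE eq_sym => io ->; apply: edges_complete.
move/subset_leq_card; rewrite card_in_imset // cardsC1 card_ord.
exact: leq_trans.
Qed.

(** If fewer than four pairs are missing, further edges are given up, since [Kminus] asks for
    exactly four. The subgraph to contract is the union of the branch sets without the edges joining
    two sets of a deleted pair. *)
Lemma hasK_minor G : hasK G -> exists2 H, Kminus 8 4 H & minor H G.
Proof.
case=> m [cm dm nm].
pose NA : {set {set complete 8}} :=
  [set [set p.1; p.2] | p : 'I_8 * 'I_8 & (p.1 < p.2) && ~~ adjs (m p.1) (m p.2)].
have NA4 : #|NA| <= 4.
  pose Q := [set p : 'I_8 * 'I_8 | (p.1 < p.2) && ~~ adjs (m p.1) (m p.2)].
  pose Q' := [set p : 'I_8 * 'I_8 | (p.2 < p.1) && ~~ adjs (m p.1) (m p.2)].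
  pose D := [set p : 'I_8 * 'I_8 | p.1 == p.2].
  set P := [set p | _] in nm.
  have QQ' : #|Q| = #|Q'|.
    rewrite -(card_imset Q' (_ : injective (fun p => (p.2, p.1)))) => [|[a b] [c d] [-> ->] //].
    apply: eq_card => -[i j].
    apply/idP/imsetP => [|[[a b]]]; last first.
      by rewrite !inE /= adjs_sym => H [-> ->].
    by rewrite inE /= => H; exists (j, i); rewrite // inE /= adjs_sym.
  have cD : #|D| = 8.
    rewrite -[RHS](card_ord 8) -(card_imset _ (_ : injective (fun i : 'I_8 => (i, i)))); last by move=> i j [].
    apply: eq_card => -[i j]; apply/idP/imsetP => [|[a _ [-> ->]]]; last by rewrite inE /=.
    by rewrite inE /= => /eqP->; exists j.
  have d1 : [disjoint Q & Q'].
    by apply/pred0P => -[i j]; rewrite /= !inE /=; case: ltngtP; rewrite ?andbF.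
  have d2 : [disjoint D & Q :|: Q'].
    by apply/pred0P => -[i j]; rewrite /= !inE /= -val_eqE /=; case: ltngtP.
  have d3 : [disjoint P & D :|: (Q :|: Q')].
    apply/pred0P => -[i j]; rewrite /= !inE /=; case: (i == j) => //=.
    by case: adjs; rewrite ?andbF.
  (* The 64 ordered pairs contain the diagonal, each missing pair in both orders and at least 48
     adjacent pairs, so at most (64 - 8 - 48)/2 = 4 pairs are missing. *)
  have : #|P| + (#|D| + (#|Q| + #|Q'|)) <= 64.
    move: d1 d2 d3; rewrite -!leq_card_setU => /eqP<- /eqP<- /eqP<-.
    by rewrite (leq_trans (max_card _)) // card_prod !card_ord.
  have : #|NA| <= #|Q| by apply: leq_imset_card.
  by rewrite cD -QQ'; move: nm; clear; lia.
have NAE : NA \subset edges (complete 8).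
  apply/subsetP => e /imsetP[[i j]]; rewrite inE /= => /andP[ij _] ->.
  by apply: edges_complete; rewrite -val_eqE /=; lia.
case: (@exists_subset_card _ NA (edges (complete 8)) 4 NAE) => [|F NAF [FE F4]].
  by rewrite NA4 four_le_edges.
exists (delete_edges F); first by exists F; split=> //; exists id => //; exists id.
have adjF i j : (i : delete_edges F) -- j -> adjs (m i) (m j).
  rewrite {1}/adj /= /delete_rel {1}/adj /= /complete_rel => /andP[ij ijF].
  apply: contraNT ijF => nadj; apply: (subsetP NAF); apply/imsetP.
  have [lt|lt|e] := ltngtP (i : nat) j; last by rewrite (val_inj e) eqxx in ij.
    by exists (i, j); rewrite // inE /= lt.
  by exists (j, i); rewrite ?inE /= ?lt 1?adjs_sym // setUC.
pose V := {v : G | [exists i, v \in m i]}.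
have ex (v : V) : exists i, val v \in m i by apply/existsP: (valP v).
pose phi (v : V) : delete_edges F := xchoose (ex v).
have phiP (v : V) : val v \in m (phi v) by apply: (xchooseP (ex v)).
have phiU (v : V) i : val v \in m i -> phi v = i.
  move=> vi; apply/eqP; apply: contraT => ne.
  by have := disjointFr (dm _ _ ne) (phiP v); rewrite vi.
pose r : rel V := fun u v => (val u -- val v) && ((phi u == phi v) || (phi u -- phi v)).
have rsym : symmetric r.
  by move=> u v; rewrite /r adj_sym eq_sym (adj_sym (phi u)).
have rirr : irreflexive r by move=> u; rewrite /r adj_irrefl.
pose S := SGraph rsym rirr.
have inm v i : v \in m i -> {u : S | val u = v}.
  by move=> vi; exists (Sub v (introT existsP (ex_intro _ i vi)) : V).
have [S' [cS iS]] : exists S', contracts_to S S' /\ iso S' (delete_edges F).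
  apply: (@contracts_quotient S _ phi).
  - move=> i; case: (cm i) => /set0Pn[v vi] _; case: (inm v i vi) => u uv; exists u.
    by apply: phiU; rewrite uv.
  - move=> i; split.
      case: (cm i) => /set0Pn[v vi] _; case: (inm v i vi) => u uv.
      by apply/set0Pn; exists u; rewrite inE; apply/eqP/phiU; rewrite uv.
    move=> X /set0Pn[a]; rewrite !inE => /andP[/eqP pa aX] /set0Pn[b].
    rewrite !inE => /andP[bX /eqP pb].
    case: (cm i) => _ /(_ [set val u | u in X])[||u [v []]].
    + apply/set0Pn; exists (val a); rewrite !inE -{1}pa phiP /=.
      by apply/imsetP; exists a.
    + apply/set0Pn; exists (val b); rewrite !inE -{1}pb phiP andbT.
      by apply: contra bX => /imsetP[c cX /val_inj->].
    move=> /setIP[ui uX] /setDP[vi vX] uv; case/imsetP: uX => u' u'X eu; subst u.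
    case: (inm v i vi) => v' ev; subst v; exists u', v'.
    have pu' : phi u' = i by apply: phiU.
    have pv' : phi v' = i by apply: phiU.
    rewrite !inE pu' pv' eqxx u'X /=; split=> //.
      by rewrite andbT; apply: contra vX => v'X; apply/imsetP; exists v'.
    by rewrite /adj /= /r uv pu' pv' eqxx.
  - by move=> u v; rewrite {1}/adj /= /r => /andP[_ /orP[->|]].
  - move=> i j ij; case/adjsP: (adjF _ _ ij) => u [v [ui vj uv]].
    case: (inm u i ui) => u' eu; case: (inm v j vj) => v' ev; subst u v.
    have pu' : phi u' = i by apply: phiU.
    have pv' : phi v' = j by apply: phiU.
    by exists u', v'; split=> //; rewrite /adj /= /r uv pu' pv' ij orbT.
exists S, S'; split=> //; exists val; first exact: val_inj.
by move=> u v; rewrite {1}/adj /= /r => /andP[].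
Qed.

(** * Counting edges *)

Lemma card_disjU (T : finType) (A B : {set T}) : [disjoint A & B] -> #|A :|: B| = #|A| + #|B|.
Proof. by move=> d; have [_] := leq_card_setU A B; rewrite d => /eqP. Qed.

Section Nbr.
Variable G : sgraph.
Implicit Types (A B X : {set G}) (u v w x y z : G).

Definition nbr x := [set y | x -- y].
(** Twice the number of edges inside [A]; the factor two is carried through all later bounds. *)
Definition esum A := \sum_(v in A) #|nbr v :&: A|.

Lemma nbrE x y : (y \in nbr x) = x -- y.
Proof. by rewrite inE. Qed.

Lemma nbr_irr x : x \in nbr x = false.
Proof. by rewrite inE adj_irrefl. Qed.

Definition degs A B := \sum_(v in A) #|nbr v :&: B|.

Lemma degs_sum A B : degs A B = \sum_(u in A) \sum_(v in B) (u -- v : nat).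
Proof.
apply: eq_bigr => u _; rewrite -sum1_card big_mkcond [RHS]big_mkcond /=.
by apply: eq_bigr => v _; rewrite !inE; case: (v \in B); rewrite ?andbF ?andbT //; case: (u -- v).
Qed.

Lemma degs_sym A B : degs A B = degs B A.
Proof.
rewrite !degs_sum exchange_big; apply: eq_bigr => u _; apply: eq_bigr => v _.
by rewrite adj_sym.
Qed.

Lemma degsUl A B X : [disjoint A & B] -> degs (A :|: B) X = degs A X + degs B X.
Proof.
move=> d; rewrite /degs -bigU //; by apply: eq_bigl => v; rewrite !inE.
Qed.

Lemma degsUr A B X : [disjoint A & B] -> degs X (A :|: B) = degs X A + degs X B.
Proof. by move=> d; rewrite degs_sym degsUl // !(degs_sym X). Qed.

Lemma esumU A B : [disjoint A & B] -> esum (A :|: B) = esum A + esum B + 2 * degs A B.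
Proof.
move=> d; rewrite -[esum _]/(degs _ _) degsUl // !degsUr // -/(esum A) (degs_sym B A).
rewrite -[degs A A]/(esum A) -[degs B B]/(esum B); lia.
Qed.

Lemma esum1 x : esum [set x] = 0.
Proof.
rewrite /esum big_set1; apply/eqP; rewrite cards_eq0; apply/eqP/setP => y.
by rewrite !inE; case: eqP => [->|]; rewrite ?adj_irrefl ?andbF.
Qed.

Lemma esumD1 A x : x \in A -> esum A = esum (A :\ x) + 2 * #|nbr x :&: A|.
Proof.
move=> xA; rewrite -{1}(setD1K xA) esumU; last by rewrite disjoints1 !inE eqxx.
rewrite esum1 add0n; congr (_ + 2 * _); rewrite /degs big_set1; apply: eq_card => y.
by rewrite !inE; case: eqP => [->|]; rewrite ?adj_irrefl.
Qed.

Lemma esum_le A : esum A <= #|A| * #|A|.-1.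
Proof.
rewrite /esum -sum_nat_const; apply: leq_sum => v vA.
rewrite (cardsD1 v A) vA /=; apply: subset_leq_card; apply/subsetP => y.
by rewrite !inE => /andP[vy ->]; rewrite andbT; apply: contraTneq vy => ->; rewrite adj_irrefl.
Qed.

Lemma degsTr A : degs A setT = \sum_(v in A) #|nbr v|.
Proof. by apply: eq_bigr => v _; rewrite setIT. Qed.

End Nbr.

(* Minors whose branch sets are indexed by a set of vertices of [G]. *)
Section Rooted.
Variables (G : sgraph) (A : {set G}) (B : G -> {set G}) (R : rel G).

Definition rooted := [/\ {in A, forall c, conn (B c)},
  {in A &, forall c d, c != d -> [disjoint B c & B d]}
  & {in A &, forall c d, R c d -> c != d /\ adjs (B c) (B d)}].

(** Symmetrised, so that [R] may list an adjacency in one order only. Adjacencies that [R] omits are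
    dropped, which is harmless because only lower bounds on the number of edges are drawn from the
    model. *)
Definition rooted_rel : rel {c | c \in A} := fun u v => (u != v) && (R (val u) (val v) || R (val v) (val u)).

Lemma rooted_sym : symmetric rooted_rel.
Proof. by move=> u v; rewrite /rooted_rel eq_sym orbC. Qed.

Lemma rooted_irr : irreflexive rooted_rel.
Proof. by move=> u; rewrite /rooted_rel eqxx. Qed.

Definition rooted_graph := SGraph rooted_sym rooted_irr.

Lemma rooted_model : rooted -> model (fun c : rooted_graph => B (val c)).
Proof.
case=> cB dB aB; split.
- by move=> c; apply: cB; apply: valP.
- by move=> c d cd; apply: dB; rewrite ?(valP c) ?(valP d).
- move=> c d /andP[_ /orP[]] => /aB; first by case; rewrite ?(valP c) ?(valP d).
  by case; rewrite ?(valP c) ?(valP d) // adjs_sym.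
Qed.

Lemma rooted_card : #|rooted_graph| = #|A|.
Proof. by rewrite card_sig; apply: eq_card. Qed.

Lemma rooted_esum : rooted ->
  \sum_(c in A) #|[set d in A | R c d]| <= esum [set: rooted_graph].
Proof.
case=> _ _ aB; rewrite /esum big_sub /= big_set /=.
apply: leq_sum => c _; rewrite setIT -(card_imset _ val_inj).
apply: subset_leq_card; apply/subsetP => d; rewrite inE => /andP[dA cd].
apply/imsetP; exists (Sub d dA : rooted_graph) => //=; rewrite inE /adj /= /rooted_rel /= cd andbT.
by case: (aB _ _ (valP c) dA cd) => ne _; rewrite -val_eqE /=.
Qed.
End Rooted.

(** * Minimal dense graphs *)

Definition cn (G : sgraph) (x : G) : {set G} := x |: nbr x.

Lemma cnE (G : sgraph) (x y : G) : (y \in cn x) = (y == x) || (x -- y).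
Proof. by rewrite !inE. Qed.

Lemma card_cn (G : sgraph) (x : G) : #|cn x| = #|nbr x|.+1.
Proof. by rewrite cardsU1 nbr_irr. Qed.

(* [esum] is twice the number of edges, so this describes a vertex-minimal
   counterexample to: [n >= 8] and [e >= 9n/2 - 12] imply a K_8^{-4} minor;
   its edges are deleted as long as the bound holds. *)
Definition minimal_dense (G : sgraph) := [/\ 9 <= #|G|, 9 * #|G| <= esum [set: G] + 24,
  esum [set: G] + 24 <= 9 * #|G| + 1
  & forall (H : sgraph) (m : H -> {set G}), model m ->
    8 <= #|H| -> #|H| < #|G| -> esum [set: H] + 24 < 9 * #|H|].

Section MinimalDense.
Variable G : sgraph.
Hypothesis mG : minimal_dense G.
Let n9 : 9 <= #|G|. Proof. by case: mG. Qed.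
Let flo : 9 * #|G| <= esum [set: G] + 24. Proof. by case: mG. Qed.
Let fhi : esum [set: G] + 24 <= 9 * #|G| + 1. Proof. by case: mG. Qed.
Implicit Types (A B D : {set G}) (u v w x y z : G).

Lemma min_rooted A (B : G -> {set G}) (R : rel G) : rooted A B R -> 8 <= #|A| -> #|A| < #|G| ->
  \sum_(c in A) #|[set d in A | R c d]| + 24 < 9 * #|A|.
Proof.
move=> r; rewrite -(rooted_card A R) => h1 h2.
by case: mG => _ _ _ /(_ _ _ (rooted_model r) h1 h2); have := rooted_esum r; lia.
Qed.

(** The minor keeps [A] and contracts [D] into [c]. Every neighbour that [c] gains in this way is
    counted from both ends, hence the factor 2. *)
Lemma min_contract A c D : c \in A -> [disjoint A & D] -> conn (c |: D) ->
  8 <= #|A| -> #|A| < #|G| ->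
  esum A + 2 * #|[set w in A :\ c | ~~ (c -- w) && adjs [set w] D]| + 24 < 9 * #|A|.
Proof.
move=> cA AD cD h1 h2; set W := [set w in _ | _].
have nD v : v \in A -> v \in D = false by move/(disjointFr AD).
pose B u := if u == c then c |: D else [set u].
pose R u v := [|| u -- v, (u == c) && (v \in W) | (v == c) && (u \in W)].
have r : rooted A B R.
  split.
  - by move=> u uA; rewrite /B; case: eqP => // _; apply: conn1.
  - move=> u v uA vA uv; apply/pred0P => t; rewrite /B /=; apply/negP.
    have [eu|nu] := eqVneq u c; have [ev|nv] := eqVneq v c; rewrite !inE => /andP[].
    + by rewrite eu ev eqxx in uv.
    + by move=> /orP[/eqP->|tD] /eqP et; [rewrite -et eqxx in nv|rewrite et nD in tD].
    + by move=> /eqP et /orP[/eqP et'|tD]; [rewrite -et et' eqxx in nu|rewrite et nD in tD].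
    + by move=> /eqP-> /eqP e; rewrite e eqxx in uv.
  - have adjB u v : u \in B u -> v \in B v -> u -- v -> adjs (B u) (B v).
      by move=> uB vB uv; apply/adjsP; exists u, v.
    have inB u : u \in B u by rewrite /B; case: eqP => [->|_]; rewrite !inE eqxx.
    have Wadj w : w \in W -> c != w /\ adjs (B c) (B w).
      rewrite !inE => /andP[/andP[nwc _] /andP[_ aw]]; split; first by rewrite eq_sym.
      by rewrite /B eqxx (negPf nwc) adjs_sym; apply: adjs_sub aw => //; apply: subsetUr.
    move=> u v uA vA /or3P[uv|/andP[/eqP-> /Wadj //]|/andP[/eqP-> /Wadj[ne a]]].
      by rewrite adj_neq //; split=> //; apply: adjB.
    by rewrite eq_sym adjs_sym.
have H0 := min_rooted r h1 h2.
suff: esum A + 2 * #|W| <= \sum_(u in A) #|[set v in A | R u v]| by lia.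
rewrite /esum (bigD1 c cA) [X in _ <= X](bigD1 c cA) /=.
have cW : c \notin W by rewrite !inE eqxx.
have sWA : W \subset A by apply/subsetP => w; rewrite !inE => /andP[/andP[]].
have E1 : #|nbr c :&: A| + #|W| <= #|[set v in A | R c v]|.
  have d : [disjoint nbr c :&: A & W].
    by apply/pred0P => w; rewrite /= !inE; case: (c -- w); rewrite ?andbF //= ?andbF.
  rewrite -card_disjU //.
  apply: subset_leq_card; apply/subsetP => w; rewrite [in X in _ -> X]inE /R eqxx !inE.
  case/orP=> [/andP[-> ->]//|/andP[/andP[-> ->]] /andP[-> ->]].
  by rewrite !orbT.
have E2 : \sum_(i in A | i != c) #|nbr i :&: A| + #|W| <= \sum_(i in A | i != c) #|[set v in A | R i v]|.
  have -> : #|W| = \sum_(i in A | i != c) (i \in W : nat).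
    rewrite -sum1_card big_mkcond [RHS]big_mkcond /=; apply: eq_bigr => i _.
    have [iW|] := boolP (i \in W); last by case: ifP.
    have ic : i != c by apply/eqP => e; move: iW; rewrite e (negPf cW).
    by rewrite (subsetP sWA) // ic.
  rewrite -big_split; apply: leq_sum => i /andP[iA ic] /=.
  have [iW|iW] := boolP (i \in W); last first.
    rewrite addn0; apply: subset_leq_card; apply/subsetP => v.
    by rewrite !inE /R => /andP[-> ->].
  rewrite addn1; have cNi : c \notin nbr i :&: A.
    by move: iW; rewrite !inE adj_sym => /andP[_ /andP[/negPf-> _]].
  have := cardsU1 c (nbr i :&: A); rewrite cNi add1n => <-.
  apply: subset_leq_card; apply/subsetP => v; rewrite in_setU1 in_setI inE /R.
  case/orP=> [/eqP->|/andP[vi ->]]; first by rewrite cA eqxx iW !orbT.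
  by rewrite -nbrE vi.
apply: leq_trans (leq_add E1 E2); rewrite mul2n -addnn addnACA; exact: leqnn.
Qed.

Lemma min_induced A : 8 <= #|A| -> #|A| < #|G| -> esum A + 24 < 9 * #|A|.
Proof.
move=> h1 h2; have /card_gt0P[c cA] : 0 < #|A| by lia.
have := @min_contract A c set0 cA _ _ h1 h2; rewrite setU0.
move/(_ _ (conn1 c)); rewrite disjoint_sym disjoints_subset sub0set => /(_ isT); lia.
Qed.

(** With t common neighbours of [u] and [v], contracting the edge loses one vertex and 1 + t edges,
    so minimality forces 2(1 + t) > 9. *)
Lemma min_triangles u v : u -- v -> 4 <= #|nbr u :&: nbr v|.
Proof.
move=> uv; have nuv := adj_neq uv.
have cC : #|[set~ v]| = #|G|.-1 by rewrite cardsC1.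
set W := [set w in [set~ v] :\ u | ~~ (u -- w) && adjs [set w] [set v]].
have H : esum [set~ v] + 2 * #|W| + 24 < 9 * #|[set~ v]|.
  apply: min_contract; rewrite ?cC; try lia; last exact: conn2.
    by rewrite !inE.
  by rewrite disjoint_sym disjoints1 !inE eqxx.
have := @esumD1 G setT v (in_setT v); rewrite setIT -[setT :\ v]/(setT :\: [set v]) setTD => E.
have : #|nbr v| <= #|u |: (nbr u :&: nbr v) :|: W|.
  apply: subset_leq_card; apply/subsetP => w; rewrite !inE adjs11 (adj_sym w) => vw.
  have wv : w != v by rewrite eq_sym adj_neq.
  by rewrite vw wv; case: eqP => //= _; case: (u -- w).
have := (leq_card_setU (u |: (nbr u :&: nbr v)) W).1.
rewrite cardsU1; have := leq_b1 (u \notin nbr u :&: nbr v); lia.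
Qed.

(** Deleting [v] has to lose more than 9/2 edges, as otherwise the rest would still satisfy the
    bound. *)
Lemma min_degree v : 5 <= #|nbr v|.
Proof.
have cC : #|[set~ v]| = #|G|.-1 by rewrite cardsC1.
have H := @min_induced [set~ v]; rewrite cC in H.
have := @esumD1 G setT v (in_setT v); rewrite setIT -[setT :\ v]/(setT :\: [set v]) setTD => E.
lia.
Qed.

Lemma min_low : exists v, #|nbr v| <= 8.
Proof.
have [/existsP[v v8]|/existsPn H] := boolP [exists v : G, #|nbr v| <= 8]; first by exists v.
suff : 9 * #|G| <= esum [set: G] by lia.
have -> : 9 * #|G| = \sum_(v in [set: G]) 9 by rewrite sum_nat_const cardsT mulnC.
apply: leq_sum => v _.
by rewrite setIT; have := H v; lia.
Qed.

(** A vertex of degree at most 8 adjacent to all others forces nine vertices; if all low vertices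
    were of this kind, the graph would be [K_9], whose degree sum 72 exceeds the upper bound 58. The
    smallest component is the extremal choice on which [clone_structure] rests. *)
Lemma min_pair : exists x z, [/\ #|nbr x| <= 8, z \notin cn x &
  forall x' z', #|nbr x'| <= 8 -> z' \notin cn x' -> #|component (~: cn x) z| <= #|component (~: cn x') z'|].
Proof.
pose P (p : G * G) := (#|nbr p.1| <= 8) && (p.2 \notin cn p.1).
have [p0 Pp0] : exists p, P p.
  case: min_low => v v8; have [/existsP[z zv]|/existsPn all] := boolP [exists z, z \notin cn v].
    by exists (v, z); rewrite /P v8.
  have n9' : #|G| = 9.
    have : #|G| <= #|cn v|.
      by apply: subset_leq_card; apply/subsetP => z _; have := all z; rewrite negbK.
    by rewrite card_cn; lia.
  have [/existsP[[u z] Pz]|/existsPn all'] := boolP [exists p, P p]; first by exists (u, z).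
  have deg u : #|nbr u| = 8.
    have l8 : #|nbr u| <= 8.
      have : #|nbr u| < #|G|; last by lia.
      rewrite -(cardsT G); apply: proper_card; rewrite properT; apply/eqP => /setP/(_ u).
      by rewrite nbr_irr inE.
    have : #|G| <= #|cn u|; last by rewrite card_cn; lia.
    apply: subset_leq_card; apply/subsetP => z _; have := all' (u, z).
    by rewrite /P /= l8 negbK.
  have : esum [set: G] = 9 * 8; last by lia.
  have -> : 9 * 8 = \sum_(v in [set: G]) 8 by rewrite sum_nat_const cardsT n9'.
  apply: eq_bigr => u _.
  by rewrite setIT deg.
case: (@arg_minnP _ p0 P (fun p => #|component (~: cn p.1) p.2|) Pp0) => -[x z] /andP[/= x8 zx] min.
exists x, z; split=> // x' z' x8' zx'; apply: (min (x', z')).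
by rewrite /P x8'.
Qed.

End MinimalDense.

Section LowVertices.
Variable G : sgraph.
Hypothesis mG : minimal_dense G.
Implicit Types (A B D : {set G}) (u v w x y z : G).

Lemma component_nbr A z u v : z \in A -> u \in component A z -> u -- v -> v \notin component A z -> v \notin A.
Proof. by move=> zA uC uv; apply: contra => vA; apply: component_closed uv. Qed.

(** Suppose all degrees in the component [K] are at least 9. Its neighbourhood [S] has at most eight
    vertices and many inner edges, because edges at [x] lie in four triangles; the density bounds
    for [K :|: S] and [K] then contradict each other. *)
Lemma low_in_component x z : #|nbr x| <= 8 -> z \notin cn x ->
  exists2 y, y \in component (~: cn x) z & #|nbr y| <= 8.
Proof.
move=> x8; rewrite -in_setC => zC; set K := component _ z.
have [/existsP[y /andP[yK y8]]|/existsPn nlow] := boolP [exists y, (y \in K) && (#|nbr y| <= 8)].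
  by exists y.
have deg9 v : v \in K -> 9 <= #|nbr v|.
  by move=> vK; have := nlow v; rewrite vK /= ltnNge.
have KC : K \subset ~: cn x := component_sub zC.
pose S := [set v | (v \notin K) && adjs [set v] K].
have SN : S \subset nbr x.
  apply/subsetP => v; rewrite !inE adjs1 => /andP[vK /existsP[u /andP[uK vu]]].
  have := component_nbr zC uK _ vK; rewrite adj_sym => /(_ vu); rewrite !inE negbK.
  case/orP=> // /eqP ev; have := subsetP KC _ uK; by rewrite !inE -ev vu orbT.
have nbrKS v : v \in K -> nbr v \subset K :|: S.
  move=> vK; apply/subsetP => w; rewrite !inE => vw; case: (w \in K) => //=.
  by rewrite adjs1; apply/existsP; exists v; rewrite vK adj_sym.
have KS : [disjoint K & S].
  by apply/pred0P => v; rewrite /= [v \in S]inE; case: (v \in K).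
have xKS : x \notin K :|: S.
  rewrite inE negb_or; apply/andP; split; last by apply/negP => /(subsetP SN); rewrite nbr_irr.
  by apply/negP => /(subsetP KC); rewrite !inE eqxx.
have s8 : #|S| <= 8 by apply: leq_trans x8; apply: subset_leq_card.
have cKS : #|K :|: S| = #|K| + #|S| by rewrite card_disjU.
have nKS : #|K :|: S| < #|G|.
  rewrite -cardsT; apply: proper_card; rewrite properT; apply: contraNneq xKS => ->.
  by rewrite inE.
have [z9 zK] : 9 <= #|nbr z| /\ z \in K by have := component_self (~: cn x) z; split=> //; apply: deg9.
have ks10 : 10 <= #|K| + #|S|.
  have : #|cn z| <= #|K :|: S| by apply: subset_leq_card; rewrite subUset sub1set inE zK nbrKS.
  by rewrite card_cn; lia.
have k0 : 0 < #|K| by apply/card_gt0P; exists z.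
have eS : #|S| * (#|S| - 4) <= esum S.
  rewrite /esum -sum_nat_const; apply: leq_sum => v vS.
  have vx : x -- v by move: (subsetP SN _ vS); rewrite inE.
  have t4 := min_triangles mG vx.
  have : #|nbr x :&: nbr v| <= #|(nbr v :&: S) :|: (nbr x :\: S)|.
    apply: subset_leq_card; apply/subsetP => w; rewrite inE => /andP[wx wv].
    by rewrite in_setU in_setI in_setD wv wx; case: (w \in S).
  have := (leq_card_setU (nbr v :&: S) (nbr x :\: S)).1.
  rewrite (cardsD (nbr x)) (setIidPr SN); lia.
have eK : esum K + degs K S = degs K setT.
  rewrite -[esum K]/(degs K K) -degsUr //; apply: eq_bigr => v vK.
  by rewrite setIT (setIidPl (nbrKS _ vK)).
have dK : 9 * #|K| <= degs K setT.
  by rewrite degsTr mulnC -sum_nat_const; apply: leq_sum.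
have h1 : esum (K :|: S) + 24 < 9 * #|K :|: S| by apply: min_induced; rewrite // cKS; lia.
rewrite esumU // cKS in h1.
(* Let k and s be the sizes of [K] and [S], and d the value of [degs K S]. Degrees at least 9 turn
   the bound for [K :|: S] into d + s(s - 4) + 24 < 9s. If k >= 8, the bound for [K] gives d > 24;
   if k < 8, counting gives d >= k(10 - k). Neither is possible with s <= 8 and k + s >= 10. *)
have [k8|k8] := leqP 8 #|K|.
  have h2 : esum K + 24 < 9 * #|K| by apply: min_induced => //; rewrite cKS in nKS; lia.
  move: (esum S) (esum K) (degs K S) (degs K setT) #|K| #|S| s8 eS eK dK h1 h2 {nKS cKS ks10 k8 k0} => a b c d k s.
  by do 9 (case: s => [|s]; first by lia).
have h2 := esum_le K.
move: (esum S) (esum K) (degs K S) (degs K setT) #|K| #|S| s8 eS eK dK h1 h2 k8 ks10 k0 {nKS cKS} => a b c d k s.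
by do 9 (case: s => [|s]; first by do 8 (case: k => [|k]; first by lia); lia).
Qed.

(* [y] has minimum degree in the smallest component [K] of a graph [G - cn x] with [x] of degree at most 8:
   a neighbour of [y] without neighbours in the component of [x] would otherwise give a smaller component. *)
Lemma clone_structure : exists y x, [/\ #|nbr y| <= 8, x \notin cn y &
  forall v, y -- v -> ~~ adjs [set v] (component (~: cn y) x) -> cn v = cn y].
Proof.
have [x [z [x8 zx min]]] := min_pair mG.
have zC : z \in ~: cn x by rewrite inE.
set K := component (~: cn x) z in min.
have KC : K \subset ~: cn x := component_sub zC.
case: (low_in_component x8 zx) => y0 y0K y08.
case: (@arg_minnP _ y0 (mem K) (fun y => #|nbr y|) y0K) => y yK miny.
have y8 : #|nbr y| <= 8 by apply: leq_trans y08; apply: miny.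
have xy : x \notin cn y.
  by have := subsetP KC _ yK; rewrite !inE !negb_or eq_sym adj_sym.
have xC : x \in ~: cn y by rewrite inE.
exists y, x; split=> // v yv; set K' := component _ x => nadj.
have nx w : w \in nbr x -> w \notin cn y -> w \in K'.
  rewrite inE => xw wy; apply: component_closed xC (component_self _ _) _ xw.
  by rewrite inE.
have nv w : v -- w -> w \notin K'.
  by move=> vw; apply: contra nadj => wK'; rewrite adjs1; apply/existsP; exists w; rewrite wK'.
have vx : v \notin cn x.
  rewrite !inE negb_or; apply/andP; split.
    by apply: contraNneq xy => <-; rewrite !inE yv orbT.
  by apply/negP => xv; have := nv x; rewrite adj_sym => /(_ xv); rewrite component_self.
have vK : v \in K by apply: component_closed yv => //; rewrite inE.
have sub : cn v \subset cn y.
  apply/subsetP => w; rewrite cnE => /orP[/eqP->|vw]; first by rewrite !inE yv orbT.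
  apply: contraT => wy; have wK' := nv _ vw.
  have wC : w \in ~: cn y by rewrite inE.
  (* A vertex of [cn x] outside [cn y] lies in [K'], so [K2] avoids [cn x]. Hence [K2] sits inside
     [K] and misses [y], against the choice of [K]. *)
  set K2 := component (~: cn y) w.
  have K2x u : u \in K2 -> u \notin cn x.
    move=> uK2; apply/negP => ux; have uC := subsetP (component_sub wC) _ uK2.
    have uK' : u \in K'.
      by move: ux; rewrite cnE => /orP[/eqP->|xu]; [exact: component_self|apply: nx; [by rewrite inE|by move: uC; rewrite in_setC]].
    by case/negP: wK'; rewrite /K' -(component_eq xC uK') (component_eq wC uK2) component_self.
  have wK : w \in K.
    by apply: component_closed vK _ vw => //; rewrite inE K2x // component_self.
  have K2K : K2 \subset K.
    rewrite /K -(component_eq zC wK); apply: component_max; first by rewrite inE K2x // component_self.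
    - exact: component_conn.
    - by apply/subsetP => u uK2; rewrite inE K2x.
    - exact: component_self.
  have : #|K2| < #|K|.
    apply: proper_card; apply/properP; split=> //; exists y => //.
    by apply/negP => /(subsetP (component_sub wC)); rewrite !inE eqxx.
  by rewrite ltnNge (min y w).
apply/eqP; rewrite eqEcard sub !card_cn ltnS; exact: miny.
Qed.

End LowVertices.

(** * Selection in the neighbourhood of a low-degree vertex *)

Lemma hasK_eight (H : sgraph) : #|H| = 8 -> 48 <= esum [set: H] -> hasK H.
Proof.
move=> H8 e48; pose f (i : 'I_8) : H := enum_val (cast_ord (esym H8) i).
have fI : injective f by move=> i j /enum_val_inj /cast_ord_inj.
have [g fK gK] : bijective f by apply: inj_card_bij => //; rewrite card_ord H8.
exists (fun i => [set f i]); split.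
- by move=> i; exact: conn1.
- move=> i j ij; apply/pred0P => z /=; apply/negP; rewrite !inE => /andP[/eqP-> /eqP /fI e].
  by rewrite e eqxx in ij.
- apply: leq_trans e48 _.
  have -> : esum [set: H] = #|[set p : H * H | p.1 -- p.2]|.
    transitivity (\sum_(u : H) \sum_(v : H | u -- v) 1).
      rewrite /esum big_set /=; apply: eq_bigr => u _.
      by rewrite setIT -sum1_card; apply: eq_bigl => v; rewrite inE.
    by rewrite pair_big_dep /= -sum1_card; apply: eq_bigl => p; rewrite inE.
  have I2 : injective (fun p : H * H => (g p.1, g p.2)).
    by move=> [a b] [c d] /= [/(can_inj gK)-> /(can_inj gK)->].
  rewrite -(card_imset _ I2); apply: subset_leq_card; apply/subsetP => q /imsetP[[u v]].
  by rewrite !inE /= => uv ->; rewrite /= !gK adjs11 uv andbT (inj_eq (can_inj gK)) adj_neq.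
Qed.

Lemma hasK_rooted (G : sgraph) (A : {set G}) B (R : rel G) : rooted A B R -> #|A| = 8 ->
  \sum_(c in A) #|[set d in A :\ c | ~~ R c d]| <= 8 -> hasK G.
Proof.
move=> r A8 miss; apply: (hasK_model (rooted_model r)); apply: hasK_eight.
  by rewrite rooted_card.
apply: leq_trans (rooted_esum r).
suff : \sum_(c in A) #|[set d in A :\ c | ~~ R c d]| + \sum_(c in A) #|[set d in A | R c d]| = 8 * 7 by lia.
rewrite -big_split /= -{1}A8 -sum_nat_const; apply: eq_bigr => c cA.
case: r => _ _ rA.
have -> : 7 = #|A :\ c| by have := cardsD1 c A; rewrite cA A8 => -[].
rewrite -card_disjU; last first.
  by apply/pred0P => d; rewrite /= !inE; case: (R c d); rewrite ?andbF ?andbT //= ?andbF.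
apply: eq_card => d; rewrite !inE.
have [dA|] := boolP (d \in A); rewrite ?andbF ?andbT //=.
have [Rcd|] := boolP (R c d); last by rewrite andbT orbF.
by rewrite orbT eq_sym; case: (rA _ _ cA dA Rcd) => ->.
Qed.

(** Every neighbour of [a] spends one of its edges on [a], and the others bound the edges to the
    non-neighbours of [a]; counted from the other end these are the common neighbours. The use is
    averaging: some non-neighbour of [a] has many neighbours and shares few of them with [a]. *)
Lemma nonnbr_sum (C : sgraph) (N : {set C}) a : a \in N ->
  esum N + \sum_(b in N :\: cn a) #|nbr a :&: nbr b :&: N| <=
  \sum_(b in N :\: cn a) #|nbr b :&: N| + 2 * \sum_(c in nbr a :&: N) #|nbr c :&: N|.
Proof.
pose d v := #|nbr v :&: N|; pose T a b := nbr a :&: nbr b :&: N.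
pose D a := \sum_(c in nbr a :&: N) d c.
change (a \in N -> esum N + \sum_(b in N :\: cn a) #|T a b| <= \sum_(b in N :\: cn a) d b + 2 * D a).
move=> aN; set Ba := N :\: cn a.
have e1 : esum N = d a + D a + \sum_(b in Ba) d b.
  rewrite /esum (bigD1 a aN) /= -addnA; congr (_ + _); rewrite -/(esum _) /D.
  rewrite (bigID (fun v => a -- v)) /=; congr (_ + _); apply: eq_bigl => v; rewrite !inE.
    by case: (v =P a) => [->|_]; rewrite ?adj_irrefl ?andbF ?andbT //; exact: andbC.
  transitivity ((v \in N) && (v != a) && ~~ (a -- v)) => //.
  by case: (v \in N); case: (v == a); case: (a -- v).
have e2 : \sum_(b in Ba) #|T a b| = \sum_(c in nbr a :&: N) #|nbr c :&: Ba|.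
  rewrite -[RHS]/(degs _ _) degs_sym; apply: eq_bigr => b bB; apply: eq_card => c.
  by rewrite !inE; case: (a -- c); case: (b -- c).
have e3 : \sum_(c in nbr a :&: N) #|nbr c :&: Ba| + d a <= D a.
  rewrite /D /d -sum1_card -big_split; apply: leq_sum => c; rewrite !inE => /andP[ac cN].
  rewrite [X in X <= _]addn1; have aB : a \notin nbr c :&: Ba by rewrite !inE eqxx andbF.
  have := cardsU1 a (nbr c :&: Ba); rewrite aB add1n => <-; apply: subset_leq_card.
  apply/subsetP => v; rewrite !inE => /orP[/eqP->|/and3P[-> _ ->] //].
  by rewrite adj_sym ac aN.
by rewrite e2; lia.
Qed.


Lemma esum_even (G : sgraph) (A : {set G}) : exists k, esum A = k.*2.
Proof.
move: {2}#|A| (erefl #|A|) => n; elim: n A => [|n IH] A An.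
  by exists 0; rewrite (cards0_eq An) /esum big_set0.
have /card_gt0P[x xA] : 0 < #|A| by rewrite An.
case: (IH (A :\ x)) => [|k ek]; first by have := cardsD1 x A; rewrite xA An; case.
by exists (k + #|nbr x :&: A|); rewrite (esumD1 xA) ek; lia.
Qed.

(* In a graph [C] of maximum degree 3 on eight vertices, identifying suitable
   non-adjacent [a], [b] and deleting [c] leaves at most four edges. *)
Section CubicSelection.
Variables (C : sgraph) (N : {set C}).
Hypothesis N8 : #|N| = 8.
Hypothesis deg3 : forall v, v \in N -> #|nbr v :&: N| <= 3.
Let d (v : C) := #|nbr v :&: N|.
Let T (a b : C) := nbr a :&: nbr b :&: N.

Lemma esum_two a b : a \in N -> b \in N -> a != b -> ~~ (a -- b) ->
  esum N = esum (N :\ a :\ b) + 2 * d a + 2 * d b.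
Proof.
move=> aN bN ab nab; rewrite (esumD1 aN) (@esumD1 _ (N :\ a) b); last by rewrite !inE eq_sym ab.
suff -> : nbr b :&: (N :\ a) = nbr b :&: N by rewrite /d; lia.
apply/setP => v; rewrite !inE; case: (v =P a) => [->|//]; by rewrite adj_sym (negPf nab) andbF.
Qed.

(** Deleting [c] saves twice its degree in the rest, plus 2 if it lies in [T a b]; [k] measures the
    saving that brings the count down to 8. In the application [C] is a complement, and positive
    degree shows that [c] has a neighbour in the outer component. *)
Lemma select_c a b k : a \in N -> b \in N -> a != b -> ~~ (a -- b) ->
  (exists2 c, c \in N :\ a :\ b & k <= #|nbr c :&: (N :\ a :\ b)| + (c \in T a b) /\ 0 < d c) ->
  esum (N :\ a :\ b) + 2 * #|T a b| <= 8 + 2 * k ->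
  exists2 c, c \in N :\ a :\ b & 0 < d c /\ esum (N :\ a :\ b :\ c) + 2 * #|T a b :\ c| <= 8.
Proof.
move=> aN bN ab nab [c cX [kc dc]] le; exists c => //; split=> //.
move: le; rewrite (esumD1 cX) (cardsD1 c (T a b)); lia.
Qed.

(** Three ranges of the count: up to 8 any [c] with an edge does, up to 10 one of weight 1, up to 12
    one of weight 2. In the last range the weights of the six vertices sum to at least 11 - 3 = 8 >
    6, as [T a b] has at most three elements. *)
Lemma select_pair a b : 10 <= esum N -> a \in N -> b \in N -> a != b -> ~~ (a -- b) ->
  esum (N :\ a :\ b) + 2 * #|T a b| <= 12 ->
  exists2 c, c \in N :\ a :\ b & 0 < d c /\ esum (N :\ a :\ b :\ c) + 2 * #|T a b :\ c| <= 8.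
Proof.
move=> N10 aN bN ab nab le; set X := N :\ a :\ b in le *.
have TX : T a b \subset X.
  apply/subsetP => v; rewrite !inE => /andP[/andP[av bv] ->].
  by rewrite andbT; apply/andP; split; apply/eqP => e; subst v; rewrite adj_irrefl in av bv.
have XN : X \subset N by apply/subsetP => v; rewrite !inE => /and3P[].
have X6 : #|X| = 6.
  have bNa : b \in N :\ a by rewrite !inE eq_sym ab.
  by have := cardsD1 a N; have := cardsD1 b (N :\ a); rewrite aN bNa N8 -/X; lia.
have dsum : \sum_(c in X) (#|nbr c :&: X| + (c \in T a b)) = esum X + #|T a b|.
  rewrite big_split /= -/(esum X); congr (_ + _).
  rewrite -sum1_card [RHS]big_mkcond [LHS]big_mkcond; apply: eq_bigr => c _.
  by have [cT|cT] := boolP (c \in T a b); [rewrite (subsetP TX) | case: ifP].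
have pos c : 0 < #|nbr c :&: X| + (c \in T a b) -> 0 < d c.
  rewrite addn_gt0 => /orP[/leq_trans|]; first by apply; apply: subset_leq_card; apply: setIS.
  rewrite lt0b !inE => /andP[/andP[ac _] _]; rewrite /d.
  by apply/card_gt0P; exists a; rewrite !inE adj_sym ac.
have T3 : #|T a b| <= 3.
  by apply: leq_trans (deg3 aN); apply: subset_leq_card; rewrite /T setIAC subsetIl.
have big k : #|X| * k < esum X + #|T a b| ->
    exists2 c, c \in X & k < #|nbr c :&: X| + (c \in T a b).
  rewrite -dsum -sum_nat_const => lt; have [/existsP[c /andP[cX kc]]|/existsPn no] :=
    boolP [exists c, (c \in X) && (k < #|nbr c :&: X| + (c \in T a b))]; first by exists c.
  move: lt; rewrite ltnNge; case/negP; apply: leq_sum => c cX.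
  by have := no c; rewrite cX /= -leqNgt.
have [small|large] := leqP (esum X + 2 * #|T a b|) 8.
  apply: (@select_c a b 0) => //.
  have [/existsP[c /andP[cX dc]]|/existsPn no] := boolP [exists c, (c \in X) && (0 < d c)].
    by exists c.
  have dX c : c \in X -> d c = 0 by move=> cX; have := no c; rewrite cX /= -leqNgt leqn0 => /eqP.
  have d0 c : c \in N -> nbr c :&: N \subset X -> d c = 0.
    move=> cN s; apply/eqP; rewrite cards_eq0 -subset0; apply/subsetP => v vc.
    have := dX _ (subsetP s _ vc); rewrite /d => /eqP; rewrite cards_eq0 => /eqP/setP/(_ c).
    by move: vc; rewrite !inE adj_sym cN => /andP[-> _].
  have da : d a = 0.
    apply: d0 => //; apply/subsetP => v; rewrite !inE => /andP[av ->]; rewrite andbT.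
    by apply/andP; split; apply/eqP => e; subst v; [rewrite (negPf nab) in av|rewrite adj_irrefl in av].
  have db : d b = 0.
    apply: d0 => //; apply/subsetP => v; rewrite !inE => /andP[bv ->]; rewrite andbT.
    by apply/andP; split; apply/eqP => e; subst v; [rewrite adj_irrefl in bv|rewrite adj_sym (negPf nab) in bv].
  have := esum_two aN bN ab nab; rewrite da db -/X; lia.
have [mid|top] := leqP (esum X + 2 * #|T a b|) 10.
  apply: (@select_c a b 1) => //; case: (big 0) => [|c cX kc]; first by lia.
  by exists c => //; split=> //; apply: pos.
apply: (@select_c a b 2) => //; case: (big 1) => [|c cX kc]; first by rewrite X6; lia.
by exists c => //; split=> //; apply: pos; lia.
Qed.

Let D (a : C) := \sum_(c in nbr a :&: N) d c.

(** A vertex of degree 3 has four non-neighbours among the eight; [nonnbr_sum] is averaged over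
    them. *)
Lemma select_b a k : a \in N -> d a = 3 -> 4 * k + 2 * D a < esum N ->
  exists b, [/\ b \in N, a != b, ~~ (a -- b) & k + #|T a b| < d b].
Proof.
move=> aN da lt.
have : esum N + \sum_(b in N :\: cn a) #|T a b| <= \sum_(b in N :\: cn a) d b + 2 * D a.
  exact: nonnbr_sum.
have B4 : #|N :\: cn a| = 4.
  rewrite cardsD N8 (_ : #|_ :&: _| = 4) // setIC /cn setIUl (setIidPl _) ?sub1set //.
  by rewrite cardsU1 !inE adj_irrefl /= [#|_|]da.
have [/existsP[b]|/existsPn no] := boolP [exists b, [&& b \in N, a != b, ~~ (a -- b) & k + #|T a b| < d b]].
  by case/and4P; exists b.
have : \sum_(b in N :\: cn a) d b <= \sum_(b in N :\: cn a) (k + #|T a b|).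
  apply: leq_sum => b; rewrite !inE negb_or => /andP[/andP[ba ab] bN].
  by have := no b; rewrite bN eq_sym ba ab /= -leqNgt.
by rewrite big_split /= sum_nat_const B4; lia.
Qed.

Lemma D_le9 a : a \in N -> D a <= 3 * d a.
Proof.
by move=> aN; rewrite mulnC -sum_nat_const; apply: leq_sum => c; rewrite inE => /andP[_ /deg3].
Qed.

Lemma big_degree k : 8 * k < esum N -> exists2 a, a \in N & k < d a.
Proof.
rewrite -N8 -sum_nat_const => lt.
have [/existsP[a /andP[aN ka]]|/existsPn no] := boolP [exists a, (a \in N) && (k < d a)]; first by exists a.
move: lt; rewrite ltnNge; case/negP; apply: leq_sum => a aN.
by have := no a; rewrite aN /= -leqNgt.
Qed.

Lemma some_nonnbr a : a \in N -> exists b, [/\ b \in N, a != b & ~~ (a -- b)].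
Proof.
move=> aN; have /card_gt0P[b] : 0 < #|N :\: cn a|.
  rewrite cardsD N8 setIC /cn setIUl (setIidPl _) ?sub1set // cardsU1.
  by have := deg3 aN; case: (_ \notin _) => /=; lia.
by rewrite !inE negb_or => /andP[/andP[ba ab] bN]; exists b; rewrite bN eq_sym ba ab.
Qed.

(** [select_pair] applies as soon as [esum N] plus twice the size of [T a b] is at most 12 + 2 [d a]
    + 2 [d b]. Up to 18 a vertex [a] of large degree works with any non-neighbour [b]. For 20, 22
    and 24 the vertex [b] is chosen with at least 1, 2 and 2 more neighbours than it shares with
    [a]. *)
Lemma cubic_selection : 10 <= esum N -> exists a b, [/\ a \in N, b \in N, a != b, ~~ (a -- b) &
  exists2 c, c \in N :\ a :\ b & 0 < d c /\ esum (N :\ a :\ b :\ c) + 2 * #|T a b :\ c| <= 8].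
Proof.
move=> N10; have [e0 ee] := esum_even N.
have Tle a b : #|T a b| <= d b.
  by apply: subset_leq_card; apply/subsetP => v; rewrite !inE => /andP[/andP[_ ->] ->].
have pair a b : a \in N -> b \in N -> a != b -> ~~ (a -- b) ->
    esum N + 2 * #|T a b| <= 12 + 2 * d a + 2 * d b ->
    exists a b, [/\ a \in N, b \in N, a != b, ~~ (a -- b) &
      exists2 c, c \in N :\ a :\ b & 0 < d c /\ esum (N :\ a :\ b :\ c) + 2 * #|T a b :\ c| <= 8].
  move=> aN bN ab nab le; exists a, b; split=> //; apply: select_pair => //.
  by have := esum_two aN bN ab nab; lia.
have e24 : esum N <= 24.
  by rewrite -[24]/(8 * 3) -N8 -sum_nat_const; apply: leq_sum => v /deg3.
have [le18|gt18] := leqP (esum N) 18.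
  have [a aN ha] : exists2 a, a \in N & esum N <= 12 + 2 * d a.
    have [l|l] := leqP (esum N) 12.
      by case: (@big_degree 0) => [|a aN _]; [lia | exists a => //; lia].
    have [l'|l'] := leqP (esum N) 16.
      by case: (@big_degree 1) => [|a aN ha]; [lia | exists a => //; lia].
    by case: (@big_degree 2) => [|a aN ha]; [lia | exists a => //; lia].
  case: (some_nonnbr aN) => b [bN ab nab]; apply: (pair a b) => //.
  by have := Tle a b; lia.
have [a1 a1N da1] : exists2 a, a \in N & 2 < d a by apply: big_degree; lia.
have [e20|n20] := eqVneq (esum N) 20.
  have da : d a1 = 3 by have := deg3 a1N; rewrite -/(d a1); lia.
  have := D_le9 a1N; case: (@select_b a1 0) => // [|b [bN ab nab hb] _]; first by have := D_le9 a1N; lia.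
  by apply: (pair a1 b) => //; lia.
have [e22|n22] := eqVneq (esum N) 22.
  (* The degrees fall short of cubic by 2 in total. If no vertex of degree 3 had a neighbour of
     smaller degree, all neighbours of a deficient vertex would be deficient, and there are too few
     of those. *)
  have [a aN [da Da]] : exists2 a, a \in N & d a = 3 /\ D a <= 8.
    have [/existsP[a /and3P[aN /eqP da Da]]|/existsPn no] :=
      boolP [exists a, [&& a \in N, d a == 3 & D a <= 8]]; first by exists a.
    have nbr3 a c : a \in N -> d a = 3 -> c \in N -> a -- c -> d c = 3.
      move=> aN da cN ac; apply/eqP; rewrite eqn_leq (deg3 cN) /=.
      have := no a; rewrite aN da eqxx /= -ltnNge => D9.
      rewrite leqNgt; apply/negP => dc.
      have cI : c \in nbr a :&: N by rewrite !inE ac.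
      move: D9; rewrite ltnNge; case/negP; rewrite /D (big_setD1 c cI) /=.
      have := cardsD1 c (nbr a :&: N); rewrite cI [#|nbr a :&: N|]da => e2.
      have : \sum_(i in (nbr a :&: N) :\ c) d i <= \sum_(i in (nbr a :&: N) :\ c) 3.
        by apply: leq_sum => i; rewrite !inE => /and3P[_ _ /deg3].
      by rewrite sum_nat_const; lia.
    exfalso; pose L := [set v in N | d v <= 2].
    have defi : \sum_(v in L) (3 - d v) = 2.
      have : \sum_(v in N) (3 - d v) + esum N = 24.
        rewrite -big_split /= -[24]/(8 * 3) -N8 -sum_nat_const; apply: eq_bigr => v vN.
        by rewrite subnK // deg3.
      have -> : \sum_(v in N) (3 - d v) = \sum_(v in L) (3 - d v); last by lia.
      rewrite (bigID (fun v => d v <= 2)) /= [X in _ + X]big1 ?addn0.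
        by apply: eq_bigl => v; rewrite inE.
      by move=> v /andP[_ h]; lia.
    have [p pL] : exists p, p \in L.
      by apply/set0Pn; apply/eqP => L0; rewrite L0 big_set0 in defi.
    have pN : p \in N by move: pL; rewrite inE => /andP[].
    have nbL : nbr p :&: N \subset L :\ p.
      apply/subsetP => c; rewrite !inE => /andP[pc cN]; rewrite cN eq_sym adj_neq //=.
      rewrite leqNgt; apply/negP => dc.
      have d3 : d c = 3 by have := deg3 cN; rewrite -/(d c); lia.
      have := nbr3 c p cN d3 pN; rewrite adj_sym pc => /(_ isT) dp.
      by move: pL; rewrite inE dp andbF.
    have sz : #|L :\ p| + (3 - d p) <= 2.
      have h : #|L :\ p| <= \sum_(v in L :\ p) (3 - d v).
        by rewrite -sum1_card; apply: leq_sum => v; rewrite !inE => /and3P[_ _]; lia.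
      by move: defi; rewrite (big_setD1 p pL) /=; lia.
    have := subset_leq_card nbL; rewrite [#|nbr p :&: N|]/(d p).
    by have := deg3 pN; rewrite -/(d p); move: pL; rewrite inE => /andP[_]; lia.
  case: (@select_b a 1) => // [|b [bN ab nab hb]]; first by lia.
  by apply: (pair a b) => //; lia.
have E24 : esum N = 24 by lia.
have all3 v : v \in N -> d v = 3.
  move=> vN; apply/eqP; rewrite eqn_leq (deg3 vN) /= leqNgt; apply/negP => dv.
  move: E24; rewrite /esum (big_setD1 v vN) /= -/(d v).
  have : \sum_(i in N :\ v) #|nbr i :&: N| <= \sum_(i in N :\ v) 3.
    by apply: leq_sum => i; rewrite !inE => /andP[_ /deg3].
  by rewrite sum_nat_const; have := cardsD1 v N; rewrite vN N8; lia.
have da := all3 _ a1N.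
case: (@select_b a1 1) => // [|b [bN ab nab hb]]; first by have := D_le9 a1N; lia.
have db := all3 _ bN.
have [T0|T1] := leqP #|T a1 b| 0; first by apply: (pair a1 b) => //; lia.
(* Exactly one common neighbour is left, so the two neighbourhoods cover five vertices. One of the
   six remaining vertices lies outside both and keeps degree 3 after [a1] and [b] are removed. *)
exists a1, b; split=> //; apply: (@select_c a1 b 3) => //; last first.
  by have := esum_two a1N bN ab nab; lia.
have XN : N :\ a1 :\ b \subset N by apply/subsetP => v; rewrite !inE => /and3P[].
have X6 : #|N :\ a1 :\ b| = 6.
  have bNa : b \in N :\ a1 by rewrite !inE eq_sym ab.
  by have := cardsD1 a1 N; have := cardsD1 b (N :\ a1); rewrite a1N bNa N8; lia.
have : #|(nbr a1 :&: N) :|: (nbr b :&: N)| = 5.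
  have := cardsUI (nbr a1 :&: N) (nbr b :&: N).
  rewrite (_ : _ :&: _ :&: _ = T a1 b); last by apply/setP => v; rewrite !inE; case: (v \in N); rewrite ?andbF ?andbT.
  rewrite [#|nbr a1 :&: N|]da [#|nbr b :&: N|]db; lia.
move=> U5; have /card_gt0P[c] : 0 < #|(N :\ a1 :\ b) :\: ((nbr a1 :&: N) :|: (nbr b :&: N))|.
  by rewrite cardsD X6; have := subset_leq_card (subsetIr (N :\ a1 :\ b) ((nbr a1 :&: N) :|: (nbr b :&: N))); lia.
rewrite in_setD => /andP[cU cX]; exists c => //.
have cN := subsetP XN _ cX; split; last by rewrite all3.
rewrite -(all3 _ cN) -[X in X <= _]addn0; apply: leq_add => //.
apply: subset_leq_card; apply/subsetP => v; rewrite !inE => /andP[cv vN].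
rewrite cv vN andbT /=; move: cU; rewrite !inE cN !andbT negb_or => /andP[nac nbc].
by apply/andP; split; apply/eqP => e; subst v; [rewrite adj_sym (negPf nbc) in cv|rewrite adj_sym (negPf nac) in cv].
Qed.
End CubicSelection.

(** * Missing edges, and minors built around a vertex and its neighbours *)

Section Complement.
Variable G : sgraph.
Definition compl_rel : rel G := fun u v => (u != v) && ~~ (u -- v).
Lemma compl_sym : symmetric compl_rel.
Proof. by move=> u v; rewrite /compl_rel eq_sym adj_sym. Qed.
Lemma compl_irr : irreflexive compl_rel.
Proof. by move=> u; rewrite /compl_rel eqxx. Qed.
Definition compl : sgraph := SGraph compl_sym compl_irr.
End Complement.

Lemma complE (G : sgraph) (u v : G) : @adj (compl G) u v = (u != v) && ~~ (u -- v).
Proof. by []. Qed.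

Definition non (G : sgraph) (v : G) : {set G} := @nbr (compl G) v.
(** Twice the number of non-adjacent pairs inside [A]. Eight branch sets may miss four pairs, which
    is the recurring bound 8. *)
Definition msum (G : sgraph) (A : {set G}) := @esum (compl G) A.

Lemma nonE (G : sgraph) (u v : G) : (v \in non u) = (u != v) && ~~ (u -- v).
Proof. by rewrite inE. Qed.

Lemma msumD1 (G : sgraph) (A : {set G}) x : x \in A -> msum A = msum (A :\ x) + 2 * #|non x :&: A|.
Proof. exact: (@esumD1 (compl G)). Qed.

Lemma msum_even (G : sgraph) (A : {set G}) : exists k, msum A = k.*2.
Proof. exact: (@esum_even (compl G)). Qed.

Lemma hasK_sets (G : sgraph) (A : {set G}) (B : G -> {set G}) :
  {in A, forall c, conn (B c)} -> {in A &, forall c d, c != d -> [disjoint B c & B d]} ->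
  #|A| = 8 -> \sum_(c in A) #|[set d in A :\ c | ~~ adjs (B c) (B d)]| <= 8 -> hasK G.
Proof.
move=> cB dB A8 le; apply: (@hasK_rooted G A B (fun c d => (c != d) && adjs (B c) (B d))) => //.
  by split=> // c d cA dA /andP[].
apply: leq_trans le; apply: leq_sum => c cA; apply: subset_leq_card; apply/subsetP => d.
by rewrite !inE => /andP[/andP[dc dA]]; rewrite dc dA eq_sym dc.
Qed.

Section Star.
Variables (G : sgraph) (y a b c : G) (Z : {set G}).
Hypothesis cZ : conn Z.
Hypothesis cinZ : c \in Z.
Hypothesis dZ : forall v, v \in cn y -> v != c -> v \notin Z.
Hypothesis aZ : forall v, v \in cn y -> v != c -> adjs [set v] Z.
Hypotheses (ya : y -- a) (yb : y -- b) (ab : (a == b) || (a -- b)).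
Let X := nbr y :\ a :\ b.
Let T := non a :&: non b :&: X.

Let yNX : y \notin a |: X.
Proof. by rewrite !inE adj_irrefl !andbF orbF adj_neq. Qed.
Let aNX : a \notin X.
Proof. by rewrite !inE eqxx /= andbF. Qed.
Let sub : y |: (a |: X) \subset cn y.
Proof.
apply/subsetP => v; rewrite !inE => /or3P[->//|/eqP->|/and3P[_ _ ->]]; last by rewrite orbT.
by rewrite ya orbT.
Qed.
Let cab : conn [set a; b].
Proof. by case/orP: ab => [/eqP->|/conn2//]; rewrite setUid; exact: conn1. Qed.
Let adjab v : (a -- v) || (b -- v) -> adjs [set a; b] [set v].
Proof.
by move=> av; apply/adjsP; case/orP: av => av; [exists a, v|exists b, v]; rewrite !inE eqxx ?orbT.
Qed.

(** The branch sets are [y], the pair [a], [b], the set [Z] in place of [c], and the five other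
    vertices of [X]. The sets of [y] and [c] miss nothing, and the pair misses only common
    non-neighbours. With [a] equal to [b] nothing is merged. *)
Lemma hasK_star : c \in X -> #|X| = 6 ->
  msum (X :\ c) + 2 * #|T :\ c| <= 8 -> hasK G.
Proof.
move=> cX X6 le.
have cNa : c == a = false by apply/negP => /eqP e; have := aNX; rewrite -e cX.
have cNb : c == b = false by apply/negP => /eqP e; move: cX; rewrite e !inE eqxx.
have ycn : y -- c by move: cX; rewrite !inE => /and3P[].
have cNy : c == y = false by rewrite eq_sym (negPf (adj_neq ycn)).
pose B v := if v == c then Z else if v == a then [set a; b] else [set v].
have Bc : B c = Z by rewrite /B eqxx.
have Ba : B a = [set a; b] by rewrite /B eq_sym cNa eqxx.
have Bv v : v != c -> v != a -> B v = [set v] by rewrite /B => /negPf-> /negPf->.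
have selfB v : v \in B v.
  by rewrite /B; case: eqP => [->//|_]; case: eqP => [->|_]; rewrite !inE eqxx.
have adjcK v : v \in cn y -> v != c -> adjs (B c) (B v).
  move=> vy vc; rewrite adjs_sym Bc; apply: adjs_sub (aZ vy vc) => //.
  by rewrite sub1set.
apply: (@hasK_sets _ (y |: (a |: X)) B).
- by move=> v _; rewrite /B; case: eqP => // _; case: eqP => // _; exact: conn1.
- have disj u v : u \in y |: (a |: X) -> v \in y |: (a |: X) -> u != c -> u != v -> [disjoint B u & B v].
    move=> uA vA uc uv.
    have Bu : B u \subset u |: [set b] :&: [set x | u == a].
      rewrite /B (negPf uc); case: eqP => [->|_]; last by rewrite subsetUl.
      by apply/subsetP => x; rewrite !inE ?eqxx ?andbT.
    have Bvs : B v \subset (v |: [set b] :&: [set x | v == a]) :|: Z.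
      rewrite /B; case: eqP => [_|_]; first exact: subsetUr.
      case: eqP => [->|_]; last by rewrite -setUA subsetUl.
      by apply/subsetP => x; rewrite !inE ?eqxx ?andbT => ->.
    have nb z : z \in y |: (a |: X) -> b == z -> z == a.
      rewrite !inE => + /eqP ebz; rewrite -ebz eqxx /= orbF.
      by case/orP=> // /eqP e; have := yb; rewrite -e adj_irrefl.
    apply/pred0P => x /=; apply/negP => /andP[/(subsetP Bu) + /(subsetP Bvs)].
    have uK : u \in Z = false by apply/negbTE; apply: dZ uc; exact: (subsetP sub).
    have bK : b \in Z = false.
      apply/negbTE; apply: dZ; first by rewrite !inE yb orbT.
      by rewrite eq_sym cNb.
    rewrite !inE => /orP[/eqP->|/andP[/eqP-> ua]].
      rewrite uK orbF (negPf uv) /= => /andP[ub va].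
      have bu : b == u by rewrite eq_sym.
      by have := nb u uA bu; rewrite -(eqP va) (negPf uv).
    rewrite bK orbF eqxx /= => /orP[bv|va].
      by have := nb v vA bv; rewrite -(eqP ua) eq_sym (negPf uv).
    by rewrite (eqP ua) eq_sym va in uv.
  move=> u v uA vA uv; have [uc|uc] := eqVneq u c; last exact: disj.
  by rewrite disjoint_sym; apply: disj => //; rewrite 1?eq_sym -?uc // eq_sym.
- by rewrite !cardsU1 yNX aNX X6.
rewrite big_setU1 // big_setU1 //= (big_setD1 c cX) /=.
set m := fun v => [set d in (y |: (a |: X)) :\ v | ~~ adjs (B v) (B d)].
rewrite -/(m y) -/(m a) -/(m c).
have nby v : v \in a |: X -> y -- v.
  by rewrite !inE => /orP[/eqP->|/and3P[]].
have y0 : #|m y| = 0.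
  apply/eqP; rewrite cards_eq0 -subset0; apply/subsetP => v; rewrite !inE -!andbA.
  case/and3P=> vy; rewrite (negPf vy) /= => vA; case/negP; apply/adjsP; exists y, v.
  by rewrite !selfB nby // !inE.
have c0 : #|m c| = 0.
  apply/eqP; rewrite cards_eq0 -subset0; apply/subsetP => v; rewrite in_set in_setD1 -andbA.
  by case/and3P=> vc vA; rewrite adjcK // (subsetP sub).
have Ta v : v \in X -> v != c -> ~~ adjs (B a) (B v) -> v \in T.
  move=> vX vc; have va : v != a by apply: contraNneq aNX => <-.
  have vb : v != b by move: vX; rewrite !inE => /andP[].
  rewrite Ba (Bv _ vc va) => /(contra (@adjab v)); rewrite negb_or => /andP[av bv].
  by rewrite !in_setI !nonE vX av bv eq_sym va eq_sym vb.
have a1 : #|m a| <= #|T :\ c|.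
  apply: subset_leq_card; apply/subsetP => v; rewrite in_set in_setD1 -andbA => /and3P[va vA nadj].
  have vc : v != c by apply: contraNneq nadj => ->; rewrite adjs_sym adjcK // ?cnE ?ya ?orbT // eq_sym cNa.
  rewrite in_setD1 vc /=; apply: Ta => //; move: vA; rewrite !in_setU1 (negPf va) /=.
  case/orP=> // /eqP vy; case/negP: nadj; rewrite vy adjs_sym; apply/adjsP; exists y, a.
  by rewrite !selfB.
have v1 : \sum_(v in X :\ c) #|m v| <= msum (X :\ c) + #|T :\ c|.
  have -> : #|T :\ c| = \sum_(v in X :\ c) (v \in T).
    rewrite -sum1_card [LHS]big_mkcond [RHS]big_mkcond; apply: eq_bigr => v _.
    have eT : (v \in T) = (v \in non a :&: non b) && (v \in X) by rewrite /T in_setI.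
    rewrite in_setD1 [v \in X :\ c]in_setD1 eT.
    by case: (v \in X); rewrite ?andbF ?andbT //; case: (v != c).
  rewrite /msum /esum -big_split; apply: leq_sum => v; rewrite in_setD1 => /andP[vc vX].
  have va : v != a by apply: contraNneq aNX => <-.
  apply: (@leq_trans #|(@nbr (compl G) v :&: (X :\ c)) :|: (if v \in T then [set a] else set0)|).
    apply: subset_leq_card; apply/subsetP => u; rewrite in_set in_setD1 -andbA => /and3P[uv uA nadj].
    have uc : u != c.
      apply: contraNneq nadj => ->; rewrite adjs_sym adjcK //.
      by apply: (subsetP sub); rewrite !in_setU1 vX !orbT.
    move: uA; rewrite !in_setU1 => /or3P[/eqP uy|/eqP ua|uX].
    + case/negP: nadj; rewrite adjs_sym; apply/adjsP; exists u, v; rewrite !selfB uy nby //.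
      by rewrite in_setU1 vX orbT.
    + rewrite ua in_setU; have -> : v \in T by apply: Ta; rewrite // adjs_sym -ua.
      by rewrite [a \in [set a]]inE eqxx orbT.
    + have ua : u != a by apply: contraNneq aNX => <-.
      rewrite in_setU in_setI in_setD1 uc uX; move: nadj; rewrite !Bv // adjs11 => nadj.
      by rewrite -/(non v) nonE nadj eq_sym uv.
  apply: leq_trans (leq_card_setU _ _).1 _; rewrite leq_add2l.
  by case: ifP => _; rewrite ?cards1 ?cards0.
rewrite y0 c0 !add0n; apply: leq_trans (leq_add a1 v1) _.
by apply: leq_trans le; rewrite mul2n -addnn addnCA.
Qed.

End Star.

Section Merge.
Variables (G : sgraph) (y a b : G) (K : {set G}).
Hypothesis cK : conn K.
Hypothesis dK : [disjoint cn y & K].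
Hypothesis univ : forall v, y -- v -> ~~ adjs [set v] K -> cn v = cn y.
Hypotheses (ya : y -- a) (yb : y -- b) (ab : (a == b) || (a -- b)).
Let X := nbr y :\ a :\ b.
Let T := non a :&: non b :&: X.

Let yNX : y \notin a |: X.
Proof. by rewrite !inE adj_irrefl !andbF orbF adj_neq. Qed.
Let aNX : a \notin X.
Proof. by rewrite !inE eqxx /= andbF. Qed.
Let sub : y |: (a |: X) \subset cn y.
Proof.
apply/subsetP => v; rewrite !inE => /or3P[->//|/eqP->|/and3P[_ _ ->]]; last by rewrite orbT.
by rewrite ya orbT.
Qed.
Let Kd v : v \in cn y -> v \in K = false.
Proof. exact: disjointFr. Qed.
Let bK : b \in K = false. Proof. by apply: Kd; rewrite !inE yb orbT. Qed.
Let cab : conn [set a; b].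
Proof. by case/orP: ab => [/eqP->|/conn2//]; rewrite setUid; exact: conn1. Qed.
Let adjab v : (a -- v) || (b -- v) -> adjs [set a; b] [set v].
Proof.
by move=> av; apply/adjsP; case/orP: av => av; [exists a, v|exists b, v]; rewrite !inE eqxx ?orbT.
Qed.

(** [K] is absorbed into [c]. A vertex of [cn y] without a neighbour in [K] has the closed
    neighbourhood of [y], so it is adjacent to [c] itself. *)
Lemma hasK_merge c : c \in X -> adjs [set c] K -> #|X| = 6 ->
  msum (X :\ c) + 2 * #|T :\ c| <= 8 -> hasK G.
Proof.
move=> cX cKa; have ycn : y -- c by move: cX; rewrite !inE => /and3P[].
apply: (@hasK_star G y a b c (c |: K)) => //; rewrite ?setU11 //.
- by apply: connU; rewrite ?cKa ?orbT //; exact: conn1.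
- by move=> v vy vc; rewrite in_setU1 negb_or vc Kd.
- move=> v vy vc; have [vK|vK] := boolP (adjs [set v] K).
    by apply: adjs_sub vK; rewrite ?subsetUr.
  have cv : cn v = cn y.
    by move: vy; rewrite cnE => /orP[/eqP->//|yv]; apply: univ.
  have : c \in cn v by rewrite cv cnE ycn orbT.
  rewrite cnE eq_sym (negPf vc) /= => vc'.
  by apply/adjsP; exists v, c; rewrite set11 setU11.
Qed.

(* Here [K] itself, represented by one of its vertices [w], is a branch set. *)
Lemma hasK_keep : #|X| = 5 -> 2 + 2 * #|[set v in nbr y | ~~ adjs [set v] K]| + msum X + 2 * #|T| <= 8 -> hasK G.
Proof.
move=> X5 le; set U := [set v in nbr y | _] in le.
have [w wK] : exists w, w \in K by case: cK => /set0Pn.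
have wcn v : v \in cn y -> (v == w) = false.
  by move=> vy; apply/negP => /eqP e; rewrite -e Kd in wK.
have wA : w \notin y |: (a |: X) by apply/negP => /(subsetP sub) /wcn; rewrite eqxx.
pose B v := if v == w then K else if v == a then [set a; b] else [set v].
have Bw : B w = K by rewrite /B eqxx.
have Ba : B a = [set a; b] by rewrite /B wcn ?cnE ?ya ?orbT // eqxx.
have Bv v : v != w -> v != a -> B v = [set v] by rewrite /B => /negPf-> /negPf->.
have selfB v : v \in B v.
  by rewrite /B; case: eqP => [->|_]; last case: eqP => [->|_]; rewrite // !inE eqxx.
have Xa v : v \in X -> v != a by move=> vX; apply: contraNneq aNX => <-.
have Xy v : v \in X -> y -- v by rewrite !inE => /and3P[].
have Xw v : v \in X -> v != w by move/Xy => yv; rewrite wcn // cnE yv orbT.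
have yw : y != w by rewrite wcn // cnE eqxx.
have yNa : y != a by apply: adj_neq.
have By : B y = [set y] by apply: Bv.
have aw : a != w by rewrite wcn // cnE ya orbT.
apply: (@hasK_sets _ (w |: (y |: (a |: X))) B).
- move=> v _; rewrite /B; case: eqP => // _; case: eqP => // _; exact: conn1.
- have disj u v : u \in y |: (a |: X) -> v \in w |: (y |: (a |: X)) -> u != v -> [disjoint B u & B v].
    move=> uA vA uv.
    have uw : u != w by apply: contraNneq wA => <-.
    have Bu : B u \subset u |: [set b] :&: [set x | u == a].
      rewrite /B (negPf uw); case: eqP => [->|_]; last by rewrite subsetUl.
      by apply/subsetP => x; rewrite !inE ?eqxx ?andbT.
    have nb z : z \in y |: (a |: X) -> b == z -> z == a.
      rewrite !inE => + /eqP ebz; rewrite -ebz eqxx /= orbF.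
      by case/orP=> // /eqP e; have := yb; rewrite -e adj_irrefl.
    apply/pred0P => x /=; apply/negP => /andP[/(subsetP Bu)].
    have uK := Kd (subsetP sub _ uA).
    have [->|vw] := eqVneq v w.
      by rewrite Bw !inE => /orP[/eqP->|/andP[/eqP-> _]]; rewrite ?uK ?bK.
    have vA' : v \in y |: (a |: X) by move: vA; rewrite in_setU1 (negPf vw).
    rewrite /B (negPf vw) !inE; have [ev|va] := eqVneq v a; rewrite !inE.
      case/orP=> [/eqP->|/andP[/eqP-> ua]]; last by rewrite (eqP ua) ev eqxx in uv.
      rewrite -ev (negPf uv) /= => ub; have bu : b == u by rewrite eq_sym.
      by have := nb u uA bu; rewrite -ev (negPf uv).
    case/orP=> [/eqP->|/andP[/eqP-> ua]]; first by rewrite (negPf uv).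
    by move=> bv; rewrite (nb v vA' bv) in va.
  move=> u v uA vA uv; move: (uA); rewrite in_setU1 => /orP[/eqP uw|uA']; last exact: disj.
  rewrite disjoint_sym; apply: disj => //; last by rewrite eq_sym.
  by move: vA; rewrite [v \in w |: _]in_setU1 -uw eq_sym (negPf uv).
- by rewrite cardsU1 wA !cardsU1 yNX aNX X5.
rewrite big_setU1 // big_setU1 // big_setU1 //=.
set m := fun v => [set d in (w |: (y |: (a |: X))) :\ v | ~~ adjs (B v) (B d)].
rewrite -/(m w) -/(m y) -/(m a).
have UX v : v \in a |: X -> ~~ adjs (B w) (B v) -> v \in U.
  move=> vA; rewrite Bw => nadj; have yv : y -- v by move: vA; rewrite in_setU1 => /orP[/eqP->|/Xy].
  rewrite /U in_set inE yv; apply: contra nadj => vK; rewrite adjs_sym; apply: adjs_sub vK => //.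
  by rewrite sub1set selfB.
have nby v : v \in a |: X -> adjs (B y) (B v).
  move=> vA; apply/adjsP; exists y, v; rewrite !selfB; split=> //.
  by move: vA; rewrite in_setU1 => /orP[/eqP->|/Xy].
have w1 : #|m w| <= #|[set y]| + #|[set v in a |: X | v \in U]|.
  apply: leq_trans (leq_card_setU _ _).1; apply: subset_leq_card; apply/subsetP => v.
  rewrite in_set in_setD1 -andbA => /and3P[vw vA nadj].
  move: vA; rewrite in_setU1 (negPf vw) [_ || _]in_setU1 => /orP[/eqP->|vA]; first by rewrite in_setU set11.
  by rewrite in_setU [v \in [set _ in _ | _]]in_set vA UX ?orbT.
have y1 : #|m y| <= #|[set w]|.
  apply: subset_leq_card; apply/subsetP => v; rewrite in_set in_setD1 -andbA => /and3P[vy vA nadj].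
  move: vA; rewrite in_setU1 in_setU1 (negPf vy) => /orP[/eqP->|vA]; first by rewrite set11.
  by case/negP: nadj; apply: nby.
have Ta v : v \in X -> ~~ adjs (B a) (B v) -> v \in T.
  move=> vX; have vb : v != b by move: (vX); rewrite !inE => /andP[].
  rewrite Ba (Bv _ (Xw _ vX) (Xa _ vX)) => /(contra (@adjab v)); rewrite negb_or => /andP[av bv].
  by rewrite /T !in_setI !nonE vX av bv eq_sym Xa // eq_sym vb.
pose Uw v : {set G} := if v \in U then [set w] else set0.
have cUw v : #|Uw v| = (v \in U) by rewrite /Uw; case: ifP; rewrite ?cards1 ?cards0.
have mw u v : v \in a |: X -> u \in m v -> u = w -> u \in Uw v.
  move=> vA; rewrite in_set => /andP[_ nadj] e; rewrite /Uw UX // ?e ?set11 //.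
  by rewrite adjs_sym -e.
have my u v : v \in a |: X -> u \in m v -> u != y.
  move=> vA; rewrite in_set => /andP[_ nadj]; apply: contraNneq nadj => ->.
  by rewrite adjs_sym nby.
have a1 : #|m a| <= #|T| + (a \in U).
  rewrite -cUw; apply: leq_trans (leq_card_setU _ _).1; apply: subset_leq_card.
  have aX : a \in a |: X by rewrite in_setU1 eqxx.
  apply/subsetP => v vm; have vy := my _ _ aX vm; rewrite in_setU.
  have [e|vw] := eqVneq v w; first by rewrite (mw _ _ aX vm e) orbT.
  move: vm; rewrite in_set in_setD1 !in_setU1 (negPf vw) (negPf vy) /= -andbA => /and3P[va].
  by rewrite (negPf va) /= => vX /Ta->.
have v1 : \sum_(v in X) #|m v| <= msum X + #|T| + \sum_(v in X) (v \in U).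
  have -> : #|T| = \sum_(v in X) (v \in T).
    rewrite -sum1_card [LHS]big_mkcond [RHS]big_mkcond; apply: eq_bigr => v _.
    have -> : (v \in T) = (v \in non a :&: non b) && (v \in X) by rewrite /T in_setI.
    by case: (v \in X); rewrite ?andbF ?andbT.
  rewrite /msum /esum -!big_split; apply: leq_sum => v vX.
  have vaX : v \in a |: X by rewrite in_setU1 vX orbT.
  pose Tv : {set G} := if v \in T then [set a] else set0.
  have cTv : #|Tv| = (v \in T) by rewrite /Tv; case: ifP; rewrite ?cards1 ?cards0.
  rewrite -cTv -cUw.
  apply: leq_trans (_ : #|((@nbr (compl G) v :&: X) :|: Tv) :|: Uw v| <= _); last first.
    apply: leq_trans (leq_card_setU _ _).1 _; rewrite leq_add2r; exact: (leq_card_setU _ _).1.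
  apply: subset_leq_card; apply/subsetP => u um; have uy := my _ _ vaX um; rewrite in_setU.
  have [e|uw] := eqVneq u w; first by rewrite (mw _ _ vaX um e) orbT.
  move: um; rewrite in_set in_setD1 !in_setU1 (negPf uw) (negPf uy) /= -andbA => /and3P[uv].
  case/orP=> [/eqP ua|uX] nadj.
    have vT : v \in T by apply: Ta; rewrite // adjs_sym -ua.
    by rewrite in_setU /Tv vT ua set11 orbT.
  move: nadj; rewrite (Bv _ (Xw _ vX) (Xa _ vX)) (Bv _ (Xw _ uX) (Xa _ uX)) adjs11 => nadj.
  by rewrite in_setU in_setI uX -/(non v) nonE nadj eq_sym uv.
have Usum : #|[set v in a |: X | v \in U]| <= #|U|.
  by apply: subset_leq_card; apply/subsetP => v; rewrite in_set => /andP[].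
have Usum2 : (a \in U) + \sum_(v in X) (v \in U) = #|[set v in a |: X | v \in U]|.
  rewrite -sum1dep_card big_mkcondr /= big_setU1 //=; congr (_ + _).
rewrite !cards1 in w1 y1.
move: w1 y1 a1 v1 Usum Usum2 le; set s1 := \sum_(v in X) #|m v|; set s2 := \sum_(v in X) (v \in U).
move: #|m w| #|m y| #|m a| s1 s2 #|T| #|U| (msum X) #|_| (a \in U : nat); clear; lia.
Qed.
End Merge.

Lemma esum_mono (G : sgraph) (A B : {set G}) : A \subset B -> esum A <= esum B.
Proof.
move=> AB; rewrite -(setIidPr AB) -{2}(setID B A) esumU; first by lia.
by rewrite -setI_eq0 setIDA setIAC setDE -setIA -setIA setICr !setI0.
Qed.

Lemma msum_esum (G : sgraph) (A : {set G}) : msum A + esum A = #|A| * #|A|.-1.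
Proof.
rewrite /msum /esum -big_split -sum_nat_const; apply: eq_bigr => v vA /=.
rewrite -card_disjU.
  rewrite (cardsD1 v A) vA /=; apply: eq_card => u; rewrite !inE complE.
  rewrite -[RHS]/(((u : G) != v) && (u \in A)) [in RHS]eq_sym; have [->|vu] := eqVneq (v : G) u; rewrite ?adj_irrefl //=.
  by case: (@adj G v u); rewrite /= ?orbF.
by apply/pred0P => u; rewrite /= !inE complE; case: (@adj G v u); rewrite ?andbF.
Qed.

Lemma hasK_direct (G : sgraph) (A : {set G}) : #|A| = 8 -> msum A <= 8 -> hasK G.
Proof.
move=> A8 le; apply: (@hasK_sets G A (fun v => [set v])) => //.
- by move=> c _; exact: conn1.
- by move=> c d _ _ cd; rewrite disjoints1 inE.
apply: leq_trans le; apply: leq_sum => c cA; apply: subset_leq_card; apply/subsetP => d.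
by rewrite !inE adjs11 => /andP[/andP[dc ->] nc]; rewrite complE eq_sym dc nc.
Qed.

Lemma merge_selection (G : sgraph) (N : {set G}) : #|N| = 8 ->
  (forall v, v \in N -> #|non v :&: N| <= 3) -> 10 <= msum N ->
  exists a b c : G, [/\ a \in N, b \in N, a -- b, c \in N :\ a :\ b &
    0 < #|non c :&: N| /\ msum (N :\ a :\ b :\ c) + 2 * #|(non a :&: non b :&: N) :\ c| <= 8].
Proof.
move=> N8 d3 e10.
case: (@cubic_selection (compl G) N N8 d3 e10) => a [b [aN bN ab nab [c cX [dc le]]]].
exists a, b, c; split; [exact: aN|exact: bN| |exact: cX|by split].
move: nab; rewrite complE negb_and !negbK => /orP[e|//].
by case/negP: ab.
Qed.

Lemma hasK_rooted_sum (G : sgraph) (A : {set G}) B (R : rel G) : rooted A B R -> #|A| = 8 ->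
  48 <= \sum_(c in A) #|[set d in A | R c d]| -> hasK G.
Proof.
move=> r A8 le; apply: (hasK_model (rooted_model r)); apply: hasK_eight.
  by rewrite rooted_card.
exact: leq_trans le (rooted_esum r).
Qed.

(** * Degrees eight, seven and six, and degree five with clones *)

Section Cases.
Variable G : sgraph.
Hypothesis mG : minimal_dense G.
Hypothesis nK : ~ hasK G.
Variables (y x : G).
Hypothesis xy : x \notin cn y.
Let K := component (~: cn y) x.
Hypothesis univ : forall v, y -- v -> ~~ adjs [set v] K -> cn v = cn y.
Let N := nbr y.
Let U := [set v in N | ~~ adjs [set v] K].
Let Q := y |: U.
Let M := N :\: U.

Let cK : conn K. Proof. exact: component_conn. Qed.
Let dK : [disjoint cn y & K].
Proof.
have xC : x \in ~: cn y by rewrite inE.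
by rewrite disjoint_sym disjoints_subset; exact: component_sub.
Qed.

(** The edge from [y] to [v] lies in four triangles, so [v] and four of its neighbours are
    excluded. *)
Lemma non_deg v : v \in N -> #|non v :&: N| + 5 <= #|N|.
Proof.
move=> vN; have yv : y -- v by move: vN; rewrite inE.
have t4 := min_triangles mG yv.
have := subset_leq_card (_ : (v |: (N :&: nbr v)) :|: (non v :&: N) \subset N).
have -> : #|(v |: (N :&: nbr v)) :|: (non v :&: N)| = 1 + #|N :&: nbr v| + #|non v :&: N|.
  rewrite card_disjU; first by rewrite cardsU1 !inE adj_irrefl andbF.
  apply/pred0P => u; rewrite /= !inE complE.
  by case: (u =P v) => [->|]; rewrite ?eqxx //=; case: (v -- u); rewrite ?andbF.
rewrite -/N in t4; move=> H; suff /H : (v |: (N :&: nbr v)) :|: (non v :&: N) \subset N by lia.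
by rewrite !subUset sub1set vN subsetIl subsetIr.
Qed.

Lemma nonuniv v : v \in N -> 0 < #|non v :&: N| -> adjs [set v] K.
Proof.
move=> vN /card_gt0P[u]; rewrite inE nonE => /andP[/andP[vu nvu] uN].
apply: contraT => /(univ _) e; have : u \in cn v.
  by rewrite e ?cnE; move: vN uN; rewrite !inE => // _ ->; rewrite orbT.
by rewrite cnE eq_sym (negPf vu) (negPf nvu).
Qed.

Lemma msum_cn : msum (cn y) = msum N.
Proof.
have yc : y \in cn y by rewrite cnE eqxx.
rewrite /msum (@esumD1 (compl G) (cn y) y yc) (_ : #|_ :&: _| = 0) ?addn0.
  by congr esum; apply/setP => v; rewrite !inE; case: (v =P y) => [->|]; rewrite ?adj_irrefl.
apply/eqP; rewrite cards_eq0 -subset0; apply/subsetP => v /setIP[vn vc]; move: vc vn.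
by rewrite (cnE (y : G)) inE complE => /orP[/eqP->|->]; rewrite ?eqxx ?andbF.
Qed.

Lemma adj_N v : v \in N -> y -- v. Proof. by rewrite inE. Qed.

Lemma no_degree_eight : #|N| = 8 -> False.
Proof.
move=> N8; apply: nK; have d3 (v : G) : v \in N -> #|non v :&: N| <= 3.
  by move=> /non_deg h; rewrite N8 in h; have h' : #|non v :&: N| <= 3 by lia.
have [small|big] := leqP (msum N) 8.
  have /card_gt0P[v vN] : 0 < #|N| by rewrite N8.
  have vc : v \in cn y by move: vN; rewrite !inE orbC => ->.
  apply: (@hasK_direct _ (cn y :\ v)); first by have := cardsD1 v (cn y); rewrite vc card_cn -/N N8; lia.
  by apply: leq_trans small; rewrite -msum_cn; apply: esum_mono; apply: subsetDl.
have big10 : 10 <= msum N.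
  by case: (msum_even N) => k ek; lia.
case: (merge_selection N8 d3 big10) => a [b [c [aN bN ab cX [dc le]]]].
have cN : c \in N by move: cX; rewrite !inE => /and3P[].
apply: (@hasK_merge G y a b K cK dK univ (adj_N aN) (adj_N bN) _ c) => //.
- by rewrite ab orbT.
- by apply: nonuniv => //; move: cX; rewrite !in_setD1 => /and3P[].
- have bNa : b \in N :\ a by rewrite in_setD1 eq_sym adj_neq.
  by have := cardsD1 a N; have := cardsD1 b (N :\ a); rewrite aN bNa N8 -/N; lia.
apply: leq_trans le; rewrite leq_add2l leq_mul2l /=; apply: subset_leq_card; apply: setSD.
by apply: setIS; apply/subsetP => v; rewrite !inE => /and3P[].
Qed.

(** The complement on [N] has maximum degree 2. Up to four missing pairs [cn y] is the minor; up to
    six it is enough to absorb the component into a vertex with two non-neighbours. With seven the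
    complement is 2-regular: an edge [u v] without common non-neighbour is contracted, and the
    component stays a branch set of its own. *)
Lemma no_degree_seven : #|N| = 7 -> False.
Proof.
move=> N7; apply: nK; have d2 (v : G) : v \in N -> #|non v :&: N| <= 2.
  by move=> /non_deg h; rewrite N7 in h; have h' : #|non v :&: N| <= 2 by lia.
have [small|big] := leqP (msum N) 8.
  by apply: (@hasK_direct _ (cn y)); rewrite ?card_cn -/N ?N7 ?msum_cn.
have [k ek] := msum_even N.
have two : exists2 c, c \in N & 2 <= #|non c :&: N|.
  have [/existsP[c /andP[cN c2]]|/existsPn no] := boolP [exists c, (c \in N) && (2 <= #|non c :&: N|)].
    by exists c.
  have : msum N <= \sum_(c in N) 1.
    by apply: leq_sum => c cN; have := no c; rewrite cN /= -ltnNge ltnS.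
  by rewrite sum1_card N7; lia.
have [le12|ge13] := leqP (msum N) 12.
  case: two => c cN c2.
  have /card_gt0P[a] : 0 < #|N :\ c| by have := cardsD1 c N; rewrite cN N7; lia.
  rewrite in_setD1 => /andP[ac aN].
  apply: (@hasK_merge G y a a K cK dK univ (adj_N aN) (adj_N aN) _ c) => //.
  - by rewrite eqxx.
  - by rewrite !in_setD1 eq_sym ac cN.
  - by apply: nonuniv => //; lia.
  - rewrite -/N (_ : N :\ a :\ a = N :\ a); last by apply/setP => v; rewrite !inE; case: eqP.
    by have := cardsD1 a N; rewrite aN N7; lia.
  rewrite -/N (_ : N :\ a :\ a = N :\ a); last by apply/setP => v; rewrite !inE; case: eqP.
  have aNc : a \in N :\ c by rewrite in_setD1 ac.
  have e1 := msumD1 cN; have e2 := msumD1 aNc.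
  rewrite setIid (_ : (non a :&: (N :\ a)) :\ c = non a :&: (N :\ c)).
    rewrite (_ : N :\ a :\ c = N :\ c :\ a); last by apply/setP => v; rewrite !inE andbCA.
    by lia.
  apply/setP => v; rewrite !in_setD1 !in_setI in_setD1 nonE eq_sym in_setD1.
  by rewrite ![_ == v]eq_sym; case: (_ == c); case: (_ == a); rewrite ?andbF ?andbT //=; case: (_ -- _).
have e14 : msum N = 14.
  have : msum N <= \sum_(c in N) 2 by apply: leq_sum => c /d2.
  by rewrite sum_nat_const N7; lia.
have all2 (v : G) : v \in N -> #|non v :&: N| = 2.
  move=> vN; apply/eqP; rewrite eqn_leq (d2 _ vN) /= leqNgt; apply/negP => dv.
  have : msum N = \sum_(i in N) #|non i :&: N| by [].
  rewrite e14 (big_setD1 v vN) /=.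
  have : \sum_(i in N :\ v) #|non i :&: N| <= \sum_(i in N :\ v) 2.
    by apply: leq_sum => i; rewrite in_setD1 => /andP[_ /d2].
  by rewrite sum_nat_const; have := cardsD1 v N; rewrite vN N7; lia.
have /card_gt0P[u uN] : 0 < #|N| by rewrite N7.
have [v [vN uv nuv T0]] : exists v, [/\ v \in N, u != v, u -- v & #|non u :&: non v :&: N| = 0].
  have lt : msum N + \sum_(b in N :\: @cn (compl G) u) #|non u :&: non b :&: N| <=
    \sum_(b in N :\: @cn (compl G) u) #|non b :&: N| + 2 * \sum_(c in non u :&: N) #|non c :&: N|.
    exact: (@nonnbr_sum (compl G)).
  have B4 : #|N :\: @cn (compl G) u| = 4.
    rewrite cardsD setIC /cn setIUl (setIidPl _) ?sub1set // cardsU1 N7.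
    by rewrite [#|_ :&: _|](all2 _ uN) !inE adj_irrefl.
  have s1 : \sum_(c in non u :&: N) #|non c :&: N| = 4.
    rewrite (eq_bigr (fun _ => 2)) => [|c]; last by rewrite in_setI => /andP[_ /all2].
    by rewrite sum_nat_const all2.
  have s2 : \sum_(b in N :\: @cn (compl G) u) #|non b :&: N| = 8.
    rewrite (eq_bigr (fun _ => 2)) => [|c]; last by rewrite in_setD => /andP[_ /all2].
    by rewrite sum_nat_const B4.
  (* Now 14 plus the numbers of common non-neighbours over the four candidates is at most 8 + 8, so
     these numbers sum to at most 2 and one of them is 0. *)
  move: lt; rewrite s1 s2 e14.
  move=> lt; have [/existsP[v /andP[vB /eqP v0]]|/existsPn no] :=
    boolP [exists v, (v \in N :\: @cn (compl G) u) && (#|non u :&: non v :&: N| == 0)].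
    exists v; move: vB; rewrite !inE negb_or complE => /andP[/andP[vu uv] vN].
    have nuv : u != v by rewrite eq_sym.
    by move: uv; rewrite nuv /= negbK.
  have : \sum_(b in N :\: @cn (compl G) u) 1 <= \sum_(b in N :\: @cn (compl G) u) #|non u :&: non b :&: N|.
    by apply: leq_sum => v vB; have := no v; rewrite vB /= -lt0n.
  by rewrite sum1_card B4; lia.
apply: (@hasK_keep G y u v K cK dK (adj_N uN) (adj_N vN)).
- by rewrite nuv orbT.
- have vNu : v \in N :\ u by rewrite in_setD1 eq_sym uv.
  by have := cardsD1 u N; have := cardsD1 v (N :\ u); rewrite uN vNu N7 -/N; lia.
have -> : [set v0 in nbr y | ~~ adjs [set v0] K] = set0.
  apply/setP => w; rewrite in_set in_set0; apply/negP => /andP[wN]; rewrite nonuniv //.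
  by rewrite all2.
have e2 : msum N = msum (N :\ u :\ v) + 2 * 2 + 2 * 2.
  have vNu : v \in N :\ u by rewrite in_setD1 eq_sym uv.
  rewrite (msumD1 uN) (msumD1 vNu) (all2 u uN) (_ : non v :&: (N :\ u) = non v :&: N) ?(all2 v vN) //.
  apply/setP => w; rewrite !in_setI in_setD1 nonE; have [->|] := eqVneq w u; rewrite ?andbF //=.
  by rewrite (adj_sym v) nuv andbF.
have : #|non u :&: non v :&: (N :\ u :\ v)| <= 0.
  rewrite -T0; apply: subset_leq_card; apply: setIS.
  by apply/subsetP => w; rewrite !in_setD1 => /and3P[].
by move: e2; rewrite e14 cards0 -/N; lia.
Qed.

Let UN : U \subset N. Proof. by apply/subsetP => v; rewrite inE => /andP[]. Qed.
Let cU : #|Q| = #|U|.+1.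
Proof. by rewrite cardsU1 !inE adj_irrefl. Qed.
Let cM : #|M| + #|U| = #|N|.
Proof. by rewrite cardsD (setIidPr UN) subnK // subset_leq_card. Qed.
Let cQ v : v \in Q -> cn v = cn y.
Proof. by rewrite !inE => /orP[/eqP->//|/andP[yv /(univ yv)]]. Qed.
Let sQ : Q \subset cn y.
Proof. exact: setUS. Qed.
Let cA : #|~: Q| + #|Q| = #|G|.
Proof. by rewrite addnC cardsC. Qed.
Let nbrQ v u : v \in Q -> (u \in nbr v) = (u != v) && (u \in cn y).
Proof. by move=> vQ; rewrite -(cQ vQ) cnE inE; case: (u =P v) => [->|]; rewrite ?adj_irrefl. Qed.
Let MQ : M \subset ~: Q.
Proof.
apply/subsetP => v; rewrite !inE negb_or => /andP[vU yv].
by rewrite eq_sym adj_neq //= yv; move: vU; rewrite yv.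
Qed.

Lemma clone_esum : esum [set: G] = esum (~: Q) + #|Q| * #|Q|.-1 + 2 * (#|Q| * #|M|).
Proof.
rewrite -(setUCr Q) esumU; last by rewrite -setI_eq0 setICr.
suff [-> ->] : esum Q = #|Q| * #|Q|.-1 /\ degs Q (~: Q) = #|Q| * #|M| by lia.
split; rewrite -sum_nat_const; apply: eq_bigr => v vQ.
  rewrite (cardsD1 v Q) vQ /=; apply: eq_card => u; rewrite in_setI nbrQ // in_setD1.
  by case: (u =P v) => //= _; have [/(subsetP sQ)->|] := boolP (u \in Q); rewrite ?andbF.
apply: eq_card => u; rewrite in_setI nbrQ // in_setC.
have [uQ|uQ] := boolP (u \in Q).
  by rewrite andbF; apply/esym/negP => /(subsetP MQ); rewrite in_setC uQ.
have uv : u != v by apply: contraNneq uQ => ->.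
rewrite uv andbT /= cnE; move: uQ; rewrite /Q in_setU1 negb_or => /andP[/negPf-> uU].
by rewrite /M in_setD uU inE.
Qed.

Lemma keep6 : #|N| = 6 -> 2 + 2 * #|U| + msum N <= 8 -> False.
Proof.
move=> N6 le; apply: nK; have /card_gt0P[a aN] : 0 < #|N| by rewrite N6.
have E : nbr y :\ a :\ a = N :\ a by apply/setP => v; rewrite !inE; case: eqP.
apply: (@hasK_keep G y a a K cK dK (adj_N aN) (adj_N aN)); first by rewrite eqxx.
  by rewrite E; have := cardsD1 a N; rewrite aN N6; lia.
rewrite E setIid; move: le; rewrite (msumD1 aN) -/U (_ : non a :&: (N :\ a) = non a :&: N); first by lia.
apply/setP => w; rewrite !in_setI in_setD1 nonE; have [->|] := eqVneq w a; by rewrite ?eqxx.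
Qed.

Lemma hle1 v : #|N| = 6 -> v \in N -> #|non v :&: N| <= 1.
Proof. by move=> N6 /non_deg; rewrite N6; lia. Qed.

Lemma non_U v : v \in U -> #|non v :&: N| = 0.
Proof.
move=> vU; apply/eqP; rewrite -leqn0 leqNgt; apply/negP => /(nonuniv (subsetP UN _ vU)).
by move: vU; rewrite inE => /andP[_ /negPf->].
Qed.

Lemma msum_M : msum N = msum M.
Proof.
have -> : msum N = \sum_(v in N) #|non v :&: N| by [].
rewrite (big_setID U) /= big1 ?add0n => [|v]; last by rewrite in_setI => /andP[_ /non_U].
apply: eq_bigr => v vM; rewrite -/(non v); apply: eq_card => u; rewrite !in_setI in_setD.
have [uU|//] := boolP (u \in U); rewrite (subsetP UN _ uU) /= !andbT andbF.
apply/negP => uv; have := non_U uU; move/eqP; rewrite cards_eq0 => /eqP/setP/(_ v).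
rewrite in_setI in_set0 nonE; move: uv; rewrite nonE eq_sym adj_sym => ->.
by move: vM; rewrite in_setD => /andP[_ ->].
Qed.

Lemma msum_M_le : #|N| = 6 -> msum N <= #|M|.
Proof.
move=> N6; rewrite msum_M -[X in _ <= X]muln1 -sum_nat_const; apply: leq_sum => v vM.
have vN : v \in N by move: vM; rewrite in_setD => /andP[].
apply: leq_trans (hle1 N6 vN); apply: subset_leq_card; apply: setIS; exact: subsetDl.
Qed.

(* Two clones are contracted onto [m1], [m2] to turn [M] into a clique. *)
Lemma fill_clones : #|N| = 6 -> 2 <= #|U| -> 8 < 2 + 2 * #|U| + msum N -> 2 <= msum N <= 4 -> False.
Proof.
move=> N6 U2 UM /andP[m2' m4]; have mle := msum_M_le N6; have [k ek] := msum_even N.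
have pos (A : {set G}) : 0 < msum A -> exists2 v, v \in A & 0 < #|non v :&: A|.
  move=> A0; have [/existsP[v /andP[vA v0]]|/existsPn no] := boolP [exists v, (v \in A) && (0 < #|non v :&: A|)].
    by exists v.
  by move: A0; rewrite lt0n; case/eqP; apply: big1 => v vA; have := no v; rewrite vA /= -leqNgt leqn0 => /eqP.
have inM v : v \in N -> 0 < #|non v :&: N| -> v \in M.
  by move=> vN v0; rewrite /M in_setD vN andbT /U in_set vN nonuniv.
have [m1 m1N m10] := pos N (leq_trans (isT : 0 < 2) m2').
have e1 := msumD1 m1N.
(* The non-adjacent pairs in [N] form a matching with one or two edges, and [m1], [m2] meet all of
   them. With a single pair any further [m2] in [M] will do. *)
have [m2 [m2M m12 M0]] : exists m2, [/\ m2 \in M, m2 != m1 & msum (N :\ m1 :\ m2) = 0].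
  have [z|nz] := posnP (msum (N :\ m1)).
    have /card_gt0P[m2] : 0 < #|M :\ m1|.
      by have := cardsD1 m1 M; rewrite (inM _ m1N m10); lia.
    rewrite in_setD1 => /andP[ne m2M]; exists m2; split=> //.
    apply/eqP; rewrite -leqn0 -z; apply: (@esum_mono (compl G)); exact: subsetDl.
  case: (pos _ nz) => m2 m2N; rewrite in_setD1 in m2N; case/andP: m2N => ne m2N d2.
  have m2N1 : m2 \in N :\ m1 by rewrite in_setD1 ne.
  have e2 := msumD1 m2N1; exists m2; split=> //; last by move: e1 e2 m10 d2 m4; clear; lia.
  apply: inM => //; apply: leq_trans d2 _; apply: subset_leq_card; apply: setIS; exact: subsetDl.
have m1M := inM _ m1N m10.
have [q2 q2U] : exists q2, q2 \in U by apply/card_gt0P; apply: ltn_trans U2.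
have [q3 q3U] : exists q3, q3 \in U :\ q2 by apply/card_gt0P; move: U2; rewrite (cardsD1 q2 U) q2U.
move: q3U; rewrite in_setD1 => /andP[q32 q3U].
have yQ : y \in Q by rewrite in_setU1 eqxx.
have UQ v : v \in U -> v \in Q by move=> vU; rewrite in_setU1 vU orbT.
have Uy v : v \in U -> v != y by rewrite eq_sym => /(subsetP UN)/adj_N/adj_neq.
pose B v := if v == m1 then [set m1; y] else if v == m2 then [set m2; q2] else [set v].
have selfB v : v \in B v.
  by rewrite /B; case: eqP => [->|_]; last case: eqP => [->|_]; rewrite !inE eqxx.
have MnotQ v : v \in M -> v \notin Q by move/(subsetP MQ); rewrite in_setC.
have AQ v : v \in ~: Q -> v \notin Q by rewrite in_setC.
have QM q v : q \in Q -> v \in M -> q -- v.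
  move=> qQ vM; have := nbrQ v qQ; rewrite inE => ->; apply/andP; split.
    by apply: contraNneq (MnotQ _ vM) => ->.
  by rewrite cnE; move: vM; rewrite in_setD => /andP[_ /adj_N->]; rewrite orbT.
pose S := q3 |: ~: Q.
have q3NQ : q3 \notin ~: Q by rewrite in_setC negbK UQ.
have cB v : conn (B v).
  rewrite /B; case: eqP => _; first by apply: conn2; rewrite adj_sym QM.
  case: eqP => _; last exact: conn1.
  by apply: conn2; rewrite adj_sym QM // UQ.
have dB : {in S &, forall u v, u != v -> [disjoint B u & B v]}.
  move=> u v uS vS uv.
  have Bs w : B w \subset w |: ([set y] :&: [set z | w == m1] :|: [set q2] :&: [set z | w == m2]).
    rewrite /B; case: eqP => [->|_]; first by apply/subsetP => z; rewrite !inE ?eqxx ?andbT => /orP[]->; rewrite ?orbT.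
    case: eqP => [->|_]; last by rewrite subsetUl.
    by apply/subsetP => z; rewrite !inE ?eqxx ?andbT => /orP[]->; rewrite ?orbT.
  have notS w : w \in Q -> w != q3 -> w \notin S.
    by move=> wQ w3; rewrite in_setU1 (negPf w3) in_setC wQ.
  have yS := notS _ yQ; rewrite eq_sym in yS; have {}yS := yS (Uy _ q3U).
  have q2S : q2 \notin S by apply: notS; rewrite ?UQ // eq_sym.
  apply/pred0P => z /=; apply/negP => /andP[/(subsetP (Bs u)) + /(subsetP (Bs v))].
  rewrite !inE => /or3P[/eqP->|/andP[/eqP-> um]|/andP[/eqP-> um]].
  - case/or3P=> [|/andP[/eqP e _]|/andP[/eqP e _]]; first by rewrite (negPf uv).
      by rewrite -e uS in yS.
    by rewrite -e uS in q2S.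
  - case/or3P=> [/eqP e|/andP[_ vm]|/andP[/eqP e _]]; first by rewrite e vS in yS.
      by rewrite (eqP um) (eqP vm) eqxx in uv.
    by have := Uy _ q2U; rewrite -e eqxx.
  - case/or3P=> [/eqP e|/andP[/eqP e _]|/andP[_ vm]]; first by rewrite e vS in q2S.
      by have := Uy _ q2U; rewrite e eqxx.
    by rewrite (eqP um) (eqP vm) eqxx in uv.
have adjB u v w t : w \in B u -> t \in B v -> w -- t -> adjs (B u) (B v).
  by move=> wu tv wt; apply/adjsP; exists w, t.
pose R u v := (u != v) && [|| u -- v, (u \in M) && (v \in M), (u == q3) && (v \in M) | (v == q3) && (u \in M)].
have M1 u v : u \in M -> v \in M -> u != v -> ~~ (u -- v) -> (u == m1) || (u == m2) -> adjs (B u) (B v).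
  move=> uM vM uv nuv /orP[]/eqP eu.
    by apply: (@adjB u v y v) => //; [rewrite /B eu eqxx !inE eqxx orbT | apply: QM].
  apply: (@adjB u v q2 v) => //; last by apply: QM => //; exact: UQ.
  by rewrite /B eu (negPf m12) eqxx !inE eqxx orbT.
have MN v : v \in M -> v \in N by rewrite in_setD => /andP[].
have MM u v : u \in M -> v \in M -> u != v -> adjs (B u) (B v).
  move=> uM vM uv; have [uv'|nuv] := boolP (u -- v); first exact: (adjB _ _ u v).
  have [um|um] := boolP ((u == m1) || (u == m2)); first exact: M1.
  have [vm|vm] := boolP ((v == m1) || (v == m2)).
    by rewrite adjs_sym; apply: M1; rewrite // 1?eq_sym // adj_sym.
  exfalso; move: um vm; rewrite !negb_or => /andP[um1 um2] /andP[vm1 vm2].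
  have uX : u \in N :\ m1 :\ m2 by rewrite !in_setD1 um1 um2 MN.
  have vX : v \in N :\ m1 :\ m2 by rewrite !in_setD1 vm1 vm2 MN.
  have := msumD1 uX; rewrite M0 => /esym/eqP; rewrite addn_eq0 muln_eq0 /= cards_eq0 => /andP[_ /eqP/setP/(_ v)].
  by rewrite in_setI vX nonE uv nuv inE.
have r : rooted S B R.
  split=> [v _|//|u v uS vS]; first exact: cB.
  case/andP=> uv; split=> //; case/or4P: b => [uv'|/andP[uM vM]|/andP[/eqP-> vM]|/andP[/eqP-> uM]].
  - exact: (adjB _ _ u v).
  - exact: MM.
  - by apply: (adjB _ _ q3 v) => //; apply: QM => //; exact: UQ.
  - by apply: (adjB _ _ u q3) => //; rewrite adj_sym; apply: QM => //; exact: UQ.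
have r' : rooted (~: Q) B R.
  case: r => a1 a2 a3; have SS : {subset ~: Q <= S} by move=> v vA; rewrite in_setU1 vA orbT.
  by split=> [v /SS/a1//|u v /SS uA /SS vA|u v /SS uA /SS vA]; [exact: a2|exact: a3].
have low v : v \in ~: Q -> #|nbr v :&: ~: Q| + (v \in M) * #|non v :&: M| <= #|[set d in ~: Q | R v d]|.
  move=> vA; have [vM|vM] := boolP (v \in M); rewrite ?mul1n ?mul0n ?addn0; last first.
    apply: subset_leq_card; apply/subsetP => w; rewrite in_setI [w \in nbr v]inE in_set => /andP[vw ->].
    by rewrite /R adj_neq // vw.
  rewrite -card_disjU; last first.
    apply/pred0P => w; rewrite /= !in_setI nonE [w \in nbr v]inE.
    by case: (v -- w); rewrite ?andbF.
  apply: subset_leq_card; apply/subsetP => w; rewrite in_setU !in_setI [w \in nbr v]inE in_set nonE.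
  case/orP=> [/andP[vw ->]|/andP[/andP[vw _] wM]]; first by rewrite /R adj_neq // vw.
  by rewrite (subsetP MQ _ wM) /R vw vM wM orbT.
have lowsum : esum (~: Q) + msum N <= \sum_(v in ~: Q) #|[set d in ~: Q | R v d]|.
  apply: (@leq_trans (\sum_(v in ~: Q) (#|nbr v :&: ~: Q| + (v \in M) * #|non v :&: M|))); last first.
    by apply: leq_sum => v vA; apply: low.
  rewrite big_split /= leq_add2l msum_M.
  have -> : msum M = \sum_(v in M) #|non v :&: M| by [].
  rewrite [X in X <= _]big_mkcond [X in _ <= X]big_mkcond /=; apply: leq_sum => v _.
  by have [vM|//] := boolP (v \in M); rewrite (subsetP MQ) // mul1n.
have cE := clone_esum; have cA' := cA; have cM' := cM; rewrite cU in cA' cE.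
case: (mG) => n9 flo _ _.
have mA : msum N <= msum (~: Q) by rewrite msum_M; exact: (@esum_mono (compl G)).
have eA := msum_esum (~: Q).
(* On at least eight vertices, [~: Q] with [M] made complete violates minimality. On seven vertices
   the third clone [q3], adjacent to all of [M], supplies the eighth. Fewer than seven vertices
   cannot carry enough edges. *)
have [A8|A7] := leqP 8 #|~: Q|.
  have := min_rooted mG r' A8.
  have lt : #|~: Q| < #|G| by rewrite -cA' addnS ltnS leq_addr.
  move/(_ lt); move: cE flo lowsum mle m2' m4 cM' cA' UM U2 ek N6; clear; rewrite /=.
  move: (esum [set: G]) (esum (~: Q)) (\sum_(v in _) _) (msum N) #|G| #|N| #|M| #|~: Q| #|U| => a b c d e f g h i.
  by move=> *; have : i = 2 \/ i = 3 \/ i = 4; [lia|case=> [|[]] ?; subst i; lia].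
have [A7'|A6] := eqVneq #|~: Q| 7; last first.
  move: A7 A6 eA mA cE flo lowsum mle m2' m4 cM' cA' UM U2 ek N6 n9; clear; rewrite /=.
  move: (esum [set: G]) (esum (~: Q)) (\sum_(v in _) _) (msum N) (msum (~: Q)) #|G| #|N| #|M| #|~: Q| #|U| => a b c d d' e f g h i.
  move=> *; have hi : i = 2 \/ i = 3 \/ i = 4 by lia.
  have hh : h = 0 \/ h = 1 \/ h = 2 \/ h = 3 \/ h = 4 \/ h = 5 \/ h = 6 by lia.
  by case: hi => [|[]] ?; subst i; case: hh => [|[|[|[|[|[]]]]]] ?; subst h; lia.
apply: nK; apply: (hasK_rooted_sum r).
  by rewrite cardsU1 q3NQ A7'.
rewrite big_setU1 //=.
have lq : #|M| <= #|[set d in S | R q3 d]|.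
  apply: subset_leq_card; apply/subsetP => w wM; rewrite in_set [w \in S]in_setU1 (subsetP MQ _ wM) orbT /=.
  rewrite /R eqxx wM !orbT andbT; apply: contraNneq (MnotQ _ wM) => <-; exact: UQ.
have ls : esum (~: Q) + msum N + #|M| <= \sum_(v in ~: Q) #|[set d in S | R v d]|.
  have -> : #|M| = \sum_(v in ~: Q) (v \in M).
    rewrite -sum1_card [LHS]big_mkcond [RHS]big_mkcond; apply: eq_bigr => v _.
    by have [vM|] := boolP (v \in M); [rewrite (subsetP MQ) | case: ifP].
  apply: leq_trans (leq_add lowsum (leqnn _)) _; rewrite -big_split; apply: leq_sum => v vA /=.
  have q3n : q3 \notin [set d in ~: Q | R v d] by rewrite in_set (negPf q3NQ).
  have [vM|vM] := boolP (v \in M); rewrite ?addn0 ?addn1.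
    have := cardsU1 q3 [set d in ~: Q | R v d]; rewrite q3n add1n => <-.
    apply: subset_leq_card; apply/subsetP => w; rewrite in_setU1 in_set => H; rewrite in_set [w \in S]in_setU1.
    case/orP: H => [/eqP->|/andP[-> ->]]; last by rewrite orbT.
    rewrite eqxx /R eqxx vM !orbT andbT; apply: contraNneq (MnotQ _ vM) => ->; exact: UQ.
  apply: subset_leq_card; apply/subsetP => w; rewrite in_set => /andP[wA wR].
  by rewrite in_set [w \in S]in_setU1 wA wR orbT.
apply: leq_trans (leq_add lq ls).
have [kb eb] := esum_even (~: Q).
move: cE flo mle m2' m4 cM' cA' UM U2 ek N6 eA eb A7'; clear; rewrite /=.
move: (esum [set: G]) (esum (~: Q)) (msum N) (msum (~: Q)) #|G| #|N| #|M| #|~: Q| #|U| => a b d d' e f g h i.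
by move=> *; have : i = 2 \/ i = 3 \/ i = 4; [lia|case=> [|[]] ?; subst i; lia].
Qed.

(** After [keep6] and [fill_clones] there remains a complete [N] containing at least four clones of
    [y]. Removing [y] and the clones loses less than 9/2 edges per vertex, so the rest is too
    dense. *)
Lemma no_degree_six : #|N| = 6 -> False.
Proof.
move=> N6; have [le|gt] := leqP (2 + 2 * #|U| + msum N) 8; first exact: keep6.
have mle := msum_M_le N6; have [k ek] := msum_even N; have cM' := cM.
have [m2|m0] := leqP 2 (msum N).
  by apply: fill_clones => //; [|apply/andP; split=> //]; move: gt mle ek cM' m2; rewrite N6; clear; lia.
have U4 : 4 <= #|U| by move: gt mle ek cM' m0; rewrite N6; clear; lia.
have cE := clone_esum; have cA' := cA; rewrite cU in cA' cE; case: (mG) => n9 flo _ _.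
have lt : #|~: Q| < #|G| by rewrite -cA' addnS ltnS leq_addr.
have eA := esum_le (~: Q).
have ind : 8 <= #|~: Q| -> esum (~: Q) + 24 < 9 * #|~: Q| by move=> A8; apply: min_induced.
move: U4 cM' cE cA' n9 flo eA ind; rewrite N6; clear; rewrite /=.
move: (esum [set: G]) (esum (~: Q)) #|G| #|M| #|~: Q| #|U| => a b g f h i U4 cM' cE cA' n9 flo eA ind.
have hi : i = 4 \/ i = 5 \/ i = 6 by lia.
have [h8|h7] := leqP 8 h.
  by have := ind h8; case: hi => [|[]] ?; subst i; lia.
have hh : h = 0 \/ h = 1 \/ h = 2 \/ h = 3 \/ h = 4 \/ h = 5 \/ h = 6 \/ h = 7 by lia.
by case: hi => [|[]] ?; subst i; case: hh => [|[|[|[|[|[|[]]]]]]] ?; subst h; lia.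
Qed.

(** With u clones, removing them and [y] loses (u + 1)(10 - u)/2 edges, at most 9/2 per vertex,
    which minimality forbids when eight vertices remain. When seven remain, [y] is put back as the
    eighth. *)
Lemma no_degree_five_clones : #|N| = 5 -> 0 < #|U| -> False.
Proof.
move=> N5 U1; have cE := clone_esum; have cA' := cA; have cM' := cM; rewrite cU in cA' cE.
case: (mG) => n9 flo _ _.
have lt : #|~: Q| < #|G| by rewrite -cA' addnS ltnS leq_addr.
have eA := msum_esum (~: Q); have [kb eb] := esum_even (~: Q).
have ind : 8 <= #|~: Q| -> esum (~: Q) + 24 < 9 * #|~: Q| by move=> A8; apply: min_induced.
have yA : y \notin ~: Q by rewrite in_setC negbK in_setU1 eqxx.
have nonyA : #|non y :&: ~: Q| + #|M| <= #|~: Q|.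
  rewrite -card_disjU.
    by apply: subset_leq_card; rewrite subUset subsetIr MQ.
  apply/pred0P => v; rewrite /= in_setI nonE; apply/negP => /andP[/andP[/andP[_ nyv] _]].
  by rewrite in_setD => /andP[_ /adj_N yv]; rewrite yv in nyv.
have S8 : msum (y |: ~: Q) = msum (~: Q) + 2 * #|non y :&: ~: Q|.
  rewrite (@msumD1 _ _ y) ?in_setU1 ?eqxx // setU1K //; congr (_ + 2 * _).
  by apply: eq_card => v; rewrite !in_setI in_setU1 nonE; have [->|] := eqVneq v y; rewrite ?eqxx.
have direct : #|~: Q| = 7 -> msum (y |: ~: Q) <= 8 -> False.
  by move=> A7 le; apply/nK/(hasK_direct _ le); rewrite cardsU1 yA A7.
move: U1 cM' cE cA' n9 flo eA eb nonyA S8 direct ind; rewrite N5; clear; rewrite /=.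
move: (esum [set: G]) (esum (~: Q)) (msum (~: Q)) (msum (y |: ~: Q)) #|non y :&: ~: Q| #|G| #|M| #|~: Q| #|U| => a b m m' q g f h i U1 cM' cE cA' n9 flo eA eb nonyA S8 direct ind.
have hi : i = 1 \/ i = 2 \/ i = 3 \/ i = 4 \/ i = 5 by lia.
have [h8|h7] := leqP 8 h.
  by have := ind h8; case: hi => [|[|[|[]]]] ?; subst i; lia.
have [h7'|h6] := eqVneq h 7.
  by apply: direct => //; subst h; case: hi => [|[|[|[]]]] ?; subst i; lia.
have hh : h = 0 \/ h = 1 \/ h = 2 \/ h = 3 \/ h = 4 \/ h = 5 \/ h = 6 by lia.
by case: hi => [|[|[|[]]]] ?; subst i; case: hh => [|[|[|[|[|[]]]]]] ?; subst h; lia.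
Qed.
End Cases.

(** * Neighbourhoods that are cliques on five vertices *)

Lemma conn_clique (G : sgraph) (A : {set G}) : A != set0 -> {in A &, forall u v, u != v -> u -- v} -> conn A.
Proof.
move=> A0 cl; split=> // X /set0Pn[u uAX] /set0Pn[v vAX]; exists u, v; split=> //.
move: uAX vAX; rewrite in_setI in_setD => /andP[uA uX] /andP[vX vA]; apply: cl => //.
by apply: contraNneq vX => <-.
Qed.

Lemma hasK_add_set (G : sgraph) (B Z : {set G}) : #|B| = 7 -> conn Z -> [disjoint B & Z] ->
  msum B + 2 * #|[set v in B | ~~ adjs [set v] Z]| <= 8 -> hasK G.
Proof.
move=> B7 cZ d le; have [z zZ] : exists z, z \in Z by case: cZ => /set0Pn.
have zB : z \notin B by rewrite (disjointFl d).
pose F v := if v == z then Z else [set v].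
have Fz : F z = Z by rewrite /F eqxx.
have Fv v : v \in B -> F v = [set v].
  by move=> vB; rewrite /F; case: eqP => // e; rewrite e (negPf zB) in vB.
apply: (@hasK_sets _ (z |: B) F).
- by move=> v /setU1P[->|vB]; rewrite ?Fz ?Fv //; exact: conn1.
- move=> u v /setU1P[->|uB] /setU1P[->|vB] uv; rewrite ?Fz ?Fv //; first by rewrite eqxx in uv.
  + by rewrite disjoint_sym disjoints1 (disjointFr d).
  + by rewrite disjoints1 (disjointFr d).
  + by rewrite disjoints1 inE.
- by rewrite cardsU1 zB B7.
rewrite big_setU1 //=; set Q := [set v in B | _] in le.
apply: leq_trans le; rewrite mul2n -addnn addnCA; apply: leq_add.
  apply: subset_leq_card; apply/subsetP => v; rewrite !inE => /andP[/andP[vz]].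
  by rewrite (negPf vz) /= => vB; rewrite Fz Fv // vB adjs_sym.
have -> : #|Q| = \sum_(v in B) (v \in Q).
  rewrite -sum1_card [LHS]big_mkcond [RHS]big_mkcond; apply: eq_bigr => v _.
  by rewrite in_set; case: (v \in B).
rewrite /msum /esum -big_split; apply: leq_sum => v vB /=.
have -> : (v \in Q : nat) = #|if v \in Q then [set z] else set0|.
  by case: ifP; rewrite ?cards1 ?cards0.
apply: leq_trans (leq_card_setU _ _).1; apply: subset_leq_card; apply/subsetP => u.
rewrite in_set in_setD1 -andbA => /and3P[uv /setU1P[->|uB]] nadj; rewrite in_setU.
  by have -> : v \in Q; [move: nadj; rewrite in_set vB Fz Fv|rewrite set11 orbT].
by move: nadj; rewrite !Fv // adjs11 in_setI uB -/(non v) nonE eq_sym uv => ->.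
Qed.

Section DegreeFive.
Variable G : sgraph.
Hypothesis mG : minimal_dense G.
Hypothesis nK : ~ hasK G.
Variables (y x : G).
Hypothesis xy : x \notin cn y.
Let K := component (~: cn y) x.
Let N := nbr y.
Hypothesis N5 : #|N| = 5.
Hypothesis adjK : forall v, y -- v -> adjs [set v] K.

Let C6 : #|cn y| = 6. Proof. by rewrite card_cn -/N N5. Qed.
Let xC : x \in ~: cn y. Proof. by rewrite inE. Qed.

Lemma N_clique u v : u \in N -> v \in N -> u != v -> u -- v.
Proof.
move=> uN vN uv; have := non_deg mG xy uN; rewrite -/N N5 -[X in _ <= X]add0n leq_add2r leqn0.
rewrite cards_eq0 => /eqP/setP/(_ v); rewrite in_setI nonE uv vN in_set0 andbT.
by move/negbT; rewrite negbK.
Qed.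

Lemma cn_clique u v : u \in cn y -> v \in cn y -> u != v -> u -- v.
Proof.
rewrite !cnE => /orP[/eqP->|yu] /orP[/eqP->|yv]; rewrite ?eqxx //; first by rewrite adj_sym.
by apply: N_clique; rewrite inE.
Qed.

Lemma esum_clique (A : {set G}) : {in A &, forall u v, u != v -> u -- v} -> esum A = #|A| * #|A|.-1.
Proof.
move=> cl; rewrite /esum -sum_nat_const; apply: eq_bigr => u uA.
rewrite (cardsD1 u A) uA /=; apply: eq_card => v; rewrite in_setI in_setD1 inE.
have [vA|] := boolP (v \in A); rewrite ?andbF ?andbT //.
by have [->|vu] := eqVneq v u; [rewrite adj_irrefl | rewrite cl // eq_sym].
Qed.

(** Deleting [y] loses five edges, the fewest that minimality allows, so the bound is attained. The
    degree sum is even, which excludes nine vertices. *)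
Lemma exact_density : esum [set: G] + 24 = 9 * #|G| /\ 10 <= #|G|.
Proof.
case: mG => n9 flo fhi _; have [k ek] := esum_even [set: G].
have c1 : #|[set~ y]| = #|G|.-1 by rewrite cardsC1.
have := esumD1 (in_setT y); rewrite setIT -/N N5 -[setT :\ y]/(setT :\: [set y]) setTD => e.
have h : esum [set~ y] + 24 < 9 * #|[set~ y]| by apply: min_induced => //; rewrite c1; lia.
by rewrite c1 in h; split; lia.
Qed.

(** Otherwise delete [y] and contract [u v]: two vertices disappear, but only 5 + 4 = 9 edges,
    because [u] and [v] then share just three neighbours. The bound would survive. *)
Lemma common_outside u v : u \in N -> v \in N -> u != v ->
  exists z, [/\ z \notin cn y, u -- z & v -- z].
Proof.
move=> uN vN uv; have uv' := N_clique uN vN uv.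
have [/existsP[z /and3P[]]|/existsPn no] := boolP [exists z, [&& z \notin cn y, u -- z & v -- z]].
  by exists z.
exfalso; have [ex n10] := exact_density.
have yu : y -- u by move: uN; rewrite inE.
have yv : y -- v by move: vN; rewrite inE.
have yNv : y != v := adj_neq yv.
pose A := [set~ v] :\ y.
have cA : #|A| = #|G|.-2.
  by have := cardsD1 y [set~ v]; rewrite !inE yNv cardsC1 /A; lia.
set W := [set w in A :\ u | ~~ (u -- w) && adjs [set w] [set v]].
have H : esum A + 2 * #|W| + 24 < 9 * #|A|.
  have [n8 n2] : 8 <= #|G|.-2 /\ #|G|.-2 < #|G| by move: n10; clear; lia.
  apply: min_contract => //; rewrite ?cA //; last exact: conn2.
    by rewrite !inE uv eq_sym adj_neq.
  by rewrite disjoint_sym disjoints1 !inE eqxx andbF.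
have e1 := esumD1 (in_setT v); rewrite setIT -[setT :\ v]/(setT :\: [set v]) setTD in e1.
have yA : y \in [set~ v] by rewrite !inE.
have e2 := esumD1 yA; rewrite -/A in e2.
have e3 : #|nbr y :&: [set~ v]| = 4.
  have := cardsD1 v N; rewrite vN N5 => -[->]; apply: eq_card => w.
  by rewrite !inE andbC.
have : #|nbr v| <= #|(cn y :\ v) :|: W|.
  apply: subset_leq_card; apply/subsetP => w; rewrite [w \in nbr v]inE => vw.
  have wv : w != v by rewrite eq_sym adj_neq.
  rewrite in_setU in_setD1 wv /=; have [//|wy] := boolP (w \in cn y).
  have uw : ~~ (u -- w) by have := no w; rewrite wy vw andbT.
  have wu : w != u by apply: contraNneq wy => ->; rewrite cnE yu orbT.
  have wNy : w != y by apply: contraNneq wy => ->; rewrite cnE eqxx.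
  by rewrite in_set !inE wu wNy wv uw adjs11 adj_sym vw.
have := (leq_card_setU (cn y :\ v) W).1.
have vc : v \in cn y by rewrite cnE yv orbT.
have := cardsD1 v (cn y); rewrite vc C6.
by rewrite cA in H; move: H e1 e2 e3 ex n10; clear; lia.
Qed.

Definition sees (X : {set G}) := #|[set v in N | adjs [set v] X]|.

Lemma sees_sub (X Y : {set G}) : X \subset Y -> sees X <= sees Y.
Proof.
move=> XY; apply: subset_leq_card; apply/subsetP => v; rewrite !inE => /andP[->].
by apply: adjs_sub.
Qed.

Lemma sees_le5 (X : {set G}) : sees X <= 5.
Proof. by rewrite -N5; apply: subset_leq_card; apply/subsetP => v; rewrite inE => /andP[]. Qed.

(* The branch sets are [W1], [W2] and the single vertices of [cn y]. *)
Lemma two_sets (W1 W2 : {set G}) (k : nat) : conn W1 -> conn W2 -> [disjoint W1 & W2] ->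
  W1 \subset ~: cn y -> W2 \subset ~: cn y -> ~~ adjs W1 W2 <= k ->
  8 + k <= sees W1 + sees W2 -> False.
Proof.
move=> c1 c2 d12 s1 s2 adj12 le; apply: nK.
have [w1 w1W] : exists w, w \in W1 by case: c1 => /set0Pn.
have [w2 w2W] : exists w, w \in W2 by case: c2 => /set0Pn.
have o1 v : v \in W1 -> v \notin cn y by move/(subsetP s1); rewrite inE.
have o2 v : v \in W2 -> v \notin cn y by move/(subsetP s2); rewrite inE.
have w12 : w1 != w2 by apply/eqP => e; rewrite -e in w2W; rewrite (disjointFr d12 w1W) in w2W.
pose B v := if v == w1 then W1 else if v == w2 then W2 else [set v].
have B1 : B w1 = W1 by rewrite /B eqxx.
have B2 : B w2 = W2 by rewrite /B eq_sym (negPf w12) eqxx.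
have Bc v : v \in cn y -> B v = [set v].
  move=> vy; rewrite /B; case: eqP => [e|_]; first by rewrite e (negPf (o1 _ w1W)) in vy.
  by case: eqP => [e|//]; rewrite e (negPf (o2 _ w2W)) in vy.
pose A := w1 |: (w2 |: cn y).
have n1 : w1 \notin w2 |: cn y by rewrite in_setU1 negb_or w12 o1.
have n2 : w2 \notin cn y := o2 _ w2W.
have memA v : v \in A -> [\/ v = w1, v = w2 | v \in cn y].
  by rewrite in_setU1 [v \in w2 |: _]in_setU1 => /or3P[/eqP|/eqP|]; [constructor 1|constructor 2|constructor 3].
have A1 : w1 \in A by rewrite setU11.
have A2 : w2 \in A by rewrite in_setU1 setU11 orbT.
apply: (@hasK_sets _ A B).
- by move=> v _; rewrite /B; case: eqP => // _; case: eqP => // _; exact: conn1.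
- have disj u v : u \in cn y -> v \in A -> u != v -> [disjoint B u & B v].
    move=> uy vA uv; rewrite (Bc u) // disjoints1 /B; case: eqP => _; first by apply: contraL uy => /o1.
    by case: eqP => _; [apply: contraL uy => /o2 | rewrite inE].
  move=> u v uA vA uv; case: (memA _ uA) => [e|e|uy]; last exact: disj.
    subst u; case: (memA _ vA) => [e|->|vy]; first by rewrite e eqxx in uv.
      by rewrite B1 B2.
    by rewrite disjoint_sym; apply: disj; rewrite 1?eq_sym.
  subst u; case: (memA _ vA) => [->|e|vy]; last 1 first.
  - by rewrite disjoint_sym; apply: disj; rewrite 1?eq_sym.
  - by rewrite B1 B2 disjoint_sym.
  - by rewrite e eqxx in uv.
- by rewrite cardsU1 n1 cardsU1 n2 C6.
rewrite /A big_setU1 // big_setU1 //=.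
set m := fun v => [set d in (w1 |: (w2 |: cn y)) :\ v | ~~ adjs (B v) (B d)].
rewrite -/(m w1) -/(m w2).
pose NS (X : {set G}) := [set v in cn y | ~~ adjs [set v] X].
(* The total is 6 and not 5 because [y] has no neighbour in [X]. So [y] accounts for two missing
   pairs, and two more are left for [N] when [W1] and [W2] are adjacent. *)
have cNS (X : {set G}) : X \subset ~: cn y -> #|NS X| + sees X = 6.
  move=> sX; rewrite -C6 -(cardsID [set v | adjs [set v] X] (cn y)) addnC; congr (_ + _).
    apply: eq_card => v; rewrite !inE; case: eqP => [->|//]; rewrite adj_irrefl /=.
    case: adjsP => // -[u [w [/set1P-> wX yw]]].
    by have := subsetP sX _ wX; rewrite inE cnE yw orbT.
  by apply: eq_card => v; rewrite !inE andbC.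
have m1 : #|m w1| <= ~~ adjs W1 W2 + #|NS W1|.
  have -> : (~~ adjs W1 W2 : nat) = #|if adjs W1 W2 then set0 else [set w2]|.
    by case: ifP; rewrite ?cards0 ?cards1.
  apply: leq_trans (leq_card_setU _ _).1; apply: subset_leq_card; apply/subsetP => v.
  rewrite in_set in_setD1 -andbA => /and3P[vw vA nadj]; rewrite in_setU.
  case: (memA _ vA) => [e|e|vy]; first by rewrite e eqxx in vw.
    by move: nadj; rewrite e B1 B2 => /negPf->; rewrite set11.
  by rewrite in_set vy; move: nadj; rewrite B1 Bc // adjs_sym => ->; rewrite orbT.
have m2 : #|m w2| <= ~~ adjs W1 W2 + #|NS W2|.
  have -> : (~~ adjs W1 W2 : nat) = #|if adjs W1 W2 then set0 else [set w1]|.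
    by case: ifP; rewrite ?cards0 ?cards1.
  apply: leq_trans (leq_card_setU _ _).1; apply: subset_leq_card; apply/subsetP => v.
  rewrite in_set in_setD1 -andbA => /and3P[vw vA nadj]; rewrite in_setU.
  case: (memA _ vA) => [e|e|vy]; last 1 first.
  - by rewrite in_set vy; move: nadj; rewrite B2 Bc // adjs_sym => ->; rewrite orbT.
  - by move: nadj; rewrite e B1 B2 adjs_sym => /negPf->; rewrite set11.
  - by rewrite e eqxx in vw.
have m3 : \sum_(v in cn y) #|m v| <= #|NS W1| + #|NS W2|.
  have cnt (X : {set G}) : #|NS X| = \sum_(v in cn y) (v \in NS X).
    rewrite -sum1_card [LHS]big_mkcond [RHS]big_mkcond; apply: eq_bigr => v _.
    by rewrite in_set; case: (v \in cn y).
  rewrite !cnt -big_split; apply: leq_sum => v vy /=.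
  pose f (b : bool) (w : G) : {set G} := if b then [set w] else set0.
  have cf b w : #|f b w| = b by rewrite /f; case: b; rewrite ?cards0 ?cards1.
  rewrite -(cf _ w1) -(cf (v \in NS W2) w2); apply: leq_trans (leq_card_setU _ _).1.
  apply: subset_leq_card; apply/subsetP => u; rewrite in_set in_setD1 -andbA => /and3P[uv uA nadj].
  rewrite in_setU; case: (memA _ uA) => [e|e|uy].
  - by have -> : v \in NS W1; [move: nadj; rewrite e B1 Bc // in_set vy|rewrite /f e set11].
  - by have -> : v \in NS W2; [move: nadj; rewrite e B2 Bc // in_set vy|rewrite /f e set11 orbT].
  - by move: nadj; rewrite !Bc // adjs11 cn_clique // eq_sym.
have := cNS _ s1; have := cNS _ s2.
move: m1 m2 m3 le adj12; move: (sees W1) (sees W2) #|NS W1| #|NS W2| (~~ adjs W1 W2 : nat) => a b c d e.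
move: #|m w1| #|m w2| (\sum_(v in cn y) _) => p q r; clear; lia.
Qed.

Lemma degsE (A B : {set G}) : (forall v, v \in A -> nbr v \subset A :|: B) -> [disjoint A & B] ->
  degs A setT = esum A + degs A B.
Proof.
move=> sub d; rewrite -[esum A]/(degs A A) -degsUr //; apply: eq_bigr => v vA.
by rewrite setIT (setIidPl (sub _ vA)).
Qed.

Lemma esum_separation (D S : {set G}) : [disjoint D & S] ->
  (forall v, v \in D -> nbr v \subset D :|: S) ->
  esum [set: G] + esum S = esum (D :|: S) + esum (~: D).
Proof.
move=> d sub; have DD : [disjoint D & ~: D] by rewrite -setI_eq0 setICr.
have := esumU DD; rewrite setUCr => ->; rewrite esumU //.
have -> : degs D (~: D) = degs D S; last by lia.
have h := degsE sub d.
have h2 : degs D setT = esum D + degs D (~: D).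
  by apply: degsE => // v _; rewrite setUCr subsetT.
lia.
Qed.

(** Another component [D] seeing four vertices of [N] gives the minor together with [K], which sees
    all five. If [D] sees at most three, a clique of that size cuts it off, and the bounds for
    [D :|: S] and [~: D] add up to a contradiction with exact density. *)
Lemma K_all z : z \notin cn y -> z \in K.
Proof.
move=> zy; apply: contraT => zK.
have zC : z \in ~: cn y by rewrite inE.
set D := component (~: cn y) z.
have DC : D \subset ~: cn y := component_sub zC.
have KC : K \subset ~: cn y := component_sub xC.
have DK : [disjoint D & K].
  apply/pred0P => v /=; apply/negP => /andP[vD vK].
  by move: zK; rewrite /K -(component_eq xC vK) (component_eq zC vD) component_self.
have [n9 flo fhi _] := mG; have [ex n10] := exact_density.
pose S := [set v in N | adjs [set v] D].
have S5 : #|S| <= 5 := sees_le5 D.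
have K5 : sees K = 5.
  by rewrite -N5; apply: eq_card => v; rewrite !inE; case yv : (y -- v) => //=; apply: adjK.
have [s4|s3] := leqP 4 (sees D).
  have := @two_sets K D 1; case=> //; try exact: component_conn; try by rewrite disjoint_sym.
    by case: (adjs _ _).
  by rewrite K5 -[8 + 1]/(5 + 4) leq_add2l.
exfalso.
have DS : [disjoint D & S].
  apply/pred0P => v /=; apply/negP => /andP[/(subsetP DC)]; rewrite !inE negb_or => /andP[_ /negPf->].
  by [].
have sub v : v \in D -> nbr v \subset D :|: S.
  move=> vD; apply/subsetP => w; rewrite [w \in nbr v]inE => vw; rewrite in_setU.
  have [//|wD] := boolP (w \in D).
  have := component_nbr zC vD vw wD; rewrite in_setC negbK cnE => /orP[/eqP e|yw].
    have := subsetP DC _ vD; rewrite in_setC cnE negb_or -e => /andP[_].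
    by rewrite adj_sym vw.
  by rewrite in_set [w \in N]inE yw adjs1; apply/existsP; exists v; rewrite vD adj_sym.
have Sc : esum S = #|S| * #|S|.-1.
  apply: esum_clique => u v; rewrite !in_set => /andP[uN _] /andP[vN _].
  by apply: N_clique; rewrite inE.
have E := esum_separation DS sub.
have c1 : #|D :|: S| = #|D| + #|S| := card_disjU DS.
have c2 : #|D| + #|~: D| = #|G| by rewrite cardsC.
have s1 : 6 <= #|D :|: S|.
  have zD : z \in D by exact: component_self.
  have : #|cn z| <= #|D :|: S|.
    by apply: subset_leq_card; rewrite subUset sub1set inE zD sub.
  by rewrite card_cn; apply: leq_trans; rewrite ltnS; exact: min_degree.
have yCD : y \notin D :|: S.
  rewrite in_setU negb_or; apply/andP; split; last by rewrite !inE adj_irrefl.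
  by apply/negP => /(subsetP DC); rewrite inE cnE eqxx.
have l1 : #|D :|: S| < #|G|.
  by rewrite -cardsT; apply: proper_card; rewrite properT; apply: contraNneq yCD => ->; rewrite inE.
have xD : x \notin D by rewrite (disjointFl DK) // component_self.
have cnD : x |: cn y \subset ~: D.
  rewrite subUset sub1set in_setC xD /=; apply/subsetP => v vy; rewrite in_setC.
  by apply: contraL vy => /(subsetP DC); rewrite in_setC.
have s2 : 7 <= #|~: D| by have := subset_leq_card cnD; rewrite cardsU1 xy C6.
have d0 : 0 < #|D| by apply/card_gt0P; exists z; exact: component_self.
have h1 : 8 <= #|D :|: S| -> esum (D :|: S) + 24 < 9 * #|D :|: S|.
  by move=> h; apply: min_induced.
have h2 : 8 <= #|~: D| -> esum (~: D) + 24 < 9 * #|~: D|.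
  by move=> h; apply: min_induced => //; rewrite -c2 -[X in X < _]add0n ltn_add2r.
have h3 : #|~: D| = 7 -> esum (~: D) <= 40.
  move=> h; have e : ~: D = x |: cn y.
    by apply/eqP; rewrite eq_sym eqEcard cnD h cardsU1 xy C6.
  have yx : y \in non x by rewrite nonE -negb_or adj_sym -cnE.
  have := msum_esum (~: D); rewrite h.
  have xCD : x \in ~: D by rewrite in_setC.
  have := msumD1 xCD; have : 0 < #|non x :&: ~: D|.
    by apply/card_gt0P; exists y; rewrite in_setI yx e in_setU1 cnE eqxx orbT.
  by move: (msum _) (msum _) (esum _) #|_ :&: _| => a b c d; clear; lia.
have h4 := esum_le (D :|: S).
have [k ek] := esum_even [set: G].
have {}s3 : #|S| <= 3 by rewrite -ltnS.
move: E Sc c1 c2 s1 s2 h1 h2 h3 h4 ek ex s3 d0 n10; clear.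
move: (esum [set: G]) (esum S) (esum (D :|: S)) (esum (~: D)) #|D :|: S| #|D| #|S| #|~: D| #|G|.
move=> e es e1 e2 n1 d s n2 n E Sc c1 c2 s1 s2 h1 h2 h3 h4 ek ex s3 d0 n10.
have hs : s = 0 \/ s = 1 \/ s = 2 \/ s = 3 by lia.
have hn : n1 = 6 \/ n1 = 7 \/ 8 <= n1 by lia.
have hn2 : n2 = 7 \/ 8 <= n2 by lia.
by case: hn => [?|[?|hn]]; case: hn2 => [?|hn2]; case: hs => [?|[?|[?|?]]]; subst; simpl in *; lia.
Qed.

Let W := ~: cn y.

Lemma WK : W = K.
Proof.
apply/eqP; rewrite eqEsubset; apply/andP; split; last exact: component_sub.
by apply/subsetP => z; rewrite inE; exact: K_all.
Qed.

Lemma W_conn : conn W.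
Proof. by rewrite WK; exact: component_conn. Qed.

Lemma W_size : 4 <= #|W|.
Proof.
have [_ n10] := exact_density; move: n10; rewrite -(cardsC (cn y)) C6 -[10]/(6 + 4).
by rewrite leq_add2l.
Qed.

Lemma W_nbr v : v \in N -> exists2 z, z \in W & v -- z.
Proof.
rewrite inE => yv; have := adjK yv; rewrite -WK adjs1 => /existsP[z /andP[zW vz]].
by exists z.
Qed.

Lemma sees_of X (J : {set G}) : (forall v, v \in N -> v \notin J -> adjs [set v] X) -> J \subset N ->
  5 <= sees X + #|J|.
Proof.
move=> h JN; rewrite -N5 addnC -leq_subLR -(setIidPr JN) -cardsD; apply: subset_leq_card.
by apply/subsetP => v; rewrite in_setD in_set => /andP[vJ vN]; rewrite vN h.
Qed.

Lemma split_sets X Y : conn X -> conn Y -> [disjoint X & Y] -> X :|: Y = W -> 8 <= sees X + sees Y -> False.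
Proof.
move=> cX cY d e le; apply: (@two_sets X Y 0) => //; rewrite -/W -?e ?subsetUl ?subsetUr //.
suff -> : adjs X Y by [].
case: W_conn => _ /(_ X); rewrite -e setUK setDUl setDv set0U.
have -> : Y :\: X = Y by apply/setDidPl; rewrite disjoint_sym.
case: cX cY => X0 _ [Y0 _] /(_ X0 Y0) [u [v [uX vY uv]]].
by apply/adjsP; exists u, v.
Qed.

(** If [z] saw three vertices, [[set z]] and [W :\ z] would see eight together, unless some vertices
    of [N] have [z] as only neighbour in [W]. Then [z] sees all of [N], so at least three such
    vertices exist, and with [y] they form a clique of four that is too loosely attached. *)
Lemma noncut_small z : z \in W -> conn (W :\ z) -> sees [set z] <= 2.
Proof.
move=> zW cz; rewrite leqNgt; apply/negP => s3.
have zy : z \notin cn y by move: zW; rewrite inE.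
have split : 8 <= sees [set z] + sees (W :\ z) -> False.
  apply: split_sets => //; first exact: conn1; last exact: setD1K.
  by rewrite disjoints1 !inE eqxx.
set J := [set v in N | ~~ adjs [set v] (W :\ z)].
have JN : J \subset N by apply/subsetP => v; rewrite in_set => /andP[].
have sW : 5 <= sees (W :\ z) + #|J|.
  by apply: sees_of => // v vN; rewrite in_set vN negbK.
have only v w : v \in J -> w \in W -> v -- w -> w = z.
  rewrite in_set => /andP[_ nadj] wW vw; apply/eqP; apply: contraNT nadj => wz.
  by rewrite adjs1; apply/existsP; exists w; rewrite in_setD1 wz wW.
have zall v0 v : v0 \in J -> v \in N -> v -- z.
  move=> v0J vN; have [->|vv] := eqVneq v v0.
    have [w wW vw] := W_nbr (subsetP JN _ v0J).
    by rewrite -(only _ _ v0J wW vw).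
  have [w [wy vw v0w]] := common_outside vN (subsetP JN _ v0J) vv.
  by rewrite -(only _ _ v0J _ v0w) // inE.
have [J0|[v0 v0J]] := set_0Vmem J.
  by apply: split; move: sW s3; rewrite J0 cards0 addn0; clear; lia.
have s5 : sees [set z] = 5.
  rewrite -N5; apply: eq_card => v; rewrite in_set; case vN : (v \in N) => //=.
  by rewrite adjs11 (zall _ _ v0J).
have [J2|J3] := leqP #|J| 2.
  by apply: split; rewrite s5; move: sW J2; clear; lia.
have [n9 flo fhi IH] := mG; have [ex n10] := exact_density.
have [|J' _ [J'J J'3]] := @exists_subset_card _ set0 J 3 (sub0set J); first by rewrite cards0.
have J'N := subset_trans J'J JN.
pose X := y |: J'.
have yJ' : y \notin J' by apply/negP => /(subsetP J'N); rewrite nbr_irr.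
have X4 : #|X| = 4 by rewrite cardsU1 yJ' J'3.
have Xcn : X \subset cn y.
  by apply/subsetP => v; rewrite in_setU1 in_setU1 => /orP[->//|/(subsetP J'N)->]; rewrite orbT.
have Xc : esum X = 12.
  by rewrite esum_clique ?X4 // => u v /(subsetP Xcn) uX /(subsetP Xcn); apply: cn_clique.
(* [y] has two neighbours outside [X], and each of the three others has at most these two and [z].
   Removing [X] loses at most 6 + 11 = 17 < 18 edges. *)
have dX : degs X (~: X) <= 11.
  rewrite /degs big_setU1 //= -[11]/(2 + 9); apply: leq_add.
    apply: (@leq_trans #|N :\: J'|); last by rewrite cardsD (setIidPr J'N) N5 J'3.
    apply: subset_leq_card; apply/subsetP => w; rewrite in_setI in_setC => /andP[yw].
    by rewrite [w \in X]in_setU1 negb_or in_setD => /andP[_ ->].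
  apply: (@leq_trans (\sum_(v in J') 3)); last by rewrite sum_nat_const J'3.
  apply: leq_sum => v vJ'.
  apply: (@leq_trans #|z |: (N :\: J')|); last first.
    rewrite cardsU1 cardsD (setIidPr J'N) N5 J'3.
    by case: (_ \notin _).
  apply: subset_leq_card; apply/subsetP => w; rewrite in_setI inE in_setC => /andP[vw].
  rewrite [w \in X]in_setU1 negb_or in_setU1 in_setD => /andP[wy wJ'].
  have [wN|wN] := boolP (w \in N); first by rewrite wJ' orbT.
  have wW : w \in W by rewrite inE cnE negb_or wy; move: wN; rewrite inE.
  by rewrite (only v w) ?eqxx // (subsetP J'J).
have dXX : [disjoint X & ~: X] by rewrite -setI_eq0 setICr.
have E := esumU dXX; rewrite setUCr Xc in E.
have cX : #|X| + #|~: X| = #|G| by rewrite cardsC.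
rewrite X4 in cX.
have [n8|n8] := leqP 8 #|~: X|.
  have h := min_induced mG n8.
  by move: h E ex cX dX; clear; lia.
have W4 : #|W| = 4.
  have := cardsC (cn y); rewrite C6 -/W; have [k ek] := esum_even [set: G].
  by move: ek cX n8 n10 ex; clear; lia.
have n10' : #|G| = 10 by rewrite -(cardsC (cn y)) C6 -/W W4.
have dWC : [disjoint cn y & W] by rewrite -setI_eq0 setICr.
have E2 := esumU dWC; rewrite setUCr (esum_clique cn_clique) C6 in E2.
have eW := esum_le W; rewrite W4 in eW.
have cNW : degs W (cn y) <= 11.
  rewrite /degs (big_setD1 z zW) /= -[11]/(5 + 6); apply: leq_add.
    rewrite -N5; apply: subset_leq_card; apply/subsetP => w; rewrite in_setI inE cnE => /andP[zw].
    by case/orP=> [/eqP e|yw]; [move: zy; rewrite cnE -e adj_sym zw orbT|rewrite inE].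
  apply: (@leq_trans (\sum_(v in W :\ z) 2)); last first.
    by rewrite sum_nat_const; have := cardsD1 z W; rewrite zW W4 add1n => -[<-].
  apply: leq_sum => w; rewrite in_setD1 => /andP[wz wW].
  apply: (@leq_trans #|N :\: J'|); last by rewrite cardsD (setIidPr J'N) N5 J'3.
  apply: subset_leq_card; apply/subsetP => v; rewrite in_setI inE cnE in_setD => /andP[wv].
  case/orP=> [/eqP e|yv].
    by move: wW; rewrite inE cnE -e adj_sym wv orbT.
  rewrite [v \in N]inE yv andbT; apply: contra wz => /(subsetP J'J) vJ.
  by apply/eqP; apply: (only v) => //; rewrite adj_sym.
rewrite degs_sym in cNW.
by move: E2 ex n10' eW cNW; clear; simpl; lia.
Qed.

Lemma component_off_cut c z : c \in W -> z \in W -> z != c ->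
  adjs [set c] (component (W :\ c) z).
Proof.
move=> cW zW zc; have zA : z \in W :\ c by rewrite in_setD1 zc.
set D := component _ _; have DW : D \subset W :\ c := component_sub zA.
have zD : z \in D by exact: component_self.
case: W_conn => _ /(_ D); case.
- by apply/set0Pn; exists z; rewrite in_setI zW.
- apply/set0Pn; exists c; rewrite in_setD cW andbT; apply/negP => /(subsetP DW).
  by rewrite in_setD1 eqxx.
move=> u [v []]; rewrite in_setI in_setD => /andP[_ uD] /andP[vD vW] uv.
have := component_nbr zA uD uv vD; rewrite in_setD1 vW andbT negbK => /eqP e.
by rewrite adjs1; apply/existsP; exists u; rewrite uD -e adj_sym.
Qed.

(** [c] and the at most three vertices of [L] separate [D]. Contracting [D] into [c] joins [c] to
    all of [L], so this separator becomes a clique on the other side. Adding the edge counts of both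
    sides leaves room only for a component of three vertices that is nearly complete together with
    its separator. *)
Lemma cut_low c z (D := component (W :\ c) z) (L := [set v in N | adjs [set v] D]) :
  c \in W -> z \in W :\ c -> W :\ c != D -> sees D <= 3 ->
  [/\ #|L| = 3, #|c |: (D :|: L)| = 7 & msum (c |: (D :|: L)) <= 2].
Proof.
move=> cW zA ne s3; have DA : D \subset W :\ c := component_sub zA.
have zD : z \in D by exact: component_self.
have cD : c \notin D by apply/negP => /(subsetP DA); rewrite in_setD1 eqxx.
have DW : D \subset W by apply: subset_trans DA (subsetDl _ _).
have cNy : c \notin cn y by move: cW; rewrite in_setC.
have [[n9 _ _ _] [ex n10]] := (mG, exact_density).
have [t tA tD] : exists2 t, t \in W :\ c & t \notin D.
  move: ne; rewrite eqEsubset DA andbT => /subsetPn[t tA tD].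
  by exists t.
have zW := subsetP DW _ zD; have zc : z != c by move: zA; rewrite in_setD1 => /andP[].
have Ls : #|L| <= 3 := s3.
have LN : L \subset N by apply/subsetP => v; rewrite in_set => /andP[].
pose S := c |: L.
have cL : c \notin L.
  by apply/negP => /(subsetP LN); move: cNy; rewrite cnE negb_or inE => /andP[_ /negPf->].
have ND v : v \in cn y -> v \notin D.
  by apply: contraL => /(subsetP DW); rewrite in_setC.
have DS : [disjoint D & S].
  rewrite -setI_eq0 -subset0; apply/subsetP => v; rewrite in_setI in_set0 => /andP[vD].
  rewrite in_setU1 => /orP[/eqP e|/(subsetP LN)]; first by rewrite e (negPf cD) in vD.
  by move=> vN; move: vD; rewrite (negPf (ND _ _)) // in_setU1 vN orbT.
have sub v : v \in D -> nbr v \subset D :|: S.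
  move=> vD; apply/subsetP => w; rewrite [w \in nbr v]inE => vw; rewrite in_setU.
  have [//|wD] := boolP (w \in D).
  have := component_nbr zA vD vw wD; rewrite in_setD1 negb_and negbK in_setU1.
  case/orP=> [->//|]; rewrite in_setC negbK cnE => /orP[/eqP e|yw].
    by have := subsetP DW _ vD; rewrite in_setC cnE negb_or -e adj_sym vw andbF.
  rewrite orFb in_set [w \in N]inE yw adjs1 /=; apply/orP; right.
  by apply/existsP; exists v; rewrite vD adj_sym.
have E := esum_separation DS sub.
have eL : esum L = #|L| * #|L|.-1.
  by apply: esum_clique => u v /(subsetP LN) uN /(subsetP LN); apply: N_clique.
have eS : esum S = esum L + 2 * #|nbr c :&: L|.
  rewrite (esumD1 (setU11 c L)) -/S; congr (esum _ + 2 * _); first exact: setU1K.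
  apply: eq_card => v; rewrite !in_setI [v \in S]in_setU1.
  by case: eqP => // ->; rewrite nbr_irr.
have cDL : #|nbr c :&: L| + #|L :\: nbr c| = #|L| by rewrite setIC cardsID.
have cDS : #|D :|: S| = #|D| + #|L|.+1 by rewrite card_disjU // cardsU1 cL.
have cDc : #|D| + #|~: D| = #|G| by rewrite cardsC.
have d0 : 0 < #|D| by apply/card_gt0P; exists z.
have cD' : c \in ~: D by rewrite in_setC.
have A8 : 8 <= #|~: D|.
  have : #|t |: (c |: cn y)| <= #|~: D|.
    apply: subset_leq_card; apply/subsetP => v; rewrite in_setU1 in_setU1 in_setC.
    by case/or3P=> [/eqP->|/eqP->|/ND].
  move: tA; rewrite in_setD1 in_setC => /andP[tc ty].
  by rewrite cardsU1 in_setU1 negb_or tc ty cardsU1 cNy C6.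
have AG : #|~: D| < #|G| by rewrite -cDc -[X in X < _]add0n ltn_add2r.
have ccD : conn (c |: D).
  apply: connU1; first exact: component_conn.
  by have := component_off_cut cW zW zc; rewrite adjs1.
have dD : [disjoint ~: D & D] by rewrite disjoint_sym -setI_eq0 setICr.
have h := min_contract mG cD' dD ccD A8 AG.
set Q := [set w in _ | _] in h.
have LQ : #|L :\: nbr c| <= #|Q|.
  apply: subset_leq_card; apply/subsetP => v; rewrite in_setD [v \in nbr c]inE => /andP[cv vL].
  have vN := subsetP LN _ vL; rewrite in_set in_setD1 in_setC cv ND ?in_setU1 ?vN ?orbT //=.
  rewrite andbT; apply/andP; split; first by apply: contraNneq cL => <-.
  by move: vL; rewrite in_set => /andP[].
have s6 : 6 <= #|D :|: S|.
  have : #|cn z| <= #|D :|: S|.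
    by apply: subset_leq_card; rewrite subUset sub1set in_setU zD sub.
  by rewrite card_cn; apply: leq_trans; rewrite ltnS; exact: min_degree.
have eB := esum_le (D :|: S).
have l1 : #|D :|: S| < #|G|.
  rewrite -cardsT; apply: proper_card; rewrite properT; apply/eqP => e.
  have : y \in D :|: S by rewrite e in_setT.
  rewrite in_setU (negPf (ND y _)) ?in_setU1 ?eqxx //= => /orP[/eqP yc|/(subsetP LN)].
    by rewrite -yc setU11 in cNy.
  by rewrite nbr_irr.
have h2 : 8 <= #|D :|: S| -> esum (D :|: S) + 24 < 9 * #|D :|: S|.
  by move=> h8; apply: min_induced.
have eqB : c |: (D :|: L) = D :|: S by rewrite setUCA.
have M := msum_esum (D :|: S); rewrite eqB.
have [k ek] := msum_even (D :|: S).
suff : #|L| = 3 /\ #|D :|: S| = 7 /\ msum (D :|: S) <= 2 by case=> -> [-> ->].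
move: E eL eS cDL cDS cDc d0 h LQ s6 eB h2 M Ls ex ek; clear.
move: (esum setT) (esum S) (esum L) (esum (D :|: S)) (esum (~: D)) (msum _) #|_ :&: _| #|L :\: _| #|Q|.
move: #|D :|: S| #|D| #|L| #|~: D| #|G|.
move=> n1 d s n2 n e es el e1 e2 ms a b q E eL eS cDL cDS cDc d0 h LQ s6 eB h2 M Ls ex ek.
have hs : s = 0 \/ s = 1 \/ s = 2 \/ s = 3 by lia.
have hn : n1 = 6 \/ n1 = 7 \/ 8 <= n1 by lia.
by case: hn => [?|[?|hn]]; case: hs => [?|[?|[?|?]]]; subst; simpl in *; lia.
Qed.


(** Otherwise the seven vertices of [cut_low] miss at most one pair, and a connected set outside
    them that sees [c] and [L] completes the minor, since only the three vertices of [D] can miss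
    it. Another component [E] serves: joined to [y] and the rest of [N] if it sees a vertex there,
    and alone if not, because it then sees exactly [L]. *)
Lemma cut_high c z : c \in W -> z \in W :\ c -> W :\ c != component (W :\ c) z ->
  4 <= sees (component (W :\ c) z).
Proof.
move=> cW zA ne; rewrite leqNgt; apply/negP => s3; apply: nK.
have [L3 B7 mB] := cut_low cW zA ne s3; move: L3 B7 mB.
set D := component _ _ in ne s3 *; set L := [set v in N | _]; set B := c |: _ => L3 B7 mB.
have LN : L \subset N by apply/subsetP => v; rewrite in_set => /andP[].
have cNy : c \notin cn y by move: cW; rewrite in_setC.
have DA : D \subset W :\ c := component_sub zA.
have [t tA tD] : exists2 t, t \in W :\ c & t \notin D.
  by move: ne; rewrite eqEsubset DA andbT => /subsetPn[t tA tD]; exists t.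
set E := component (W :\ c) t.
have EA : E \subset W :\ c := component_sub tA.
have DE : [disjoint D & E].
  apply/pred0P => v /=; apply/negP => /andP[vD vE].
  by move: tD; rewrite /D -(component_eq zA vD) (component_eq tA vE) component_self.
have neE : W :\ c != E.
  apply: contraTneq zA => ->; rewrite (disjointFr DE) //; exact: component_self.
have [tc tW] : t != c /\ t \in W by apply/andP; rewrite -in_setD1.
have cE : adjs [set c] E := component_off_cut cW tW tc.
have cNE : c \notin E by apply/negP => /(subsetP EA); rewrite in_setD1 eqxx.
have EW : E \subset W := subset_trans EA (subsetDl _ _).
have DW : D \subset W := subset_trans DA (subsetDl _ _).
have off v (X : {set G}) : X \subset W -> v \in cn y -> v \notin X.
  by move=> XW; apply: contraL => /(subsetP XW); rewrite in_setC.
have Ncn v : v \in N -> v \in cn y by rewrite in_setU1 => ->; rewrite orbT.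
have card_D : #|D| <= 3.
  have cL : c \notin D :|: L.
    rewrite in_setU negb_or; apply/andP; split; last by apply: contra cNy => /(subsetP LN)/Ncn.
    by apply/negP => /(subsetP DA); rewrite in_setD1 eqxx.
  have dDL : [disjoint D & L].
    rewrite disjoint_sym -setI_eq0 -subset0; apply/subsetP => v; rewrite in_setI => /andP[].
    by move=> /(subsetP LN)/Ncn vy; rewrite (negPf (off _ _ DW vy)).
  by move: B7; rewrite cardsU1 cL card_disjU // L3 => /eqP; rewrite add1n eqSS -[6]/(3 + 3) eqn_add2r => /eqP->.
have fin Z : conn Z -> [disjoint B & Z] -> adjs [set c] Z -> {in L, forall v, adjs [set v] Z} -> hasK G.
  move=> cZ dZ aZ LZ; apply: (@hasK_add_set G B Z) => //.
  rewrite -[8]/(2 + 2 * 3); apply: leq_add => //; rewrite leq_mul2l /=.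
  apply: leq_trans card_D; apply: subset_leq_card; apply/subsetP => v; rewrite in_set => /andP[].
  by move=> /setU1P[->|]; rewrite ?aZ // in_setU => /orP[//|/LZ->].
have [/existsP[v /and3P[vN vL vE]]|/existsPn no] := boolP [exists v, [&& v \in N, v \notin L & adjs [set v] E]].
  apply: (fin ((y |: (N :\: L)) :|: E)).
  - have YN : y |: (N :\: L) \subset cn y by apply: setUS; exact: subsetDl.
    apply: connU; last 1 first.
    + by apply/orP; right; apply: adjs_sub vE => //; rewrite sub1set in_setU1 in_setD vN vL orbT.
    + apply: conn_clique; first by apply/set0Pn; exists y; rewrite setU11.
      by move=> u w /(subsetP YN) uy /(subsetP YN); exact: cn_clique.
    + exact: component_conn.
  - rewrite -setI_eq0 -subset0; apply/subsetP => u; rewrite in_setI in_setU => /andP[uB].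
    have : u \in c |: (D :|: L) by []. 
    move=> /setU1P[->|/setUP[uD|uL]] /orP[].
    + by move=> /setU1P[e|/setDP[/Ncn]]; [rewrite e setU11 in cNy|rewrite (negPf cNy)].
    + by rewrite (negPf cNE).
    + have uW := subsetP DW _ uD.
      move=> /setU1P[e|/setDP[/Ncn uy]]; last by rewrite in_setC uy in uW.
      by rewrite e in_setC setU11 in uW.
    + by rewrite (disjointFr DE uD).
    + move=> /setU1P[e|/setDP[_]]; last by rewrite uL.
      by have := subsetP LN _ uL; rewrite e nbr_irr.
    + by rewrite (negPf (off _ _ EW (Ncn _ (subsetP LN _ uL)))).
  - by apply: adjs_sub cE => //; exact: subsetUr.
  - move=> u uL; rewrite adjs1; apply/existsP; exists y; rewrite in_setU setU11 /= adj_sym.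
    by have := subsetP LN _ uL; rewrite inE.
have EL : [set v in N | adjs [set v] E] \subset L.
  by apply/subsetP => v; rewrite in_set => /andP[vN vE]; have := no v; rewrite vN vE andbT negbK.
have sE : sees E <= 3 by rewrite -L3; exact: subset_leq_card.
have [L3' _ _] := cut_low cW tA neE sE.
apply: (fin E) => //.
- exact: component_conn.
- rewrite -setI_eq0 -subset0; apply/subsetP => u; rewrite in_setI => /andP[uB].
  have : u \in c |: (D :|: L) by []. 
  move=> /setU1P[->|/setUP[uD|uL]]; first by rewrite (negPf cNE).
    by rewrite (disjointFr DE uD).
  by rewrite (negPf (off _ _ EW (Ncn _ (subsetP LN _ uL)))).
- have -> : L = [set v in N | adjs [set v] E].
    by apply/eqP; rewrite eq_sym eqEcard EL L3 L3'.
  by move=> v; rewrite in_set => /andP[].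
Qed.

(** Two components would see four vertices of [N] each, and adding [c] to one of them makes the two
    sets adjacent. *)
Lemma no_cut c : c \in W -> conn (W :\ c).
Proof.
move=> cW; have [z zA] : exists z, z \in W :\ c.
  apply/set0Pn; rewrite -card_gt0; have := cardsD1 c W; rewrite cW; have := W_size.
  by move=> + e; rewrite e; case: #|W :\ c|.
set D := component (W :\ c) z; have DA : D \subset W :\ c := component_sub zA.
have [->|ne] := eqVneq (W :\ c) D; first exact: component_conn.
have [t tA tD] : exists2 t, t \in W :\ c & t \notin D.
  by move: ne; rewrite eqEsubset DA andbT => /subsetPn[t tA tD]; exists t.
exfalso; set E := component (W :\ c) t.
have EA : E \subset W :\ c := component_sub tA.
have DE : [disjoint D & E].
  apply/pred0P => v /=; apply/negP => /andP[vD vE].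
  by move: tD; rewrite /D -(component_eq zA vD) (component_eq tA vE) component_self.
have neE : W :\ c != E.
  apply: contraTneq zA => ->; rewrite (disjointFr DE) //; exact: component_self.
have [tc tW] : t != c /\ t \in W by apply/andP; rewrite -in_setD1.
have [zc zW] : z != c /\ z \in W by apply/andP; rewrite -in_setD1.
have cD : adjs [set c] D := component_off_cut cW zW zc.
have cE : adjs [set c] E := component_off_cut cW tW tc.
have cND : c \notin D by apply/negP => /(subsetP DA); rewrite in_setD1 eqxx.
apply: (@two_sets D (c |: E) 0).
- exact: component_conn.
- by apply: connU1; [exact: component_conn|rewrite -adjs1].
- by rewrite disjoint_sym -setI_eq0 setIUl setU_eq0 !setI_eq0 disjoints1 cND disjoint_sym.
- exact: subset_trans DA (subsetDl _ _).
- by rewrite subUset sub1set cW; exact: subset_trans EA (subsetDl _ _).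
- suff -> : adjs D (c |: E) by [].
  by rewrite adjs_sym; apply: adjs_sub cD => //; exact: subsetUl.
- rewrite -[8 + 0]/(4 + 4); apply: leq_add; first exact: cut_high.
  by apply: leq_trans (cut_high cW tA neE) _; apply: sees_sub; exact: subsetUr.
Qed.

(* Move to [X] a vertex [z] next to [X] for which the component of the rest avoiding [z] is largest. *)
Lemma grow_step (X Y : {set G}) : conn X -> conn Y -> [disjoint X & Y] -> X :|: Y = W -> 2 <= #|Y| ->
  exists2 z, z \in Y & adjs [set z] X /\ conn (Y :\ z).
Proof.
move=> cX cY d e Y2.
have X0 : X != set0 by case: cX.
have aXY : exists2 z, z \in Y & adjs [set z] X.
  case: W_conn => _ /(_ X); rewrite -e setUK setDUl setDv set0U.
  have -> : Y :\: X = Y by apply/setDidPl; rewrite disjoint_sym.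
  case: cY => Y0 _ /(_ X0 Y0) [u [v [uX vY uv]]]; exists v => //.
  by rewrite adjs1; apply/existsP; exists u; rewrite uX adj_sym.
case: aXY => z0 z0Y z0X; pose P (p : G * G) := [&& p.1 \in Y, p.2 \in Y :\ p.1 & adjs [set p.1] X].
have [u0 u0Y] : exists u, u \in Y :\ z0.
  apply/set0Pn; rewrite -card_gt0; move: Y2; rewrite (cardsD1 z0) z0Y.
  by case: #|_|.
have P0 : P (z0, u0) by rewrite /P /= z0Y u0Y.
case: (@arg_maxnP _ (z0, u0) P (fun p => #|component (Y :\ p.1) p.2|) P0) => -[z u] /and3P[/= zY uY zX] max.
exists z => //; split=> //; set C := component (Y :\ z) u in max.
have CY : C \subset Y :\ z := component_sub uY.
have [->|ne] := eqVneq (Y :\ z) C; first exact: component_conn.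
have [t tY tC] : exists2 t, t \in Y :\ z & t \notin C.
  by move: ne; rewrite eqEsubset CY andbT => /subsetPn[t tY tC]; exists t.
exfalso; set D := component (Y :\ z) t.
have DY : D \subset Y :\ z := component_sub tY.
have CD : [disjoint C & D].
  apply/pred0P => v /=; apply/negP => /andP[vC vD].
  by move: tC; rewrite /C -(component_eq uY vC) (component_eq tY vD) component_self.
have YW : Y \subset W by rewrite -e subsetUr.
have XY v : v \in X -> v \in Y = false by apply: disjointFr.
have DX : exists2 z', z' \in D & adjs [set z'] X.
  have [_ /(_ D)] := no_cut (subsetP YW _ zY).
  case.
  - apply/set0Pn; exists t; rewrite in_setI component_self andbT.
    by move: tY; rewrite !in_setD1 => /andP[-> /(subsetP YW)].
  - case/set0Pn: X0 => v vX; apply/set0Pn; exists v; rewrite in_setD in_setD1 -e in_setU vX.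
    rewrite /= andbT; apply/andP; split; first by apply/negP => /(subsetP DY); rewrite in_setD1 XY ?andbF.
    by apply: contraTneq zY => <-; rewrite XY.
  move=> v [w [/setIP[_ vD] /setDP[wW wD] vw]].
  exists v => //; rewrite adjs1; apply/existsP; exists w; rewrite vw andbT.
  have := component_nbr tY vD vw wD; move: wW; rewrite !in_setD1 -e in_setU => /andP[->].
  by case/orP=> // ->.
case: DX => z' z'D z'X.
have [z'z z'Y] : z' != z /\ z' \in Y by apply/andP; rewrite -in_setD1; apply: (subsetP DY).
have zA : z \in Y :\ z' by rewrite in_setD1 eq_sym z'z.
have cC : conn (z |: C).
  apply: connU1; first exact: component_conn.
  case: cY => _ /(_ C); case.
  - apply/set0Pn; exists u; rewrite in_setI component_self andbT.
    by move: uY; rewrite in_setD1 => /andP[].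
  - by apply/set0Pn; exists z'; rewrite in_setD z'Y (disjointFl CD).
  move=> v [w []]; rewrite in_setI in_setD => /andP[_ vC] /andP[wC wY] vw.
  have := component_nbr uY vC vw wC; rewrite in_setD1 wY andbT negbK => /eqP ez.
  by apply/existsP; exists v; rewrite vC -ez adj_sym.
have sub : z |: C \subset component (Y :\ z') z.
  apply: component_max => //; last exact: setU11.
  rewrite subUset sub1set zA /=; apply/subsetP => v vC; rewrite in_setD1.
  have := subsetP CY _ vC; rewrite in_setD1 => /andP[_ ->]; rewrite andbT.
  by apply: contraTneq vC => ->; rewrite (disjointFl CD).
have zC : z \notin C by apply/negP => /(subsetP CY); rewrite in_setD1 eqxx.
have Pz' : P (z', z) by rewrite /P /= z'Y zA z'X.
have := leq_trans (subset_leq_card sub) (max _ Pz').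
by rewrite cardsU1 zC /= add1n ltnn.
Qed.

Lemma single_small z : z \in W -> sees [set z] <= 2.
Proof. by move=> zW; apply: noncut_small => //; exact: no_cut. Qed.

(* A vertex of [N] unseen by [z |: X] shares with every other vertex of [N] a neighbour outside [cn y],
   which must then lie in [Y :\ z]; hence [Y :\ z] sees all of [N]. *)
Lemma grow k (X Y : {set G}) : #|Y| <= k -> conn X -> conn Y -> [disjoint X & Y] -> X :|: Y = W ->
  sees X <= 2 -> False.
Proof.
elim: k X Y => [|k IH] X Y.
  by rewrite leqn0 cards_eq0 => /eqP-> _ [/eqP].
move=> Yk cX cY d e s2.
have YW : Y \subset W by rewrite -e subsetUr.
have [Y2|Y1] := leqP 2 #|Y|; last first.
  have /cards1P[z ez] : #|Y| == 1.
    by rewrite eqn_leq -ltnS Y1 card_gt0; case: cY.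
  have zW : z \in W by rewrite (subsetP YW) // ez set11.
  have := single_small zW; rewrite -ez => s1.
  have : 5 <= sees X + #|[set v in N | adjs [set v] Y]|.
    apply: sees_of; last by apply/subsetP => v; rewrite in_set => /andP[].
    move=> v vN; rewrite in_set vN /= => nY; have [w wW vw] := W_nbr vN.
    move: wW; rewrite -e in_setU => /orP[wX|wY]; first by rewrite adjs1; apply/existsP; exists w; rewrite wX.
    by case/negP: nY; rewrite adjs1; apply/existsP; exists w; rewrite wY.
  by rewrite -/(sees Y) leqNgt ltnS (leq_trans (leq_add s2 s1)).
have [z zY [zX cYz]] := grow_step cX cY d e Y2.
have zW := subsetP YW _ zY.
have dz : [disjoint z |: X & Y :\ z].
  rewrite -setI_eq0 -subset0; apply/subsetP => v; rewrite in_setI => /andP[/setU1P[->|vX]].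
    by rewrite in_setD1 eqxx.
  by rewrite in_setD1 (disjointFr d vX) andbF.
have ez : (z |: X) :|: (Y :\ z) = W.
  by rewrite setUAC (setD1K zY) setUC.
have cz : conn (z |: X) by apply: connU1 => //; rewrite -adjs1.
have [s2'|s3] := leqP (sees (z |: X)) 2.
  apply: (IH (z |: X) (Y :\ z)) => //.
  by move: Yk; rewrite (cardsD1 z) zY.
apply: (@split_sets (z |: X) (Y :\ z)) => //.
suff -> : sees (Y :\ z) = 5 by rewrite -[8]/(3 + 5) leq_add2r.
have s4 : sees (z |: X) <= 4.
  apply: leq_trans (leq_add (single_small zW) s2).
  apply: leq_trans (leq_card_setU _ _).1; apply: subset_leq_card; apply/subsetP => v.
  rewrite in_set in_setU !in_set adjs1 => /andP[->] /existsP[w /andP[/setU1P[->|wX] vw]].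
    by rewrite adjs11 vw.
  by apply/orP; right; rewrite adjs1; apply/existsP; exists w; rewrite wX.
have [v vN vX] : exists2 v, v \in N & ~~ adjs [set v] (z |: X).
  have : ~~ (N \subset [set v in N | adjs [set v] (z |: X)]).
    by apply/negP => /subset_leq_card; rewrite N5 leqNgt ltnS s4.
  by case/subsetPn => v vN; rewrite in_set vN => nv; exists v.
have out w u : w \in W -> v -- w -> u -- w -> adjs [set u] (Y :\ z).
  rewrite -ez in_setU => /orP[wX|wY] vw uw.
    by case/negP: vX; rewrite adjs1; apply/existsP; exists w; rewrite wX.
  by rewrite adjs1; apply/existsP; exists w; rewrite wY.
apply/eqP; rewrite eqn_leq sees_le5 -N5; apply: subset_leq_card; apply/subsetP => u uN.
rewrite in_set uN /=; have [->|uv] := eqVneq u v.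
  by have [w wW vw] := W_nbr vN; apply: (out w).
have [w [wy uw vw]] := common_outside uN vN uv.
by apply: (out w); rewrite // in_setC.
Qed.

Lemma no_degree_five : False.
Proof.
have xW : x \in W := xC.
apply: (@grow #|W :\ x| [set x] (W :\ x)) => //; try exact: conn1; try exact: no_cut.
- by rewrite disjoints1 in_setD1 eqxx.
- exact: setD1K.
- exact: single_small.
Qed.

End DegreeFive.

(** * The extremal bound *)

Lemma delete_model (G : sgraph) F : model (fun v : @delete_edges G F => [set v] : {set G}).
Proof.
split; first by move=> v; exact: conn1.
  by move=> u v uv; rewrite disjoints1 inE.
by move=> u v /andP[uv _]; rewrite adjs11.
Qed.

Lemma delete_edge_esum (G : sgraph) (u v : G) : u -- v ->
  esum [set: G] = esum [set: delete_edges [set [set u; v]]] + 2.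
Proof.
move=> uv; set G' := delete_edges _; have nuv := adj_neq uv.
have -> : 2 = \sum_(w in [set: G]) (w \in [set u; v]).
  rewrite -[2]/(true.+1) -nuv -cards2 -sum1_card [LHS]big_mkcond [RHS]big_mkcond.
  by apply: eq_bigr => w _; rewrite in_setT; case: ifP.
rewrite /esum -big_split; apply: eq_bigr => w _; rewrite !setIT.
have e (w' : G) : (w' \in (@nbr G' w)) = (w -- w') && ([set w; w'] != [set u; v]).
  by rewrite [LHS]inE /= /delete_rel in_set1.
pose p := if w == u then v else u.
have [wuv|wuv] := boolP (w \in [set u; v]); last first.
  rewrite /= addn0; apply: eq_card => w'; rewrite e [LHS]inE.
  have -> : [set w; w'] != [set u; v]; last by rewrite andbT.
  by apply: contraNneq wuv => <-; rewrite set21.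
have ep : [set w; p] = [set u; v].
  by move: wuv; rewrite !inE /p; case: eqP => [->//|_ /= /eqP->]; rewrite setUC.
have wp : w -- p.
  by move: wuv; rewrite !inE /p; case: eqP => [->//|_ /= /eqP->]; rewrite adj_sym.
rewrite (cardsD1 p) [p \in _]inE wp /= addnC; congr (_ + _); apply: eq_card => w'.
rewrite e in_setD1 [w' \in nbr w]inE andbC; case ww' : (w -- w') => //=.
rewrite -ep; apply/idP/idP; last by apply: contraNneq => ->.
apply: contraNneq => /setP/(_ w'); rewrite !inE eqxx orbT.
by rewrite [w' == w]eq_sym (negPf (adj_neq ww')) /= => <-.
Qed.

(** Induction on vertices, then on edges. On eight vertices the edges themselves form the minor;
    otherwise edges are deleted until the graph is [minimal_dense], and the vertex given by
    [clone_structure] has degree 5, 6, 7 or 8. *)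
Theorem extremal (G : sgraph) : ~ hasK G -> 8 <= #|G| -> esum [set: G] + 24 < 9 * #|G|.
Proof.
have [n] := ubnP #|G|; elim: n G => // n IHn G Gn.
have [k] := ubnP (esum [set: G]); elim: k G Gn => // k IHk G Gn Gk nK G8.
rewrite ltnNge; apply/negP => dense; move: G8; rewrite leq_eqVlt => /orP[/eqP G8|G9].
  by apply: nK; apply: hasK_eight => //; move: dense; rewrite -G8; clear; lia.
have [over|low] := leqP (9 * #|G| + 2) (esum [set: G] + 24).
  have [u [v uv]] : exists u v : G, u -- v.
    have : 0 < esum [set: G] by move: over G9; clear; lia.
    rewrite lt0n sum_nat_eq0 negb_forall => /existsP[u]; rewrite setIT in_setT /= cards_eq0.
    by case/set0Pn => v; rewrite inE => uv; exists u, v.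
  have e := delete_edge_esum uv; set G' := delete_edges _ in e.
  have nK' : ~ hasK G' by move=> hK; apply: nK; exact: hasK_model (delete_model _) hK.
  have := IHk G' Gn _ nK' (ltnW G9).
  rewrite e in over Gk; have -> : #|G'| = #|G| by [].
  have lt : esum [set: G'] < k by move: Gk; clear; lia.
  by move/(_ lt); move: over; clear; lia.
have mG : minimal_dense G.
  split=> //; first by move: low; clear; lia.
  move=> H m mm H8 HG; apply: IHn => //; first exact: leq_trans HG _.
  by move=> hK; apply: nK; exact: hasK_model mm hK.
have [y [x [y8 xy univ]]] := clone_structure mG.
have y5 := min_degree mG y.
have [|adjK] := posnP #|[set v in nbr y | ~~ adjs [set v] (component (~: cn y) x)]|; last first.
  have : #|nbr y| = 5 \/ #|nbr y| = 6 \/ #|nbr y| = 7 \/ #|nbr y| = 8.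
    by move: y5 y8; clear; lia.
  case=> [y5'|[y6|[y7|y8']]].
  - exact: (no_degree_five_clones mG nK xy univ y5' adjK).
  - exact: (no_degree_six mG nK xy univ y6).
  - exact: (no_degree_seven mG nK xy univ y7).
  - exact: (no_degree_eight mG nK xy univ y8').
move/eqP; rewrite cards_eq0 => /eqP/setP U0.
have : #|nbr y| = 5 \/ #|nbr y| = 6 \/ #|nbr y| = 7 \/ #|nbr y| = 8.
  by move: y5 y8; clear; lia.
case=> [y5'|[y6|[y7|y8']]].
- apply: (no_degree_five mG nK xy y5') => v yv; have := U0 v.
  by rewrite in_set in_set0 [v \in nbr y]inE yv => /negbT; rewrite negbK.
- exact: (no_degree_six mG nK xy univ y6).
- exact: (no_degree_seven mG nK xy univ y7).
- exact: (no_degree_eight mG nK xy univ y8').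
Qed.

(** * Colour-critical graphs *)

(** The permutation is built one vertex at a time by composing with transpositions. It makes
    colourings of two sides agree on their separator. *)
Lemma perm_match (T I : finType) (S : {set I}) (c1 c2 : I -> T) :
  {in S &, forall u v, (c1 u == c1 v) = (c2 u == c2 v)} ->
  exists s : {perm T}, {in S, forall u, s (c2 u) = c1 u}.
Proof.
move=> h; suff : forall r : seq I, {subset r <= S} -> exists s : {perm T}, {in r, forall u, s (c2 u) = c1 u}.
  by case/(_ (enum S)) => [u|s hs]; [rewrite mem_enum|exists s => u uS; apply: hs; rewrite mem_enum].
elim=> [|u r IH] sub; first by exists 1%g.
case: IH => [v vr|s hs]; first by apply: sub; rewrite inE vr orbT.
have uS : u \in S by apply: sub; rewrite mem_head.
exists (s * tperm (s (c2 u)) (c1 u))%g => v; rewrite inE permM => vur.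
have [e|ne] := eqVneq (c2 v) (c2 u).
  have vS : v \in S by case/orP: vur => [/eqP->//|vr]; apply: sub; rewrite inE vr orbT.
  by rewrite e tpermL; apply/esym/eqP; rewrite h // e.
case/orP: vur => [/eqP e|vr]; first by rewrite e eqxx in ne.
have vS : v \in S by apply: sub; rewrite inE vr orbT.
rewrite (hs v vr) tpermD //; first by rewrite -(hs _ vr) (inj_eq perm_inj) eq_sym.
by rewrite h // eq_sym.
Qed.

Definition critical (G : sgraph) := [/\ ~ hasK G, ~ colorable 7 G &
  forall (H : sgraph) (m : H -> {set G}), model m -> #|H| < #|G| -> colorable 7 H].

Definition proper_on (G : sgraph) (A : {set G}) (c : G -> 'I_7) :=
  {in A &, forall u v, u -- v -> c u != c v}.

Definition clique (G : sgraph) (A : {set G}) := {in A &, forall u v : G, u != v -> u -- v}.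

Lemma clique_sub (G : sgraph) (A B : {set G}) : A \subset B -> clique B -> clique A.
Proof. by move=> /subsetP AB cB u v /AB uB /AB; exact: cB. Qed.

Lemma msum_clique (G : sgraph) (A : {set G}) : clique A -> msum A = 0.
Proof.
move=> cl; apply: big1 => u uA; apply/eqP; rewrite cards_eq0 -subset0; apply/subsetP => v.
rewrite in_setI -/(@non G u) (@nonE G) => /andP[/andP[uv nuv] vA].
by case/negP: nuv; exact: (cl u v).
Qed.

Section Critical.
Variable G : sgraph.
Hypothesis cG : critical G.
Implicit Types (A B C Q S V : {set G}) (u v w x y z a b : G).

Lemma not_proper (c : G -> 'I_7) : ~ proper_on setT c.
Proof.
case: cG => _ nC _ pc; apply: nC; exists c => u v; exact: pc.
Qed.

(** The form in which minimality is used: the sets [B v] are contracted, so an edge between two of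
    them forces different colours even where the chosen vertices are not adjacent. Vertices outside
    [A] receive the dummy colour [ord0]. *)
Lemma colour_sets A (B : G -> {set G}) : {in A, forall v, conn (B v)} ->
  {in A &, forall u v, u != v -> [disjoint B u & B v]} -> #|A| < #|G| ->
  exists c : G -> 'I_7, {in A &, forall u v, u != v -> adjs (B u) (B v) -> c u != c v}.
Proof.
move=> cB dB AG; pose R u v := (u != v) && adjs (B u) (B v).
have r : rooted A B R by split=> // u v uA vA /andP[].
case: cG => _ _ IH; case: (IH _ _ (rooted_model r)) => [|c hc]; first by rewrite rooted_card.
exists (fun v => if insub v is Some v' then c v' else ord0) => u v uA vA uv aB.
rewrite (insubT (fun v => v \in A) uA) (insubT (fun v => v \in A) vA); apply: hc.
by rewrite /adj /= /rooted_rel /R !SubK -(inj_eq val_inj) !SubK uv aB.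
Qed.

Lemma colour_sub A : #|A| < #|G| -> exists c, proper_on A c.
Proof.
move=> AG; case: (@colour_sets A (fun v => [set v])) => // [v _|u v _ _ uv|c hc].
- exact: conn1.
- by rewrite disjoints1 inE.
- by exists c => u v uA vA uv; apply: hc; rewrite ?adjs11 // adj_neq.
Qed.

(* Contract the connected set [I :|: C], with [I] independent, to a vertex [i] of [I]. *)
Lemma pinch_colour V C (I : {set G}) i : i \in I -> I \subset V -> [disjoint V & C] -> conn (I :|: C) ->
  (C != set0) || (1 < #|I|) -> {in I &, forall u v, ~~ (u -- v)} ->
  exists c, proper_on V c /\ {in I &, forall u v, c u = c v}.
Proof.
move=> iI IV dVC cIC ne indep; pose A := i |: (V :\: I).
pose B v := if v \in I then I :|: C else [set v].
have AV : A \subset V by rewrite subUset sub1set (subsetP IV) //= subsetDl.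
have AI v : v \in A -> v \in I -> v = i by rewrite !inE => /orP[/eqP//|/andP[/negPf->]].
case: (@colour_sets A B).
- by move=> v _; rewrite /B; case: ifP => // _; exact: conn1.
- have d u v : u \in I -> v \in A -> v \notin I -> [disjoint B u & B v].
    move=> uI vA vI; rewrite /B uI (negPf vI) disjoint_sym disjoints1 in_setU negb_or vI.
    by rewrite (disjointFr dVC) // (subsetP AV).
  move=> u v uA vA uv; have [uI|uI] := boolP (u \in I); have [vI|vI] := boolP (v \in I).
  + by rewrite (AI _ uA uI) (AI _ vA vI) eqxx in uv.
  + exact: d.
  + by rewrite disjoint_sym; exact: d.
  + by rewrite /B (negPf uI) (negPf vI) disjoints1 inE.
- have AVC : #|A| + (#|I| - 1) + #|C| <= #|G|.
    have -> : #|A| + (#|I| - 1) = #|V|.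
      have := cardsD1 i I; rewrite iI cardsU1 !inE iI /= (cardsD V I) (setIidPr IV).
      by have := subset_leq_card IV; lia.
    by rewrite -card_disjU // max_card.
  by case/orP: ne => h; [rewrite -card_gt0 in h|]; lia.
move=> c hc; exists (fun v => if v \in I then c i else c v); split; last first.
  by move=> u v -> ->.
have key u v : u \in V -> v \in V -> u \in I -> v \notin I -> u -- v -> c i != c v.
  move=> uV vV uI vI uv; apply: hc; rewrite ?setU11 ?in_setU1 ?in_setD ?vI ?vV ?orbT //.
    by apply: contraNneq vI => <-.
  apply/adjsP; exists u, v; rewrite /B iI (negPf vI) set11 in_setU uI; by split.
move=> u v uV vV uv; case: ifPn => uI; case: ifPn => vI.
- by have := indep u v uI vI; rewrite uv.
- exact: (key u).
- by rewrite eq_sym; apply: (key v); rewrite 1?adj_sym.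
- by apply: hc; rewrite ?in_setU1 ?in_setD ?uI ?uV ?vI ?vV ?orbT ?adj_neq // /B (negPf uI) (negPf vI) adjs11.
Qed.

Lemma extend_colour x c : proper_on [set~ x] c -> 7 <= #|c @: nbr x|.
Proof.
move=> pc; rewrite leqNgt; apply/negP => lt.
have [k kN] : exists k, k \notin c @: nbr x.
  apply/existsP; apply: contraLR lt => /existsPn all; rewrite -leqNgt.
  apply: (@leq_trans #|[set: 'I_7]|); first by rewrite cardsT card_ord.
  by apply: subset_leq_card; apply/subsetP => k _; have := all k; rewrite negbK.
apply: (@not_proper (fun v => if v == x then k else c v)) => u v _ _ uv.
have kn w : x -- w -> k != c w.
  by move=> xw; apply: contraNneq kN => ->; apply: imset_f; rewrite inE.
have [e|ux] := eqVneq u x; have [e'|vx] := eqVneq v x.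
- by rewrite e e' adj_irrefl in uv.
- by apply: kn; rewrite -e.
- by rewrite eq_sym; apply: kn; rewrite -e' adj_sym.
- by apply: pc; rewrite ?inE.
Qed.

Lemma contract_colour x (I : {set G}) : I \subset nbr x -> I != set0 -> {in I &, forall u v, ~~ (u -- v)} ->
  exists c, proper_on [set~ x] c /\ {in I &, forall u v, c u = c v}.
Proof.
move=> IN /set0Pn[i iI] indep; apply: (@pinch_colour _ [set x] I i) => //.
- apply/subsetP => v /(subsetP IN); rewrite !inE => xv; by rewrite eq_sym adj_neq.
- by rewrite disjoint_sym disjoints1 !inE eqxx.
- rewrite setUC; have [n] := ubnP #|I|; elim: n I IN iI {indep} => // n IHn I IN iI In.
  have [e|[j jI]] := set_0Vmem (I :\ i).
    have -> : x |: I = i |: [set x] by rewrite -(setD1K iI) e setU0 setUC.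
    by apply: conn2; rewrite adj_sym; have := subsetP IN _ iI; rewrite inE.
  move: jI; rewrite in_setD1 => /andP[ji jI].
  have -> : x |: I = j |: (x |: (I :\ j)) by rewrite setUCA (setD1K jI).
  apply: connU1; last by apply/existsP; exists x; rewrite setU11 adj_sym; have := subsetP IN _ jI; rewrite inE.
  apply: IHn.
  + exact: subset_trans (subsetDl _ _) IN.
  + by rewrite in_setD1 eq_sym ji.
  + by move: In; rewrite (cardsD1 j I) jI add1n ltnS.
- by apply/orP; left; apply/set0Pn; exists x; rewrite set11.
Qed.

(** Contracting [I] with [x] gives all of [I] one colour. The neighbours of [x] still show all seven
    colours, so those outside [I] supply at least six. *)
Lemma independent_degree x (I : {set G}) : I \subset nbr x -> I != set0 ->
  {in I &, forall u v, ~~ (u -- v)} -> 6 + #|I| <= #|nbr x|.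
Proof.
move=> IN I0 indep; have [c [pc cI]] := contract_colour IN I0 indep.
have := extend_colour pc; case/set0Pn: I0 => i iI.
have sub : c @: nbr x \subset c i |: c @: (nbr x :\: I).
  apply/subsetP => _ /imsetP[v vN ->]; rewrite in_setU1; have [vI|vI] := boolP (v \in I).
    by rewrite (cI _ _ vI iI) eqxx.
  by rewrite imset_f ?orbT // in_setD vI.
have := subset_leq_card sub; rewrite cardsU1.
have := leq_imset_card c (nbr x :\: I); rewrite cardsD (setIidPr IN).
have := leq_b1 (c i \notin c @: (nbr x :\: I)); have := subset_leq_card IN.
move: #|I| #|nbr x| #|_ @: nbr x| #|_ @: _| (nat_of_bool _); clear; lia.
Qed.

Lemma card_ge8 : 8 <= #|G|.
Proof.
rewrite leqNgt ltnS; apply/negP => lt; case: cG => _ nC _; apply: nC.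
exists (fun v => widen_ord lt (enum_rank v)) => u v /adj_neq; apply: contraNneq.
by move/(congr1 val) => e; apply/eqP/enum_rank_inj/val_inj.
Qed.

(** In degree 7, two non-adjacent neighbours would contradict [independent_degree]; without them the
    closed neighbourhood is a [K_8]. *)
Lemma degree_ge8 x : 8 <= #|nbr x|.
Proof.
have [n0|[v vN]] := set_0Vmem (nbr x).
  have [|c pc] := @colour_sub [set~ x]; first by rewrite cardsC1; have := card_ge8; case: #|G|.
  by have := extend_colour pc; rewrite n0 imset0 cards0.
have d7 : 7 <= #|nbr x|.
  have := @independent_degree x [set v]; rewrite cards1; apply.
  - by rewrite sub1set.
  - by apply/set0Pn; exists v; rewrite set11.
  - by move=> u w /set1P-> /set1P->; rewrite adj_irrefl.
rewrite leq_eqVlt in d7; case/orP: d7 => // /eqP e7; exfalso.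
have [/existsP[[a b] /and4P[/= aN bN ab nab]]|/existsPn all] := boolP [exists p : G * G,
  [&& p.1 \in nbr x, p.2 \in nbr x, p.1 != p.2 & ~~ (p.1 -- p.2)]].
  have := @independent_degree x [set a; b]; rewrite cards2 ab -e7 => h.
  suff : 6 + 2 <= 7 by [].
  apply: h.
  - by rewrite subUset !sub1set aN.
  - by apply/set0Pn; exists a; rewrite set21.
  - by move=> u w /set2P[->|->] /set2P[->|->]; rewrite ?adj_irrefl // adj_sym.
case: cG => nK _ _; apply: nK; apply: (@hasK_direct _ (cn x)); first by rewrite card_cn -e7.
rewrite msum_clique // => u w; rewrite !cnE => /orP[/eqP->|xu] /orP[/eqP->|xw] uw //.
- by rewrite eqxx in uw.
- by rewrite adj_sym.
- by have := all (u, w); rewrite /= !inE xu xw uw negbK.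
Qed.

(** By minimum degree 8 the degree sum is at least 9n minus the number of vertices of degree 8,
    while [extremal] keeps it below 9n - 24. *)
Lemma card_low : 24 < #|[set x : G | #|nbr x| == 8]|.
Proof.
case: cG => nK _ _; have := extremal nK card_ge8.
set L := [set x : G | _]; have -> : esum [set: G] = \sum_(x : G) #|nbr x|.
  by rewrite /esum big_mkcond; apply: eq_bigr => x _; rewrite in_setT setIT.
have : 9 * #|G| <= \sum_(x : G) #|nbr x| + #|L|.
  have -> : #|L| = \sum_(x : G) (x \in L : nat) by rewrite -sum1_card big_mkcond.
  rewrite -big_split -[9 * _]mulnC -cardsT -sum_nat_const big_mkcond /=; apply: leq_sum => x _.
  rewrite in_setT inE; have := degree_ge8 x; rewrite leq_eqVlt => /orP[/eqP<-//|h].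
  by apply: leq_trans h (leq_addr _ _).
by clear; lia.
Qed.

Lemma alpha2 x a b d : #|nbr x| = 8 -> x -- a -> x -- b -> x -- d -> a != b -> a != d -> b != d ->
  ~~ (a -- b) -> ~~ (a -- d) -> ~~ (b -- d) -> False.
Proof.
move=> x8 xa xb xd ab ad bd nab nad nbd.
have := @independent_degree x (a |: [set b; d]); rewrite cardsU1 cards2 !inE negb_or ab ad bd x8 => h.
suff : 6 + 3 <= 8 by [].
apply: h.
- by rewrite !subUset !sub1set !inE xa xb.
- by apply/set0Pn; exists a; rewrite setU11.
- move=> u v; rewrite !inE => /or3P[]/eqP-> /or3P[]/eqP->; by rewrite ?adj_irrefl // adj_sym.
Qed.

End Critical.

(** * Kempe chains, and separators that are cliques up to one vertex *)

Section Kempe.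
Variable G : sgraph.
Hypothesis cG : critical G.
Implicit Types (A B C Q S V : {set G}) (u v w x y z a b : G).

Lemma kempe_swap A c (D : {set G}) u i : proper_on A c -> u \in A -> c u != i ->
  D = component [set v in A | (c v == c u) || (c v == i)] u ->
  proper_on A (fun v => if v \in D then (if c v == i then c u else i) else c v).
Proof.
move=> pc uA ui eD; set E := [set v in A | _] in eD.
have uE : u \in E by rewrite in_set uA eqxx.
have DE : D \subset E by rewrite eD; exact: component_sub.
have DC v : v \in D -> (c v == c u) || (c v == i) by move/(subsetP DE); rewrite in_set => /andP[].
have out v w : w \in A -> v \in D -> w \notin D -> v -- w -> c w != c u /\ c w != i.
  move=> wA vD wD vw; apply/andP; rewrite -negb_or; apply: contra wD => h.
  rewrite eD in vD *; apply: (component_closed uE vD _ vw).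
  by rewrite in_set wA h.
move=> v w vA wA vw; have ne := pc v w vA wA vw.
rewrite /=; have [vD|vD] := boolP (v \in D); have [wD|wD] := boolP (w \in D) => //.
- have [ev|nv] := eqVneq (c v) i; have [ew|nw] := eqVneq (c w) i => //.
  + by rewrite ev ew eqxx in ne.
  + by rewrite eq_sym.
  + have := DC v vD; rewrite (negPf nv) orbF => /eqP ev.
    by have := DC w wD; rewrite (negPf nw) orbF => /eqP ew; rewrite ev ew eqxx in ne.
- by have [h1 h2] := out v w wA vD wD vw; case: ifP => _; rewrite eq_sym.
- rewrite adj_sym in vw.
  by have [h1 h2] := out w v vA wD vD vw; case: ifP => _.
Qed.

(* Colour [G - x] with [a], [b] alike; the six other neighbours of [x] get distinct colours, and the Kempe
   chain from [u] to [w] avoids them. *)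
Lemma kempe_star x a b u w : #|nbr x| = 8 -> a \in nbr x -> b \in nbr x -> a != b -> ~~ (a -- b) ->
  u \in nbr x :\ a :\ b -> w \in nbr x :\ a :\ b -> u != w ->
  adjs [set w] (component (u |: ~: cn x) u).
Proof.
move=> x8 aN bN ab nab; rewrite !in_setD1 => /and3P[ub ua uN] /and3P[wb wa wN] uw.
set Z := component _ u.
have IN : [set a; b] \subset nbr x by rewrite subUset !sub1set aN.
have [||c [pc cI]] := contract_colour cG IN.
- by apply/set0Pn; exists a; rewrite set21.
- by move=> v v' /set2P[->|->] /set2P[->|->]; rewrite ?adj_irrefl // adj_sym.
have cab : c a = c b by apply: cI; rewrite ?set21 ?set22.
have Nx v : v \in nbr x -> v \in [set~ x].
  by rewrite !inE => xv; rewrite eq_sym adj_neq.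
(* As [b] repeats the colour of [a], the seven other neighbours of [x] carry all seven colours. *)
have inj (d : G -> 'I_7) : proper_on [set~ x] d -> d a = d b -> {in nbr x :\ b &, injective d}.
  move=> pd dab; apply/imset_injP; rewrite eqn_leq leq_imset_card.
  have -> : #|nbr x :\ b| = 7 by have := cardsD1 b (nbr x); rewrite bN x8 add1n => -[<-].
  apply: leq_trans (extend_colour cG pd) _; apply: subset_leq_card.
  apply/subsetP => _ /imsetP[v vN ->]; have [->|vb] := eqVneq v b.
    by rewrite -dab imset_f // in_setD1 ab.
  by rewrite imset_f // in_setD1 vb.
have mem v : v != b -> v \in nbr x -> v \in nbr x :\ b by move=> h1 h2; rewrite in_setD1 h1.
have ci := inj c pc cab.
have cuw : c u != c w by rewrite (inj_in_eq ci) ?mem.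
set E := [set v in [set~ x] | (c v == c u) || (c v == c w)].
set D := component E u.
have uE : u \in E by rewrite in_set Nx // eqxx.
have uD : u \in D := component_self _ _.
have DE : D \subset E := component_sub uE.
have Dnbr v : v \in D -> v \in nbr x -> v = u \/ v = w.
  move=> /(subsetP DE); rewrite in_set => /andP[_ h] vN.
  have [e|vb] := eqVneq v b.
    move: h; rewrite e -cab !(inj_in_eq ci) ?mem //.
    by rewrite ![a == _]eq_sym (negPf ua) (negPf wa).
  by move: h; rewrite !(inj_in_eq ci) ?mem // => /orP[/eqP|/eqP]; [left|right].
(* If the chain from [u] misses [w], swapping it changes [u] and no other neighbour of [x], and [u]
   then repeats the colour of [w]. *)
have [wD|wD] := boolP (w \in D); last first.
  exfalso; have pd := kempe_swap pc (Nx _ uN) cuw (erefl D).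
  set d := fun v => _ in pd.
  have dE v : v \in nbr x -> v != u -> d v = c v.
    move=> vN vu; rewrite /d; case: ifP => // vD.
    by case: (Dnbr v vD vN) => e; [rewrite e eqxx in vu|rewrite -e vD in wD].
  have dab : d a = d b by rewrite !dE // eq_sym.
  have := inj d pd dab u w (mem _ ub uN) (mem _ wb wN); rewrite (dE w wN) 1?eq_sym //.
  by rewrite /d uD (negPf cuw) => /(_ (erefl _)) e; rewrite e eqxx in uw.
(* Before [w] the chain meets no neighbour of [x] except [u], so it stays inside [u |: ~: cn x]. *)
have uA : u \in D :\ w by rewrite in_setD1 uw.
set F := component (D :\ w) u.
have FD : F \subset D :\ w := component_sub uA.
have FZ : F \subset Z.
  apply: component_max; rewrite ?setU11 //; [exact: component_conn| |exact: component_self].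
  apply/subsetP => v /(subsetP FD); rewrite in_setD1 => /andP[vw vD].
  rewrite in_setU1 in_setC cnE; have [//|vu] := eqVneq v u.
  rewrite negb_or; apply/andP; split.
    by have := subsetP DE _ vD; rewrite in_set !inE => /andP[].
  apply/negP => xv; case: (Dnbr v vD); rewrite ?inE // => e; first by rewrite e eqxx in vu.
  by rewrite e eqxx in vw.
have [_ /(_ F)] := component_conn E u; rewrite -/D; case.
- by apply/set0Pn; exists u; rewrite in_setI uD component_self.
- apply/set0Pn; exists w; rewrite in_setD wD andbT; apply/negP => /(subsetP FD).
  by rewrite in_setD1 eqxx.
move=> v [t [/setIP[_ vF] /setDP[tD tF] vt]].
have := component_nbr uA vF vt tF; rewrite in_setD1 tD andbT negbK => /eqP e.
by rewrite adjs1; apply/existsP; exists v; rewrite (subsetP FZ) // -e adj_sym.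
Qed.

(** After a permutation of colours the two colourings agree on the overlap and colour the whole
    graph. *)
Lemma glue (V1 V2 : {set G}) c1 c2 : proper_on V1 c1 -> proper_on V2 c2 -> V1 :|: V2 = setT ->
  {in V1 :\: V2 & V2 :\: V1, forall u v, ~~ (u -- v)} ->
  {in V1 :&: V2 &, forall u v, (c1 u == c1 v) = (c2 u == c2 v)} -> False.
Proof.
move=> p1 p2 e sep /perm_match[s hs].
apply: (not_proper cG (c := fun v => if v \in V1 then c1 v else s (c2 v))) => u v _ _ uv.
have V2v t : t \notin V1 -> t \in V2.
  by have := in_setT t; rewrite -e in_setU => /orP[->|].
have key u' v' : u' \in V1 -> v' \notin V1 -> u' -- v' -> c1 u' != s (c2 v').
  move=> uV vV uv'; have [u2|u2] := boolP (u' \in V2).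
    by rewrite -(hs u') ?in_setI ?uV // (inj_eq perm_inj); exact: (p2 u' v' u2 (V2v _ vV) uv').
  by have := sep u' v'; rewrite !in_setD uV u2 vV V2v //= uv' => /(_ isT isT).
case: ifPn => uV; case: ifPn => vV.
- exact: p1.
- exact: key.
- by rewrite eq_sym; apply: key; rewrite // adj_sym.
- by rewrite (inj_eq perm_inj); exact: (p2 u v (V2v _ uV) (V2v _ vV) uv).
Qed.

Lemma proper_clique V Q c : proper_on V c -> Q \subset V -> clique Q -> {in Q &, injective c}.
Proof.
move=> pc /subsetP QV cQ u v uQ vQ /eqP; apply: contraTeq => uv.
by apply: pc; rewrite ?QV //; apply: cQ.
Qed.

(* The two colourings are only compared on the separator [S]. *)
Lemma glue_component S z c1 c2 (C := component (~: S) z) : z \notin S ->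
  proper_on (C :|: S) c1 -> proper_on (~: C) c2 ->
  {in S &, forall u v, (c1 u == c1 v) = (c2 u == c2 v)} -> False.
Proof.
move=> zS p1 p2 h; have zC : z \in ~: S by rewrite in_setC.
have CS : C \subset ~: S := component_sub zC.
apply: (glue p1 p2).
- by apply/setP => v; rewrite in_setT 2!in_setU in_setC; case: (v \in C); rewrite ?orbT.
- move=> u v; rewrite in_setD in_setC negbK => /andP[uC _].
  rewrite in_setD in_setU negb_or => /andP[/andP[vC vS] _].
  apply/negP => uv; have := component_nbr zC uC uv vC.
  by rewrite in_setC vS.
- move=> u v; rewrite !in_setI !in_setU !in_setC => /andP[/orP[->//|uS] _] /andP[/orP[->//|vS] _].
  exact: h.
Qed.

Lemma component_lt S z z' : z \notin S -> z' \notin component (~: S) z -> z' \notin S ->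
  #|component (~: S) z :|: S| < #|G| /\ #|~: component (~: S) z| < #|G|.
Proof.
move=> zS zz' zS'; split; rewrite -cardsT; apply: proper_card; rewrite properT; apply/eqP => /setP.
  by move/(_ z'); rewrite in_setU (negPf zz') (negPf zS') in_setT.
by move/(_ z); rewrite in_setC component_self in_setT.
Qed.

(** Both sides can be coloured, and a clique receives pairwise distinct colours in each, so the
    partitions of [Q] agree. *)
Lemma clique_sep Q z z' : clique Q -> z \notin Q -> z' \notin Q -> z' \in component (~: Q) z.
Proof.
move=> cQ zQ zQ'; apply: contraT => nz; have [l1 l2] := component_lt zQ nz zQ'.
have [c1 p1] := colour_sub cG l1; have [c2 p2] := colour_sub cG l2.
exfalso; apply: (glue_component zQ p1 p2) => u v uQ vQ.
have CS : component (~: Q) z \subset ~: Q by apply: component_sub; rewrite in_setC.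
have QC : Q \subset ~: component (~: Q) z by rewrite -setCS setCK.
rewrite (inj_in_eq (proper_clique p1 (subsetUr _ _) cQ)) //.
by rewrite (inj_in_eq (proper_clique p2 QC cQ)).
Qed.

Lemma sep_shrink S u z z' : z \notin S -> z' \notin S -> ~~ adjs [set u] (component (~: S) z) ->
  z' \notin component (~: S) z -> z' \notin component (~: (S :\ u)) z.
Proof.
move=> zS zS' nu nz; set C := component (~: S) z; set D := component _ z.
have zC : z \in ~: S by rewrite in_setC.
have zD : z \in ~: (S :\ u) by rewrite in_setC in_setD1 (negPf zS) andbF.
apply/negP => z'D; have [_ /(_ C)] := component_conn (~: (S :\ u)) z; rewrite -/D; case.
- by apply/set0Pn; exists z; rewrite in_setI !component_self.
- by apply/set0Pn; exists z'; rewrite in_setD nz.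
move=> s [t [/setIP[_ sC] /setDP[tD tC] st]].
have := component_nbr zC sC st tC; rewrite in_setC negbK => tS.
have := subsetP (component_sub zD) _ tD; rewrite in_setC in_setD1 tS andbT negbK => /eqP e.
by case/negP: nu; rewrite adjs1; apply/existsP; exists s; rewrite -e adj_sym sC.
Qed.

(* A colouring in which [v] has the colour of a non-neighbour [u] in [Q] is the
   same on the separator for both sides; contracting [u], [v] and the other side gives one. *)
Lemma near_clique_sep Q v z z' : clique Q -> z \notin v |: Q -> z' \notin v |: Q ->
  z' \in component (~: (v |: Q)) z.
Proof.
have [n] := ubnP #|Q|; elim: n Q z z' => // n IH Q z z' Qn cQ zS zS'.
apply: contraT => nz; have [vQ|vQ] := boolP (v \in Q).
  have e : v |: Q = Q by apply/setUidPr; rewrite sub1set.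
  by rewrite e in zS zS' nz; rewrite clique_sep in nz.
have [zQ zQ'] : z \notin Q /\ z' \notin Q.
  by move: zS zS'; rewrite !in_setU1 !negb_or => /andP[_ ->] /andP[_ ->].
have [/existsP[u /and3P[uQ vu]]|/existsPn all] := boolP [exists u, [&& u \in Q, u != v & ~~ (v -- u)]]; last first.
  exfalso; move: nz; rewrite clique_sep //.
  have vall u : u \in Q -> v -- u.
    move=> uQ; have := all u; rewrite uQ /= negb_and !negbK => /orP[/eqP e|//].
    by rewrite -e uQ in vQ.
  move=> s t /setU1P[->|sQ] /setU1P[->|tQ]; rewrite ?eqxx // => st; last exact: cQ.
    exact: vall.
  by rewrite adj_sym vall.
move=> nvu; set S := v |: Q in zS zS' nz *; set C := component (~: S) z in nz.
have uS : u \in S by rewrite in_setU1 uQ orbT.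
have zC : z \in ~: S by rewrite in_setC.
have zC' : z' \in ~: S by rewrite in_setC.
set C' := component (~: S) z'.
have nz' : z \notin C'.
  apply: contra nz => zC2; have := component_eq zC' zC2; rewrite /C => ->; exact: component_self.
have dCC : [disjoint C & C'].
  apply/pred0P => t /=; apply/negP => /andP[tC tC'].
  by move: nz; rewrite /C -(component_eq zC tC) (component_eq zC' tC') component_self.
(* If [u] or [v] had no neighbour in a component, the separator would shrink to [v |: (Q :\ u)],
   excluded by induction, or to the clique [Q]. *)
have key t t' : t \notin S -> t' \notin S -> t' \notin component (~: S) t ->
    adjs [set u] (component (~: S) t) /\ adjs [set v] (component (~: S) t).
  move=> tS tS' nt; split; apply: contraT => na; have := sep_shrink tS tS' na nt.
    have -> : S :\ u = v |: (Q :\ u).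
      by apply/setP => s; rewrite !inE; case: (s =P u) => // ->; rewrite (negPf vu).
    have sub s : s \notin S -> s \notin v |: (Q :\ u).
      by apply: contra => /setU1P[->|]; rewrite ?setU11 // in_setD1 => /andP[_]; apply: setU1r.
    have Qn' : #|Q :\ u| < n by move: Qn; rewrite (cardsD1 u) uQ.
    by rewrite (IH _ _ _ Qn' (clique_sub (subsetDl _ _) cQ) (sub _ tS) (sub _ tS')).
  rewrite /S setU1K // clique_sep //.
    by apply: contra tS; apply: setU1r.
  by apply: contra tS'; apply: setU1r.
have [uC vC] := key z z' zS zS' nz.
have [uC' vC'] := key z' z zS' zS nz'.
have pinch V (D : {set G}) : u \in V -> v \in V -> [disjoint V & D] -> conn D -> adjs [set u] D -> adjs [set v] D ->
    exists c, proper_on V c /\ c u = c v.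
  move=> uV vV d cD uD vD; have [||||||c [pc cI]] := @pinch_colour G cG V D [set u; v] u => //.
  - exact: set21.
  - by rewrite subUset !sub1set uV.
  - rewrite -setUA; apply: connU1; last first.
      by move: uD; rewrite adjs1 => /existsP[s /andP[sD us]]; apply/existsP; exists s; rewrite setU1r.
    by apply: connU1 => //; rewrite -adjs1.
  - by rewrite cards2 vu orbT.
  - by move=> s t /set2P[->|->] /set2P[->|->]; rewrite ?adj_irrefl // adj_sym.
  - by exists c; split=> //; apply: cI; rewrite ?set21 ?set22.
have CS : C \subset ~: S := component_sub zC.
have CS' : C' \subset ~: S := component_sub zC'.
have [||||||c1 [p1 e1]] := @pinch (C :|: S) C' => //.
- by rewrite in_setU uS orbT.
- by rewrite in_setU setU11 orbT.
- by rewrite -setI_eq0 setIUl setU_eq0 !setI_eq0 dCC disjoint_sym disjoints_subset.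
- exact: component_conn.
have SC : S \subset ~: C by rewrite -setCS setCK.
have [||||||c2 [p2 e2]] := @pinch (~: C) C => //.
- exact: (subsetP SC).
- by apply: (subsetP SC); rewrite setU11.
- by rewrite -setI_eq0 setIC setICr.
- exact: component_conn.
exfalso; apply: (glue_component zS p1 p2) => s t sS tS.
(* Both colourings identify [v] with [u] and are injective on [Q], so [h] reduces every comparison
   on [S] to [Q]. *)
pose h s' := if s' == v then u else s'.
have hc c s' : c u = c v -> c s' = c (h s') :> 'I_7 by rewrite /h; case: eqP => // ->.
have hQ s' : s' \in S -> h s' \in Q by rewrite /h => /setU1P[->|]; rewrite ?eqxx //; case: eqP.
have QS : Q \subset S := subsetUr _ _.
rewrite (hc c1 s) // (hc c1 t) // (hc c2 s) // (hc c2 t) //.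
rewrite (inj_in_eq (proper_clique p1 (subset_trans QS (subsetUr _ _)) cQ)) ?hQ //.
by rewrite (inj_in_eq (proper_clique p2 (subset_trans QS SC) cQ)) ?hQ.
Qed.

End Kempe.

(** * Augmenting systems of disjoint paths *)

Lemma split_last (T : eqType) (a : pred T) x s : has a (x :: s) ->
  exists s1 s2, [/\ s = s1 ++ s2, a (last x s1) & ~~ has a s2].
Proof.
elim: s x => [|y s IH] x /=; first by rewrite orbF => ax; exists [::], [::].
have [h _|h] := boolP (has a (y :: s)).
  by have [s1 [s2 [-> h1 h2]]] := IH y h; exists (y :: s1), s2.
rewrite -/(has a (y :: s)) (negPf h) orbF => ax.
by exists [::], (y :: s); split.
Qed.

Lemma perm_map_cons (T U : eqType) (f : T -> U) (s : seq T) a l : perm_eq (map f s) (a :: l) ->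
  exists q s', [/\ perm_eq s (q :: s'), f q = a & perm_eq (map f s') l].
Proof.
move=> h; have : a \in map f s by rewrite (perm_mem h) mem_head.
case/mapP => q qs e; exists q, (rem q s); have p := perm_to_rem qs; split=> //.
by have := perm_map f p; rewrite (permPl h) /= -e perm_cons perm_sym.
Qed.

Lemma split_at (T : eqType) (x y : T) s : y \in x :: s -> exists s1 s2, s = s1 ++ s2 /\ last x s1 = y.
Proof. by case/splitPl=> s1 s2 e; exists s1, s2. Qed.

Section Linkage.
Variable G : sgraph.
Implicit Types (U A B S : {set G}) (p q : G * seq G) (ps : seq (G * seq G)).

(* A path is given by its first vertex and the list of the others. *)
Definition tail_to U B z (b : seq G) := [&& path (@adj G) z b, all (mem U) (z :: b),
  last z b \in B, all (predC (mem B)) (belast z b) & uniq (z :: b)].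
Definition link U A B p := (p.1 \in A) && tail_to U B p.1 p.2.
Definition verts p := p.1 :: p.2.
Definition target p := last p.1 p.2.
Definition linkage U A B ps := all (link U A B) ps && uniq (flatten (map verts ps)).

Lemma tail_split U B h a b : tail_to U B h (a ++ b) -> tail_to U B (last h a) b.
Proof.
rewrite /tail_to cat_path last_cat belast_cat -cat_cons (lastI h a) all_cat cat_uniq all_cat.
case/and5P=> /andP[_ pb] /andP[aU bU] lB /andP[_ nb] /and3P[ua dab ub].
rewrite pb lB nb /= bU ub !andbT; apply/andP; split.
  by have := allP aU (last h a); rewrite mem_rcons mem_head => /(_ isT).
by apply: contra dab => h'; apply/hasP; exists (last h a); rewrite ?mem_rcons ?mem_head.
Qed.

Lemma tail_cat U B B' h a b : B \subset B' -> tail_to U B' h a -> tail_to U B (last h a) b ->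
  ~~ has (mem (h :: a)) b -> tail_to U B h (a ++ b).
Proof.
move=> /subsetP BB /and5P[pa aU _ na ua] /and5P[pb /andP[_ bU] lb nb /andP[_ ub]] d.
rewrite /tail_to cat_path last_cat belast_cat -cat_cons all_cat cat_uniq all_cat.
rewrite pa pb aU lb nb ua d (bU : all _ b) (ub : uniq b) !andbT /=.
by apply/allP => v /(allP na); apply: contra; exact: BB.
Qed.

Lemma tail_trunc U B h s : path (@adj G) h s -> all (mem U) (h :: s) -> uniq (h :: s) ->
  has (mem B) (h :: s) -> exists a b, s = a ++ b /\ tail_to U B h a.
Proof.
elim: s h => [|z s IH] h.
  move=> _ /= hU _; rewrite orbF => hB; exists [::], [::]; split=> //.
  by rewrite /tail_to /= hU hB.
have [hB|hB] := boolP (h \in B).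
  move=> _ /andP[hU _] _ _; exists [::], (z :: s); split=> //.
  by rewrite /tail_to /= (hU : h \in U) hB.
move=> /andP[hz ps] /andP[hU sU] /andP[hs us] /orP[hB'|hsB]; first by case/negP: hB.
have [a [b [e /and5P[pa aU la na ua]]]] := IH z ps sU us hsB.
exists (z :: a), b; rewrite e; split=> //.
apply/and5P; split=> //; first by rewrite /= hz.
- by apply/andP; split.
- by apply/andP; split.
- apply/andP; split=> //.
  by apply: contra hs; rewrite e -cat_cons mem_cat => ->.
Qed.

Lemma conn_link U A B (C : {set G}) : conn C -> C \subset U -> C :&: A != set0 -> C :&: B != set0 ->
  exists p, link U A B p /\ {subset verts p <= C}.
Proof.
move=> cC CU /set0Pn[a /setIP[aC aA]] /set0Pn[b /setIP[bC bB]].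
have : b \in component C a by rewrite conn_component.
rewrite componentE => /connectP[s ps e]; move: e; case/shortenP: ps => s' ps' us' _ e.
have sC : {subset a :: s' <= C}.
  move=> v; rewrite inE => /orP[/eqP->//|]; elim: (s') (a) ps' => // z t IH z0 /= /andP[zz pt].
  rewrite inE => /orP[/eqP->|]; last exact: IH pt.
  by move: zz; rewrite /restr => /and3P[].
have ps : path (@adj G) a s'.
  by apply: sub_path ps' => u v; rewrite /restr => /and3P[].
have [||x [y [es t]]] := @tail_trunc U B a s' ps _ us'.
- by apply/allP => v /sC; exact: (subsetP CU).
- by apply/hasP; exists b => //; rewrite e mem_last.
exists (a, x); split; first by rewrite /link aA.
by move=> v vx; apply: sC; rewrite es -cat_cons mem_cat vx.
Qed.

Lemma linkage_perm U A B ps qs : perm_eq ps qs -> linkage U A B ps = linkage U A B qs.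
Proof.
move=> h; rewrite /linkage (perm_all _ h); congr (_ && _); apply: perm_uniq.
by apply: perm_flatten; exact: perm_map.
Qed.

(* Diestel's induction for Menger's theorem: the first path leaves a path [P] of [ps] at [x] for the
   last time; add both ways to continue from [x] to the target set and extend the linkage given by
   the induction hypothesis. *)
Lemma augment U A B ps : linkage U A B ps ->
  (forall S, #|S| <= size ps -> exists p, link U A B p /\ ~~ has (mem S) (verts p)) ->
  exists ps' y, linkage U A B ps' /\ perm_eq (map target ps') (y :: map target ps).
Proof.
have [n] := ubnP #|U :\: B|; elim: n B ps => // n IH B ps Bn /andP[ok unq] H.
set F := flatten (map verts ps) in unq.
(* The hypothesis, applied to the set of old ends, yields a path to [B] that avoids all of them. *)
have [] := H [set z in map target ps].
  apply: leq_trans (_ : #|map target ps| <= _); first by rewrite cardsE.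
  by rewrite -(size_map target) card_size.
move=> [k r] [/andP[kA tR] avoid]; rewrite /= in kA tR.
have targetF p : p \in ps -> {subset verts p <= F}.
  by move=> pps v vp; apply/flattenP; exists (verts p) => //; apply: map_f.
have [meet|free] := boolP (has (mem F) (k :: r)); last first.
  exists ((k, r) :: ps), (last k r); split; last exact: perm_refl.
  apply/andP; split; first by rewrite /= {1}/link /= kA tR.
  have us : uniq (k :: r) by case/and5P: tR.
  rewrite /= -/F -[_ && _]/(uniq ((k :: r) ++ F)) cat_uniq us unq andbT.
  by rewrite has_sym free.
have [r1 [r2 [er xF r2F]]] := split_last meet; set x := last k r1 in xF.
have [_ /mapP[P Pps ->] xP] := flattenP xF.
have pP := perm_to_rem Pps; move: (rem P ps) pP => ps0 pP.
case: P pP xP Pps => h s pP xP Pps; have /andP[/= hA tP] := allP ok _ Pps.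
have [p1 [p2 [/= es ex]]] := split_at xP; rewrite {}es in pP Pps tP {xP}.
have xB : x \notin B.
  apply/negP => xB; case/negP: avoid; apply/hasP; exists x; first by rewrite /verts /= er -cat_cons mem_cat mem_last.
  rewrite inE inE; apply/mapP; exists (h, p1 ++ p2) => //; rewrite /target /= last_cat ex.
  have := tail_split tP; rewrite ex => /and5P[_ _ _]; case: (p2) => //= z t /andP[].
  by rewrite inE xB.
have xp2 := tail_split tP; rewrite ex in xp2.
have xr2 : tail_to U B x r2 by move: tR; rewrite er => /tail_split.
(* Both tails from [x], along [P] and along the new path, become targets. Since [x] is in [U] but
   not in [B], the induction measure drops, and [P] shortened to end in [x] is a path to the new
   target set. *)
pose B' := [set v | [|| v \in B, v == x, v \in p2 | v \in r2]].
have BB : B \subset B' by apply/subsetP => v vB; rewrite inE vB.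
have xB' : x \in B' by rewrite inE eqxx orbT.
have xU : x \in U by case/and5P: xp2 => _ /andP[].
have Bn' : #|U :\: B'| < n.
  have := proper_card (_ : U :\: B' \proper U :\: B); rewrite ltnS in Bn => /(_ _) h'.
  apply: leq_trans Bn; apply: h'; apply/properP; split; first exact: setDS.
  by exists x; rewrite in_setD ?xB ?xU ?xB'.
have unq' : uniq ((h :: p1 ++ p2) ++ flatten (map verts ps0)).
  by rewrite -(perm_uniq (perm_flatten (perm_map verts pP))).
have memF v : (v \in F) = (v \in (h :: p1 ++ p2) ++ flatten (map verts ps0)).
  exact: perm_mem (perm_flatten (perm_map verts pP)) v.
have r2not v : v \in r2 -> v \in F = false.
  by move=> vr; apply/negP => vF; case/negP: r2F; apply/hasP; exists v.
have ok1 : linkage U A B' ((h, p1) :: ps0).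
  rewrite /linkage /=; apply/andP; split; last first.
    change (uniq ((h :: p1) ++ flatten (map verts ps0))).
    have e1 : (h :: p1 ++ p2) ++ flatten (map verts ps0) = (h :: p1) ++ (p2 ++ flatten (map verts ps0)).
      by rewrite -cat_cons catA.
    move: unq'; rewrite e1 !cat_uniq => /and3P[u1 h1 /and3P[_ _ u2]]; rewrite u1 u2 andbT /=.
    by apply: contra h1; rewrite has_cat orbC => ->.
  apply/andP; split.
    rewrite /link /= hA /=; move: tP; rewrite /tail_to cat_path last_cat belast_cat.
    rewrite -cat_cons all_cat cat_uniq all_cat => /and5P[/andP[-> _] /andP[-> _] _ /andP[nb _] /and3P[u1 u2 _]].
    rewrite ex xB' u1 andbT /=; apply/allP => v vb; rewrite !inE /= !negb_or.
    have vh : v \in h :: p1 by rewrite lastI mem_rcons inE vb orbT.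
    have := allP nb v vb => /= ->; rewrite /=; apply/and3P; split.
    + by move: u1; rewrite lastI rcons_uniq ex; apply: contraTneq => <-; rewrite vb.
    + by apply: contra u2 => vp; apply/hasP; exists v.
    + by apply/negP => /r2not; rewrite memF -cat_cons !mem_cat vh.
  apply/allP => q qps0; have qps : q \in ps by rewrite (perm_mem pP) inE qps0 orbT.
  have /andP[qA /and5P[h1 h2 h3 h4 h5]] := allP ok _ qps.
  rewrite /link qA /tail_to h1 h2 h5 andbT (subsetP BB) //=; apply/allP => v vb.
  have vq : v \in verts q by rewrite /verts lastI mem_rcons inE vb orbT.
  have vF0 : v \in flatten (map verts ps0) by apply/flattenP; exists (verts q); rewrite ?map_f.
  move: unq'; rewrite cat_uniq => /and3P[_ /hasPn/(_ v vF0) nv _].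
  rewrite !inE /= !negb_or; have := allP h4 v vb => /= ->; rewrite /=; apply/and3P; split.
  + by apply: contraNneq nv => ->; rewrite -cat_cons mem_cat -ex mem_last.
  + by apply: contra nv => vp; rewrite -cat_cons mem_cat vp orbT.
  + by apply/negP => /r2not; rewrite (targetF q qps).
have sz : size ps = size ((h, p1) :: ps0) by rewrite (perm_size pP).
case: (IH B' ((h, p1) :: ps0) Bn' ok1) => [S|ps2 [y [ok2 pm]]].
  rewrite -sz => /H[[q t] [/andP[qA /and5P[t1 t2 t3 _ t5]] qS]].
  have [|a [b [et ta]]] := @tail_trunc U B' q t t1 t2 t5.
    by apply/hasP; exists (last q t); rewrite ?mem_last //; exact: (subsetP BB).
  exists (q, a); split; first by rewrite /link qA.
  by apply: contra qS => /hasP[v va vS]; apply/hasP; exists v; rewrite // /verts et -cat_cons mem_cat va.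
have [Q' [s' [pm1 tQ' pm']]] := perm_map_cons pm.
have [Q [s'' [pm2 tQ pm'']]] := perm_map_cons pm'.
have {}tQ : target Q = x by rewrite tQ -ex.
have pm3 : perm_eq ps2 (Q' :: Q :: s'').
  by rewrite (permPl pm1) perm_cons.
rewrite (linkage_perm _ _ _ pm3) in ok2.
case: Q tQ pm2 pm3 ok2 => q qs; rewrite /target /= => tQ pm2 pm3.
case: Q' tQ' pm1 pm3 => q' qs'; rewrite /target /= => tQ' pm1 pm3.
case/andP; rewrite /= -!cat_cons => /and3P[/andP[/= q'A lQ'] /andP[/= qA lQ] ls] u2.
have lasts v : v \in map target s'' -> v \in F.
  rewrite (perm_mem pm'') => /mapP[z zps ->]; apply: (targetF z); rewrite ?mem_last //.
  by rewrite (perm_mem pP) inE zps orbT.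
have p2F v : v \in p2 -> v \in F by move=> vp; rewrite memF -cat_cons !mem_cat vp orbT.
have xuniq : x \notin p2 /\ x \notin r2 by case/and5P: xp2 => _ _ _ _ /andP[->]; case/and5P: xr2 => _ _ _ _ /andP[->].
have p2last v : v \in p2 -> v \notin map target s''.
  move=> vp; rewrite (perm_mem pm''); apply/mapP => -[z zps ez].
  move: unq'; rewrite cat_uniq => /and3P[_ /hasPn/(_ v) nv _].
  have : v \in flatten (map verts ps0) by apply/flattenP; exists (verts z); rewrite ?map_f // ez mem_last.
  move/nv => /negP[]; change (v \in (h :: p1) ++ p2); by rewrite mem_cat vp orbT.
have r2last v : v \in r2 -> v \notin map target s''.
  by move=> vr; apply/negP => /lasts; rewrite r2not.
pose all2 := (q' :: qs') ++ (q :: qs) ++ flatten (map verts s'').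
have {}u2 : uniq all2 by exact: u2.
(* Paths of the new linkage meet [B'] only in their ends; hence the tails can be appended without
   creating intersections. *)
have old v : v \in all2 -> v \in B' -> [\/ v = y, v = x | v \in map target s''].
  have bel z zs : tail_to U B' z zs -> v \in z :: zs -> v \in B' -> v = last z zs.
    case/and5P=> _ _ _ nb _; rewrite lastI mem_rcons inE => /orP[/eqP//|/(allP nb) /= nB vB].
    by rewrite vB in nB.
  rewrite /all2 !mem_cat => /or3P[vq|vq|/flattenP[_ /mapP[z zs ->] vz]] vB.
  - by constructor 1; rewrite -tQ'; exact: bel lQ' vq vB.
  - by constructor 2; rewrite -tQ; exact: bel lQ vq vB.
  - constructor 3; apply/mapP; exists z => //; have /andP[_ lz] := allP ls _ zs.
    exact: bel lz vz vB.
have yx : y != x.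
  apply/eqP => e; move: u2; rewrite /all2 cat_uniq => /and3P[_ /hasPn/(_ x) h' _].
  have xq : x \in q :: qs by rewrite -tQ mem_last.
  have /h'/negP[] : x \in (q :: qs) ++ flatten (map verts s'') by rewrite mem_cat xq.
  rewrite -e -tQ'; exact: mem_last.
have fin T T' : tail_to U B x T -> tail_to U B y T' -> (T = p2 \/ T = r2) ->
    {subset T' <= p2} \/ {subset T' <= r2} -> ~~ has (mem T) T' -> y \notin T ->
    linkage U A B [:: (q', qs' ++ T'), (q, qs ++ T) & s''] /\
    map target [:: (q', qs' ++ T'), (q, qs ++ T) & s''] = [:: last y T', last x T & map target s''].
  move=> xT yT cT cT' dT yNT; have tB v : v \in T -> v \in B'.
    by case: cT => ->; rewrite inE => ->; rewrite ?orbT.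
  have tB' v : v \in T' -> v \in B'.
    by case: cT' => h' /h'; rewrite inE => ->; rewrite ?orbT.
  have Tall v : v \in T -> v \notin all2.
    move=> vT; apply/negP => va; case: (old v va (tB v vT)) => e.
    - by rewrite -e vT in yNT.
    - by move: vT; rewrite e; case: cT => ->; case: xuniq => n1 n2; rewrite ?(negPf n1) ?(negPf n2).
    - by case: cT => eT; rewrite eT in vT; [have := p2last v vT|have := r2last v vT]; rewrite e.
  have T'all v : v \in T' -> v \notin all2.
    move=> vT; apply/negP => va; case: (old v va (tB' v vT)) => e.
    - by case/and5P: yT => _ _ _ _ /andP[]; rewrite -e vT.
    - by case: cT' => h'; have := h' v vT; rewrite e; case: xuniq => n1 n2; rewrite ?(negPf n1) ?(negPf n2).
    - by case: cT' => h'; [have := p2last v (h' v vT)|have := r2last v (h' v vT)]; rewrite e.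
  split; last by rewrite /= /target /= !last_cat tQ tQ'.
  apply/andP; split.
    rewrite /= /link /= q'A qA; apply/and3P; split.
    - apply: tail_cat BB lQ' _ _; first by rewrite tQ'.
      by apply/hasPn => v /T'all; apply: contra => vq; rewrite mem_cat (vq : v \in _).
    - apply: tail_cat BB lQ _ _; first by rewrite tQ.
      by apply/hasPn => v /Tall; apply: contra => vq; rewrite !mem_cat (vq : v \in _) orbT.
    - apply/allP => z zs; have /andP[-> /and5P[h1 h2 h3 h4 h5]] := allP ls _ zs.
      rewrite /tail_to h1 h2 h5 andbT /=; apply/andP; split.
        have : target z \in map target ps0 by rewrite -(perm_mem pm'') map_f.
        case/mapP => w wps ez; rewrite -/(target z) ez; have wps' : w \in ps by rewrite (perm_mem pP) inE wps orbT.
        by have /andP[_ /and5P[]] := allP ok _ wps'.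
      by apply/allP => v /(allP h4); apply: contra; exact: (subsetP BB).
  have pe : perm_eq (flatten (map verts [:: (q', qs' ++ T'), (q, qs ++ T) & s''])) ((T' ++ T) ++ all2).
    apply/seq.permP => a; rewrite /all2 /= !count_cat /= !count_cat /= !count_cat.
    by clear; lia.
  rewrite (perm_uniq pe) cat_uniq u2 andbT cat_uniq.
  have uT : uniq T by case/and5P: xT => _ _ _ _ /andP[].
  have uT' : uniq T' by case/and5P: yT => _ _ _ _ /andP[].
  rewrite uT uT' [has _ T]has_sym dT; apply/andP; split; first by [].
  apply/hasPn => v va; apply/negP => vT; have {}vT : v \in T' ++ T by exact: vT.
  by move: vT; rewrite mem_cat => /orP[/T'all|/Tall] /negP[].
have lP : target (h, p1 ++ p2) = last x p2 by rewrite /target /= last_cat ex.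
have pmt : perm_eq (map target ps) (last x p2 :: map target ps0).
  by rewrite -lP; exact: perm_map pP.
have yB' : y \in B' by rewrite -tQ'; case/and5P: lQ'.
have tail_y (c a b : seq G) : tail_to U B x c -> c = a ++ b -> last x a = y -> tail_to U B y b.
  by move=> t e <-; move: t; rewrite e => /tail_split.
have [xNp xNr] := xuniq.
have dpr : ~~ has (mem r2) p2 by apply/hasPn => v vp; apply/negP => /r2not; rewrite p2F.
have pms : perm_eq (map target s'') (map target ps0) := pm''.
(* The additional end [y] lies on the old tail, on the new tail, or in [B]. In the first case the
   path ending in [x] continues along [r2], in the other two along [p2]. *)
have [yp|yp] := boolP (y \in x :: p2).
  have [a [b [eab ey]]] := split_at yp.
  move: (yp); rewrite inE (negPf yx) /= => yp2.
  have [|||lk tg] := fin r2 b xr2 (tail_y _ _ _ xp2 eab ey) (or_intror erefl).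
  - by left=> v vb; rewrite eab mem_cat vb orbT.
  - by apply/hasPn => v vb; apply/negP => /r2not; rewrite p2F // eab mem_cat vb orbT.
  - by apply/negP => /r2not; rewrite p2F.
  exists [:: (q', qs' ++ b), (q, qs ++ r2) & s''], (last x r2); split=> //.
  rewrite tg; have -> : last y b = last x p2 by rewrite eab last_cat ey.
  by rewrite (perm_catCA [:: _] [:: _]) /= perm_cons perm_sym (permPl pmt) perm_cons perm_sym.
have yp2 : y \notin p2 by move: yp; rewrite inE negb_or => /andP[].
have [yr|yr] := boolP (y \in r2).
  have [a [b [eab ey]]] := split_at (mem_behead (s := x :: r2) yr).
  have [|||lk tg] := fin p2 b xp2 (tail_y _ _ _ xr2 eab ey) (or_introl erefl) => //.
  - by right=> v vb; rewrite eab mem_cat vb orbT.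
  - apply/hasPn => v vb; have vr : v \in r2 by rewrite eab mem_cat vb orbT.
    by apply/negP => /p2F; rewrite r2not.
  exists [:: (q', qs' ++ b), (q, qs ++ p2) & s''], (last y b); split=> //.
  by rewrite tg perm_cons perm_sym (permPl pmt) perm_cons perm_sym.
have yB : y \in B.
  by move: yB'; rewrite inE (negPf yx) (negPf yp2) (negPf yr) !orbF.
have yU : y \in U by rewrite -tQ'; case/and5P: lQ' => _ /allP/(_ _ (mem_last _ _)).
have yt : tail_to U B y [::] by rewrite /tail_to /= (yU : y \in U) yB.
have [|||lk tg] := fin p2 [::] xp2 yt (or_introl erefl) => //; first by left.
exists [:: (q', qs' ++ [::]), (q, qs ++ p2) & s''], y; split=> //.
by rewrite tg perm_cons perm_sym (permPl pmt) perm_cons perm_sym.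
Qed.

Lemma augment_to k U A B ps : linkage U A B ps -> size ps <= k ->
  (forall S, #|S| < k -> exists p, link U A B p /\ ~~ has (mem S) (verts p)) ->
  exists ps', [/\ linkage U A B ps', size ps' = k & {subset map target ps <= map target ps'}].
Proof.
move=> + + H; have [n] := ubnP (k - size ps); elim: n ps => // n IH ps kn lps szk.
have [/eqP e|ne] := boolP (size ps == k); first by exists ps; split.
have szk' : size ps < k by rewrite ltn_neqAle ne.
have [|qs [y [lqs pm]]] := augment lps.
  by move=> S Sk; apply: H; exact: leq_ltn_trans Sk szk'.
have sq : size qs = (size ps).+1 by rewrite -(size_map target) (perm_size pm) /= size_map.
have [||ps' [l' s' sub]] := IH qs _ lqs; first by move: kn szk'; rewrite sq; clear; lia.
  by rewrite sq.
by exists ps'; split=> // v vps; apply: sub; rewrite (perm_mem pm) inE vps orbT.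
Qed.
End Linkage.

(** * Separators of cliques *)

Lemma finite_choice (I : finType) (T : Type) (t0 : T) (S : {set I}) (P : I -> T -> Prop) :
  (forall i, i \in S -> exists t, P i t) -> exists f, forall i, i \in S -> P i (f i).
Proof.
move=> h; suff : forall r : seq I, {subset r <= S} -> exists f, forall i, i \in r -> P i (f i).
  case/(_ (enum S)) => [i|f hf]; first by rewrite mem_enum.
  by exists f => i iS; apply: hf; rewrite mem_enum.
elim=> [|i r IH] sub; first by exists (fun=> t0).
case: IH => [j jr|f hf]; first by apply: sub; rewrite inE jr orbT.
have [t ht] := h i (sub i (mem_head _ _)).
exists (fun j => if j == i then t else f j) => j; rewrite inE; case: eqP => [->//|_ /=]; exact: hf.
Qed.

Lemma sumn_all1 (r : seq nat) : all (leq 1) r -> sumn r <= size r -> all (pred1 1) r.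
Proof.
have low s : all (leq 1) s -> size s <= sumn s.
  by elim: s => //= n s IH /andP[n1 /IH h]; exact: (leq_add n1 h).
elim: r => //= n r IH /andP[n1 r1] le; have := low r r1; have n1' : n = 1.
  by move: le n1 (low r r1); clear; lia.
by rewrite n1' /= => _; apply: IH => //; move: le; rewrite n1'.
Qed.

Section Separators.
Variable G : sgraph.
Implicit Types (U A B C S L : {set G}).

(** Relative to the graph induced on [U], because some of the later paths have to avoid one side of
    a neighbourhood, or the vertex [x]. *)
Definition sep U S A B := [forall a in (A :&: U) :\: S, [disjoint component (U :\: S) a & B]].

Lemma unsep_link U S A B : ~~ sep U S A B -> exists p, link U A B p /\ ~~ has (mem S) (verts p).
Proof.
rewrite negb_forall_in => /exists_inP[a]; rewrite in_setD in_setI => /and3P[aS aA aU] meet.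
have aUS : a \in U :\: S by rewrite in_setD aS.
have sub := component_sub aUS.
case: (@conn_link G U A B (component (U :\: S) a)).
- exact: component_conn.
- exact: subset_trans sub (subsetDl _ _).
- by apply/set0Pn; exists a; rewrite in_setI component_self.
- by rewrite setI_eq0.
move=> p [lp ps]; exists p; split=> //; apply/hasPn => v /ps/(subsetP sub).
by rewrite in_setD => /andP[].
Qed.

Lemma sepP U S A B C : sep U S A B -> conn C -> C \subset U -> [disjoint C & S] -> C :&: A != set0 ->
  C :&: B != set0 -> False.
Proof.
move=> /forall_inP h cC CU dCS /set0Pn[a /setIP[aC aA]] /set0Pn[b /setIP[bC bB]].
have aS : a \notin S by rewrite (disjointFr dCS).
have aU := subsetP CU _ aC.
have := h a; rewrite in_setD in_setI aS aA aU => /(_ isT)/disjointFl/(_ bB).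
have sub : C \subset component (U :\: S) a.
  apply: component_max => //; first by rewrite in_setD aS.
  by apply/subsetP => v vC; rewrite in_setD (subsetP CU) // (disjointFr dCS).
by rewrite (subsetP sub).
Qed.

Lemma sepPn U S A B k : (forall S, #|S| < k -> ~~ sep U S A B) -> forall S, #|S| < k ->
  exists p, link U A B p /\ ~~ has (mem S) (verts p).
Proof. by move=> h S' /h; exact: unsep_link. Qed.

End Separators.

Section CliqueSeparators.
Variable G : sgraph.
Hypothesis cG : critical G.
Implicit Types (U A B C D S L : {set G}).

(* Contracting the sets [Z v] onto the vertices [v] of [S] makes [S] a clique. *)
Lemma rainbow_half S D L (Z : G -> {set G}) : D != set0 -> [disjoint D & S] -> clique L ->
  {in S, forall v, [/\ conn (Z v), v \in Z v, Z v \subset v |: D & Z v :&: L != set0]} ->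
  {in S &, forall u v, u != v -> [disjoint Z u & Z v]} ->
  exists c, proper_on (~: D) c /\ {in S &, injective c}.
Proof.
move=> /set0Pn[d dD] dDS cL hZ dZ; pose B v := if v \in S then Z v else [set v].
have [|||c hc] := @colour_sets G cG (~: D) B.
- by move=> v _; rewrite /B; case: ifP => [/hZ[]//|_]; exact: conn1.
- have dis u v : u \in S -> v \notin S -> v \in ~: D -> [disjoint Z u & [set v]].
    move=> uS vS; rewrite in_setC => vD; rewrite disjoint_sym disjoints1.
    have [_ _ sub _] := hZ u uS; apply/negP => /(subsetP sub)/setU1P[e|]; last by rewrite (negPf vD).
    by rewrite e uS in vS.
  move=> u v uA vA uv; rewrite /B; case: ifPn => uS; case: ifPn => vS.
  + exact: dZ.
  + exact: dis.
  + by rewrite disjoint_sym; exact: dis.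
  + by rewrite disjoints1 inE.
- by rewrite -cardsT; apply: proper_card; rewrite properT; apply/eqP => /setP/(_ d); rewrite !inE dD.
have SD : S \subset ~: D by rewrite -disjoints_subset disjoint_sym.
have inB v : v \in B v by rewrite /B; case: ifP => [/hZ[]//|_]; rewrite set11.
exists c; split.
  move=> u v uD vD uv; apply: hc; rewrite ?adj_neq //.
  by apply/adjsP; exists u, v.
move=> u v uS vS /eqP; apply: contraTeq => uv; apply: hc; rewrite ?(subsetP SD) //.
have [_ _ _ /set0Pn[a /setIP[aZ aL]]] := hZ u uS.
have [_ _ _ /set0Pn[b /setIP[bZ bL]]] := hZ v vS.
apply/adjsP; exists a, b; rewrite /B uS vS; split=> //; apply: cL => //.
by apply: contraTneq bZ => <-; rewrite (disjointFr (dZ u v uS vS uv)).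
Qed.

(** For a smallest separator [S] other than the two cliques, Menger gives as many disjoint paths as
    [S] has vertices, each meeting [S] once. Contracting their segments on one side into [S] makes
    [S] a clique, because they end in [L] or in [L']; so both sides have colourings injective on
    [S], and these can be glued. *)
Lemma clique_separator S L L' : clique L -> clique L' -> sep setT S L L' ->
  #|S| <= #|L| -> #|S| <= #|L'| -> S = L \/ S = L'.
Proof.
move=> cL cL'; have [n] := ubnP #|S|; elim: n S => // n IH S Sn sS SL SL'.
(* By induction a smaller separator would equal [L] or [L'], which are too large for that; so [S]
   may be taken as smallest. *)
have [/existsP[S' /andP[lt sS']]|/existsPn min] := boolP [exists S' : {set G}, (#|S'| < #|S|) && sep setT S' L L'].
  have := IH S' (leq_trans lt Sn) sS' (ltnW (leq_trans lt SL)) (ltnW (leq_trans lt SL')).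
  by case=> e; move: lt; rewrite e ltnNge ?SL ?SL'.
have [LS|/subsetPn[l lL lS]] := boolP (L \subset S).
  by left; apply/eqP; rewrite eq_sym eqEcard LS.
have [LS|/subsetPn[l' lL' lS']] := boolP (L' \subset S).
  by right; apply/eqP; rewrite eq_sym eqEcard LS.
have ns (S' : {set G}) : #|S'| < #|S| -> ~~ sep setT S' L L' by move=> lt; have := min S'; rewrite lt.
exfalso; have [//|//||ps [lps szps _]] := @augment_to G #|S| setT L L' [::]; first exact: sepPn ns.
move: lps; rewrite /linkage; set F := flatten _ => /andP[ok unq].
have hit p : p \in ps -> 1 <= count (mem S) (verts p).
  move=> pps; rewrite -has_count; apply: contraT => no; exfalso.
  have /andP[pL /and5P[pp _ pL' _ _]] := allP ok _ pps.
  apply: (sepP sS (conn_path pp)); first exact: subsetT.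
  - by apply/pred0P => v /=; rewrite inE; apply/negP => /andP[vp vS]; case/negP: no; apply/hasP; exists v.
  - by apply/set0Pn; exists p.1; rewrite in_setI inE mem_head.
  - by apply/set0Pn; exists (last p.1 p.2); rewrite in_setI inE mem_last.
have cF : count (mem S) F = #|[set v in F] :&: S|.
  rewrite -size_filter -(card_uniqP (filter_uniq _ unq)); apply: eq_card => v.
  by rewrite in_setI in_set mem_filter andbC.
have cF' : count (mem S) F <= #|S| by rewrite cF subset_leq_card // subsetIr.
have one : all (pred1 1) (map (fun p => count (mem S) (verts p)) ps).
  have sumE : sumn (map (fun p => count (mem S) (verts p)) ps) = count (mem S) F.
    by rewrite /F count_flatten -map_comp.
  apply: sumn_all1; last by rewrite sumE size_map szps.
  by rewrite all_map; apply/allP => p /hit.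
have {}cF : S \subset [set v in F].
  have e : count (mem S) F = #|S|.
    rewrite /F count_flatten -map_comp -szps.
    have : forall r : seq (G * seq G), all (pred1 1) (map (fun p => count (mem S) (verts p)) r) ->
      sumn (map (count (mem S) \o @verts G) r) = size r.
      by elim=> //= p r IHr /andP[/eqP-> /IHr->].
    exact.
  by apply/setIidPr/eqP; rewrite eqEcard subsetIr -cF e leqnn.
set C := component (~: S) l.
have lC : l \in ~: S by rewrite in_setC.
have CS : C \subset ~: S := component_sub lC.
have conC : conn C := component_conn _ _.
have LC h : h \in L -> h \notin S -> h \in C.
  move=> hL hS; have [->|hl] := eqVneq h l; first exact: component_self.
  by apply: (component_closed lC (component_self _ _)); rewrite ?in_setC // cL // eq_sym.
have C_L' : C :&: L' = set0.
  apply/eqP; apply: contraT => h; exfalso; apply: (sepP sS conC (subsetT _)) => //.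
    by rewrite disjoints_subset.
  by apply/set0Pn; exists l; rewrite in_setI component_self.
(* The path through [v] is cut at [v]: apart from [v], the part towards [L] runs inside [C], and the
   part towards [L'] avoids both [C] and [S]. *)
pose P v (Z : {set G} * {set G} * (G * seq G)) := [/\ Z.2 \in ps, v \in verts Z.2,
  [/\ conn Z.1.1, v \in Z.1.1, Z.1.1 \subset v |: C & Z.1.1 :&: L != set0],
  [/\ conn Z.1.2, v \in Z.1.2, Z.1.2 \subset v |: ~: (C :|: S) & Z.1.2 :&: L' != set0] &
  Z.1.1 :|: Z.1.2 \subset [set w in verts Z.2]].
have exZ v : v \in S -> exists Z, P v Z.
  move=> vS; have := subsetP cF _ vS; rewrite in_set => /flattenP[_ /mapP[p pps ->] vp].
  have /andP[pL /and5P[pp _ pL' _ up]] := allP ok _ pps.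
  have [a [b [eab ev]]] := split_at vp.
  have only w : w \in verts p -> w \in S -> w = v.
    move=> wp wS; have := allP one _ (map_f _ pps) => /eqP c1.
    apply/eqP; apply: contraT => wv; have : #|[set v; w]| <= count (mem S) (verts p).
      rewrite -size_filter -(card_uniqP (filter_uniq _ up)); apply: subset_leq_card.
      by apply/subsetP => t /set2P[->|->]; rewrite mem_filter /= ?vS ?wS.
    by rewrite c1 cards2 eq_sym wv.
  move: pp pL' up; rewrite eab cat_path last_cat ev => /andP[pa pb] lb.
  rewrite -cat_cons cat_uniq => /and3P[ua dab ub].
  have vpE w : (w \in verts p) = (w \in p.1 :: a) || (w \in b) by rewrite /verts eab -cat_cons mem_cat.
  have v_a : v \in p.1 :: a by rewrite -ev mem_last.
  exists ([set w in p.1 :: a], [set w in v :: b], p); split=> //=.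
  - split; rewrite ?inE //; first exact: conn_path.
    + apply/subsetP => w; rewrite in_set in_setU1; case: eqP => // /eqP wv wa /=.
      have aS t : t \in belast p.1 a -> t \notin S.
        move=> tb; have ta : t \in p.1 :: a by rewrite lastI mem_rcons inE tb orbT.
        apply/negP => tS; have e := only t; rewrite vpE ta in e.
        by move: ua; rewrite lastI rcons_uniq ev -(e isT tS) tb.
      move: wa aS ua pa; rewrite lastI mem_rcons inE ev (negPf wv) /=.
      case: a {eab ev dab v_a vpE} => //= z a wb aS _ /andP[hz pa].
      have pb' : path (@adj G) p.1 (belast z a) by move: pa hz; clear; elim: a z (p.1) => //= y a IHa z h /andP[zy pa] ->; exact: IHa.
      have sub : [set t in p.1 :: belast z a] \subset C.
        have hC : p.1 \in C by apply: LC => //; apply: aS; rewrite mem_head.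
        have -> : C = component (~: S) p.1 by rewrite /C (component_eq lC hC).
        apply: component_max; rewrite ?in_set ?mem_head //.
        * by rewrite aS // mem_head.
        * exact: conn_path.
        * by apply/subsetP => t; rewrite in_set in_setC => /aS.
      by apply: (subsetP sub); rewrite in_set.
    + by apply/set0Pn; exists p.1; rewrite in_setI in_set mem_head.
  - split; rewrite ?in_set ?mem_head //; first exact: conn_path.
    + apply/subsetP => w; rewrite in_set in_setU1 inE; case: eqP => // /eqP wv /= wb.
      have bS t : t \in b -> t \notin S.
        move=> tb; apply/negP => tS; have e := only t; rewrite vpE tb orbT in e.
        by case/hasPn/(_ t tb)/negP: dab; rewrite (e isT tS).
      rewrite in_setC in_setU negb_or bS // andbT; apply/negP => wC.
      move: wb bS pb lb; case: (b) => //= z b' wb bS /andP[vz pb] lb.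
      have sub : [set t in z :: b'] \subset C.
        have -> : C = component (~: S) w by rewrite /C (component_eq lC wC).
        apply: component_max; rewrite ?in_set //.
        * by rewrite bS.
        * exact: conn_path.
        * by apply/subsetP => t; rewrite in_set in_setC => /bS.
      have : last z b' \in C :&: L' by rewrite in_setI lb andbT (subsetP sub) // in_set mem_last.
      by rewrite C_L' in_set0.
    + by apply/set0Pn; exists (last v b); rewrite in_setI in_set mem_last.
  - apply/subsetP => w; rewrite in_setU !in_set => /orP[wa|]; first by rewrite vpE wa.
    by rewrite inE => /orP[/eqP->|wb]; rewrite vpE ?v_a ?wb ?orbT.
have [f hf] := finite_choice (set0, set0, (l, [::])) exZ.
have dis u v : u \in S -> v \in S -> u != v ->
    [disjoint (f u).1.1 :|: (f u).1.2 & (f v).1.1 :|: (f v).1.2].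
  move=> uS vS uv; have [pu up _ _ su] := hf u uS; have [pv vp _ _ sv] := hf v vS.
  apply: disjointWl su _; apply: disjointWr sv _.
  have ne : (f u).2 != (f v).2.
    apply: contraNneq uv => e; have := allP one _ (map_f _ pv) => /eqP c1.
    have /andP[_ /and5P[_ _ _ _ uq]] := allP ok _ pv.
    apply: contraT => uv; have : #|[set u; v]| <= count (mem S) (verts (f v).2).
      rewrite -size_filter -(card_uniqP (filter_uniq _ uq)); apply: subset_leq_card.
      by apply/subsetP => t /set2P[->|->]; rewrite mem_filter /= ?uS ?vS // -e.
    by rewrite c1 cards2 uv.
  apply/pred0P => t /=; rewrite !in_set; apply/negP => /andP[tu tv].
  have pm := perm_to_rem pu; have pv' : (f v).2 \in rem (f u).2 ps.
    by have := perm_mem pm (f v).2; rewrite pv inE eq_sym (negPf ne).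
  have : uniq (verts (f u).2 ++ flatten (map (@verts G) (rem (f u).2 ps))).
    by move: unq; rewrite (perm_uniq (perm_flatten (perm_map (@verts G) pm))).
  rewrite cat_uniq => /and3P[_ /hasPn/(_ t) h _].
  suff /h/negP[] : t \in flatten (map (@verts G) (rem (f u).2 ps)) by [].
  by apply/flattenP; exists (verts (f v).2); rewrite ?map_f.
have D2 : ~: (C :|: S) != set0.
  apply/set0Pn; exists l'; rewrite in_setC in_setU negb_or lS' andbT; apply/negP => l'C.
  have : l' \in C :&: L' by rewrite in_setI l'C.
  by rewrite C_L' in_set0.
have [|||c1 [p1 i1]] := @rainbow_half S (~: (C :|: S)) L' (fun v => (f v).1.2) D2 _ cL'.
- by rewrite disjoints_subset setCS subsetUr.
- by move=> v vS; case: (hf v vS).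
- by move=> u v uS vS uv; apply: disjointWl (disjointWr _ (dis u v uS vS uv)); exact: subsetUr.
have C0 : C != set0 by apply/set0Pn; exists l; exact: component_self.
have [|||c2 [p2 i2]] := @rainbow_half S C L (fun v => (f v).1.1) C0 _ cL.
- by rewrite disjoints_subset.
- by move=> v vS; case: (hf v vS).
- by move=> u v uS vS uv; apply: disjointWl (disjointWr _ (dis u v uS vS uv)); exact: subsetUl.
rewrite setCK in p1; apply: (glue_component cG lS p1 p2) => u v uS vS.
by rewrite (inj_in_eq i1) // (inj_in_eq i2).
Qed.

End CliqueSeparators.

(** * Odd cycles in the complement of a neighbourhood *)

Lemma split_repeat (T : eqType) (s : seq T) : ~~ uniq s ->
  exists v s1 s2 s3, s = s1 ++ v :: s2 ++ v :: s3.
Proof.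
elim: s => //= z s IH; rewrite negb_and negbK => /orP[zs|/IH[v [s1 [s2 [s3 ->]]]]].
  by case/splitPr: zs => s1 s2; exists z, [::], s1, s2.
by exists v, (z :: s1), s2, s3.
Qed.

Section OddCycles.
Variable G : sgraph.
Hypothesis cG : critical G.
Variable x : G.
Hypothesis x8 : #|nbr x| = 8.
Let N := nbr x.
Let h := @compl_rel G.

Let hC u v : h u v = h v u. Proof. by rewrite /h /compl_rel eq_sym adj_sym. Qed.

Lemma nonadj_free a b c : a \in N -> b \in N -> c \in N -> h a b -> h b c -> h a c -> False.
Proof.
rewrite !inE => xa xb xc /andP[ab nab] /andP[bc nbc] /andP[ac nac].
exact: (alpha2 cG x8 xa xb xc).
Qed.

(** The non-adjacent pair [a], [b] feeds [kempe_star], so every other neighbour of [x] is joined to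
    [u] by a Kempe chain with interior outside [cn x]; [a], [b] and [x] are adjacent to [u]
    itself. *)
Lemma star_full u a b : u \in N -> a \in N -> b \in N -> h a b -> u -- a -> u -- b ->
  forall v, v \in cn x -> v != u -> adjs [set v] (component (u |: ~: cn x) u).
Proof.
move=> uN aN bN /andP[ab nab] ua ub v.
have uZ : u \in component (u |: ~: cn x) u := component_self _ _.
have nbr_u w : w -- u -> adjs [set w] (component (u |: ~: cn x) u).
  by move=> wu; rewrite adjs1; apply/existsP; exists u; rewrite uZ.
rewrite cnE => /orP[/eqP->|xv] vu; first by apply: nbr_u; rewrite -nbrE.
have [va|va] := eqVneq v a; first by apply: nbr_u; rewrite va adj_sym.
have [vb|vb] := eqVneq v b; first by apply: nbr_u; rewrite vb adj_sym.
apply: (kempe_star cG x8 aN bN ab nab); last by rewrite eq_sym.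
  by rewrite !in_setD1 (adj_neq ub) (adj_neq ua).
by rewrite !in_setD1 vb va inE.
Qed.

(* The branch sets are [x], the star of [u], [p] and [q] together, and the other neighbours of [x]. *)
Lemma star_merge u a b p q : u \in N -> a \in N -> b \in N -> h a b -> u -- a -> u -- b ->
  p \in N -> q \in N -> p -- q -> p != u -> q != u ->
  msum (N :\ p :\ q :\ u) + 2 * #|non p :&: non q :&: (N :\ p :\ q) :\ u| <= 8 -> False.
Proof.
move=> uN aN bN hab ua ub pN qN pq pu qu le; case: cG => nK _ _; apply: nK.
have full := star_full uN aN bN hab ua ub; set Z := component _ u in full.
have uA : u \in u |: ~: cn x by rewrite setU11.
apply: (@hasK_star G x p q u Z) => //.
- exact: component_conn.
- exact: component_self.
- move=> v vx vu; apply/negP => /(subsetP (component_sub uA)).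
  by rewrite in_setU1 (negPf vu) in_setC vx.
- by rewrite -nbrE.
- by rewrite -nbrE.
- by rewrite pq orbT.
- by rewrite !in_setD1 eq_sym qu eq_sym pu.
- have := cardsD1 p N; rewrite pN x8 add1n => -[e].
  have := cardsD1 q (N :\ p); rewrite in_setD1 qN eq_sym (adj_neq pq) -e add1n => -[<-] //.
Qed.

Lemma msum_seq (s : seq G) : uniq s -> msum [set v in s] = \sum_(u <- s) \sum_(v <- s) (h u v : nat).
Proof.
move=> us; rewrite /msum /esum -[RHS]/(\sum_(u <- s) \sum_(v <- s) (@adj (compl G) u v : nat)).
rewrite -[LHS]/(degs [set v in s : seq (compl G)] [set v in s]) degs_sum.
rewrite [RHS]big_uniq //=; apply: eq_big => [u|u _]; first by rewrite inE.
by rewrite [RHS]big_uniq //=; apply: eq_bigl => v; rewrite inE.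
Qed.

Lemma card_seq (P : pred G) (s : seq G) : uniq s -> #|[set v in s | P v]| = count P s.
Proof.
move=> us; rewrite -size_filter -(card_uniqP (filter_uniq _ us)).
by apply: eq_card => v; rewrite in_set mem_filter andbC.
Qed.

Lemma star_merge_seq u p q s : N =i [:: u, p, q & s] -> uniq [:: u, p, q & s] -> p -- q ->
  (exists a b, [/\ a \in N, b \in N, h a b & ~~ h u a /\ ~~ h u b /\ u != a /\ u != b]) ->
  \sum_(v <- s) \sum_(w <- s) (h v w : nat) + 2 * count (fun v => h p v && h q v) s <= 8 -> False.
Proof.
move=> eN us pq [a [b [aN bN hab [ua [ub [nua nub]]]]]] le.
have mem v : v \in [:: u, p, q & s] -> v \in N by rewrite eN.
have [uN pN qN] : [/\ u \in N, p \in N & q \in N] by split; apply: mem; rewrite !inE eqxx ?orbT.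
move: us => /= /and4P[]; rewrite !inE !negb_or => /and3P[up uq us] /andP[npq ps] qs uqs.
have adjN v : u != v -> ~~ h u v -> u -- v by rewrite /h /compl_rel => -> /=; rewrite negbK.
apply: (star_merge uN aN bN hab (adjN _ nua ua) (adjN _ nub ub) pN qN pq); rewrite 1?eq_sym //.
have e : N :\ p :\ q :\ u = [set v in s].
  apply/setP => v; rewrite !in_setD1 eN !inE.
  case: eqP => [->|_]; first by rewrite (negPf us).
  case: eqP => [->|_]; first by rewrite (negPf qs).
  by case: eqP => [->|_]; first by rewrite (negPf ps).
rewrite e msum_seq //; apply: leq_trans le; rewrite leq_add2l leq_mul2l /= -card_seq //.
apply: subset_leq_card; apply/subsetP => v; rewrite in_setD1 in_setI => /andP[vu /andP[nn vN]].
have : v \in N :\ p :\ q :\ u by rewrite in_setD1 vu.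
by rewrite e !in_set => ->; move: nn; rewrite in_setI !nonE.
Qed.

(** The complement has no triangle, so [u] is adjacent to two consecutive vertices of the cycle and
    can absorb the outside. Merging [c1] and [c4] leaves the missing pair [c2], [c3], the common
    non-neighbour [c0], and at most one defect for each of [v] and [w]: four in all. *)
Lemma five_cycle_core c0 c1 c2 c3 c4 u v w : N =i [:: c0; c1; c2; c3; c4; u; v; w] ->
  uniq [:: c0; c1; c2; c3; c4; u; v; w] -> h c0 c1 -> h c1 c2 -> h c2 c3 -> h c3 c4 -> h c4 c0 ->
  ~~ h v w -> ~~ (h v c0 && (h v c2 || h v c3)) -> ~~ (h w c0 && (h w c2 || h w c3)) -> False.
Proof.
move=> eN us h01 h12 h23 h34 h40 nvw nv nw.
have mem z : z \in [:: c0; c1; c2; c3; c4; u; v; w] -> z \in N by rewrite eN.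
have tri a b c : a \in [:: c0; c1; c2; c3; c4; u; v; w] -> b \in [:: c0; c1; c2; c3; c4; u; v; w] ->
  c \in [:: c0; c1; c2; c3; c4; u; v; w] -> h a b -> h b c -> h a c = false.
  move=> ha hb hc ab bc; apply/negP => ac; exact: (nonadj_free (mem _ ha) (mem _ hb) (mem _ hc) ab bc ac).
have n02 : h c0 c2 = false by apply: (tri c0 c1 c2); rewrite ?inE ?eqxx ?orbT.
have n13 : h c1 c3 = false by apply: (tri c1 c2 c3); rewrite ?inE ?eqxx ?orbT.
have n24 : h c2 c4 = false by apply: (tri c2 c3 c4); rewrite ?inE ?eqxx ?orbT.
have n30 : h c3 c0 = false by apply: (tri c3 c4 c0); rewrite ?inE ?eqxx ?orbT.
have n41 : h c4 c1 = false by apply: (tri c4 c0 c1); rewrite ?inE ?eqxx ?orbT.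
have ind z : z \in [:: c0; c1; c2; c3; c4; u; v; w] ->
    [&& ~~ (h z c0 && h z c1), ~~ (h z c1 && h z c2), ~~ (h z c2 && h z c3), ~~ (h z c3 && h z c4) & ~~ (h z c4 && h z c0)].
  move=> hz; have t a b : a \in [:: c0; c1; c2; c3; c4; u; v; w] -> b \in [:: c0; c1; c2; c3; c4; u; v; w] ->
    h a b -> ~~ (h z a && h z b).
    by move=> ha hb ab; apply/negP => /andP[za zb]; rewrite (tri z a b) in zb.
  by rewrite !t // !inE eqxx ?orbT.
have un i j : i < 8 -> j < 8 -> i != j ->
    nth c0 [:: c0; c1; c2; c3; c4; u; v; w] i != nth c0 [:: c0; c1; c2; c3; c4; u; v; w] j.
  by move=> i8 j8 ij; rewrite nth_uniq.
have hu : u \in [:: c0; c1; c2; c3; c4; u; v; w] by rewrite !inE eqxx ?orbT.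
have hv : v \in [:: c0; c1; c2; c3; c4; u; v; w] by rewrite !inE eqxx ?orbT.
have hw : w \in [:: c0; c1; c2; c3; c4; u; v; w] by rewrite !inE eqxx ?orbT.
apply: (@star_merge_seq u c4 c1 [:: c0; c2; c3; v; w]).
- by move=> z; rewrite eN !inE; do 8 (case: (z == _) => //=).
- rewrite (perm_uniq (s2 := [:: c0; c1; c2; c3; c4; u; v; w])) //.
  apply/seq.permP => P /=; clear; lia.
- have d41 : c4 != c1 := un 4 1 isT isT isT.
  by move/negbT: n41; rewrite /h /compl_rel d41 negbK.
- have : [|| ~~ h u c0 && ~~ h u c1, ~~ h u c1 && ~~ h u c2, ~~ h u c2 && ~~ h u c3,
             ~~ h u c3 && ~~ h u c4 | ~~ h u c4 && ~~ h u c0].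
    have := ind u hu; move: (h u c0) (h u c1) (h u c2) (h u c3) (h u c4) => b0 b1 b2 b3 b4.
    by case: b0 b1 b2 b3 b4 => [] [] [] [] [].
  have [d0 d1 d2 d3 d4] : [/\ u != c0, u != c1, u != c2, u != c3 & u != c4].
    by split; [exact: (un 5 0)|exact: (un 5 1)|exact: (un 5 2)|exact: (un 5 3)|exact: (un 5 4)].
  case/or4P => [/andP[? ?]|/andP[? ?]|/andP[? ?]|/orP[/andP[? ?]|/andP[? ?]]];
    [exists c0, c1|exists c1, c2|exists c2, c3|exists c3, c4|exists c4, c0]; split; rewrite ?mem ?inE ?eqxx ?orbT //.
- have irr z : h z z = false by rewrite /h /compl_rel eqxx.
  have iv := ind v hv; have iw := ind w hw.
  rewrite !big_cons !big_nil /= !irr [h c2 c0]hC n02 [h c0 c3]hC n30 [h c3 c2]hC h23.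
  rewrite [h w v]hC (negPf nvw) ![h _ v]hC ![h _ w]hC [h c4 c0]hC ![h c0 c4]hC [h c1 c0]hC.
  rewrite [h c4 c2]hC n24 n13.
  move: nv nw iv iw; clear.
  move: (h v c0) (h v c1) (h v c2) (h v c3) (h v c4) (h w c0) (h w c1) (h w c2) (h w c3) (h w c4).
  move: (h c4 c0) (h c0 c1) => r s b0 b1 b2 b3 b4 d0 d1 d2 d3 d4.
  have bound (a0 a1 a2 a3 a4 : bool) : ~~ (a0 && (a2 || a3)) ->
      [&& ~~ (a0 && a1), ~~ (a1 && a2), ~~ (a2 && a3), ~~ (a3 && a4) & ~~ (a4 && a0)] ->
      a0 + a2 + a3 + (a4 && a1) <= 1 by case: a0 a1 a2 a3 a4 => [] [] [] [] [].
  move=> nb nd ib id; have := bound b0 b1 b2 b3 b4 nb ib; have := bound d0 d1 d2 d3 d4 nd id.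
  have := leq_b1 (r && s); move: (r && s : nat) (b4 && b1 : nat) (d4 && d1 : nat).
  move: (b0 : nat) (b2 : nat) (b3 : nat) (d0 : nat) (d2 : nat) (d3 : nat); clear; simpl; lia.
Qed.

(** In the complement [v] and [w] attach to independent sets of the cycle; for any two such sets one
    of the five rotations meets both conditions of [five_cycle_core]. *)
Lemma five_cycle_split c0 c1 c2 c3 c4 u v w : N =i [:: c0; c1; c2; c3; c4; u; v; w] ->
  uniq [:: c0; c1; c2; c3; c4; u; v; w] -> h c0 c1 -> h c1 c2 -> h c2 c3 -> h c3 c4 -> h c4 c0 ->
  ~~ h v w -> False.
Proof.
move=> eN us h01 h12 h23 h34 h40 nvw.
have rot a0 a1 a2 a3 a4 : perm_eq [:: a0; a1; a2; a3; a4; u; v; w] [:: c0; c1; c2; c3; c4; u; v; w] ->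
    h a0 a1 -> h a1 a2 -> h a2 a3 -> h a3 a4 -> h a4 a0 ->
    ~~ (h v a0 && (h v a2 || h v a3)) -> ~~ (h w a0 && (h w a2 || h w a3)) -> False.
  move=> pm a01 a12 a23 a34 a40; apply: (@five_cycle_core _ _ _ _ _ u v w _ _ a01 a12 a23 a34 a40 nvw).
    by move=> z; rewrite eN (perm_mem pm).
  by rewrite (perm_uniq pm).
have ind z : z \in [:: c0; c1; c2; c3; c4; u; v; w] ->
    [&& ~~ (h z c0 && h z c1), ~~ (h z c1 && h z c2), ~~ (h z c2 && h z c3), ~~ (h z c3 && h z c4) & ~~ (h z c4 && h z c0)].
  move=> hz; have t a b : a \in [:: c0; c1; c2; c3; c4; u; v; w] -> b \in [:: c0; c1; c2; c3; c4; u; v; w] ->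
    h a b -> ~~ (h z a && h z b).
    rewrite -!eN in hz * => aN bN ab; apply/negP => /andP[za zb].
    exact: (nonadj_free hz aN bN za ab zb).
  by rewrite !t // !inE eqxx ?orbT.
have hv : v \in [:: c0; c1; c2; c3; c4; u; v; w] by rewrite !inE eqxx ?orbT.
have hw : w \in [:: c0; c1; c2; c3; c4; u; v; w] by rewrite !inE eqxx ?orbT.
have := ind w hw; have := ind v hv.
have pm (a0 a1 a2 a3 a4 : G) : perm_eq [:: a0; a1; a2; a3; a4] [:: c0; c1; c2; c3; c4] ->
    perm_eq [:: a0; a1; a2; a3; a4; u; v; w] [:: c0; c1; c2; c3; c4; u; v; w].
  by move=> e; rewrite -[[:: a0, a1, a2, a3, a4 & _]]/([:: a0; a1; a2; a3; a4] ++ [:: u; v; w])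
    -[[:: c0, c1, c2, c3, c4 & _]]/([:: c0; c1; c2; c3; c4] ++ [:: u; v; w]) perm_cat2r.
have R k : perm_eq (seq.rot k [:: c0; c1; c2; c3; c4]) [:: c0; c1; c2; c3; c4] by rewrite perm_rot.
have := rot _ _ _ _ _ (pm c0 c1 c2 c3 c4 (R 0)) h01 h12 h23 h34 h40.
have := rot _ _ _ _ _ (pm c1 c2 c3 c4 c0 (R 1)) h12 h23 h34 h40 h01.
have := rot _ _ _ _ _ (pm c2 c3 c4 c0 c1 (R 2)) h23 h34 h40 h01 h12.
have := rot _ _ _ _ _ (pm c3 c4 c0 c1 c2 (R 3)) h34 h40 h01 h12 h23.
have := rot _ _ _ _ _ (pm c4 c0 c1 c2 c3 (R 4)) h40 h01 h12 h23 h34.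
clear; move: (h v c0) (h v c1) (h v c2) (h v c3) (h v c4) (h w c0) (h w c1) (h w c2) (h w c3) (h w c4).
move=> b0 b1 b2 b3 b4 d0 d1 d2 d3 d4 r4 r3 r2 r1 r0 ib id.
suff : [|| ~~ (b0 && (b2 || b3)) && ~~ (d0 && (d2 || d3)), ~~ (b1 && (b3 || b4)) && ~~ (d1 && (d3 || d4)),
  ~~ (b2 && (b4 || b0)) && ~~ (d2 && (d4 || d0)), ~~ (b3 && (b0 || b1)) && ~~ (d3 && (d0 || d1)) |
  ~~ (b4 && (b1 || b2)) && ~~ (d4 && (d1 || d2))].
  by case/or4P=> [/andP[]|/andP[]|/andP[]|/orP[]/andP[]].
by move: ib id; clear; case: b0 b1 b2 b3 b4 => [] [] [] [] [] //; case: d0 d1 d2 d3 d4 => [] [] [] [] [].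
Qed.

Lemma five_cycle c0 c1 c2 c3 c4 : uniq [:: c0; c1; c2; c3; c4] -> {subset [:: c0; c1; c2; c3; c4] <= N} ->
  h c0 c1 -> h c1 c2 -> h c2 c3 -> h c3 c4 -> h c4 c0 -> False.
Proof.
move=> us sub h01 h12 h23 h34 h40; pose c := [:: c0; c1; c2; c3; c4].
have sN : #|N :\: [set z in c]| = 3.
  have sub' : [set z in c] \subset N by apply/subsetP => z; rewrite in_set => /sub.
  by rewrite cardsD (setIidPr sub') x8 cardsE (card_uniqP us).
have [u [v [w [e us']]]] : exists u v w, N :\: [set z in c] = [set z in [:: u; v; w]] /\ uniq [:: u; v; w].
  have ue := enum_uniq (N :\: [set z in c]); have se : size (enum (N :\: [set z in c])) = 3 by rewrite -cardE.
  have me := mem_enum (N :\: [set z in c]).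
  case: (enum _) ue se me => [|u [|v [|w [|]]]] //= ue _ me; exists u, v, w; split=> //.
  by apply/setP => z; rewrite -me in_set.
have full u' v' w' : perm_eq [:: u'; v'; w'] [:: u; v; w] -> N =i c ++ [:: u'; v'; w'] /\ uniq (c ++ [:: u'; v'; w']).
  move=> pm; split.
    move=> z; rewrite mem_cat (perm_mem pm); have /setP/(_ z) := e; rewrite in_setD !in_set => <-.
    by have [/sub|] := boolP (z \in c); rewrite ?orFb //= inE => ->.
  rewrite cat_uniq us (perm_uniq pm) us' andbT andTb; apply/hasPn => z; rewrite (perm_mem pm) => zu.
  have : z \in N :\: [set z in c] by rewrite e in_set.
  by rewrite in_setD in_set => /andP[].
have tri : ~~ h u v || ~~ h v w || ~~ h u w.
  apply: contraT; rewrite !negb_or !negbK => /andP[/andP[uv vw] uw].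
  have inN z : z \in [:: u; v; w] -> z \in N.
    by move=> zs; have : z \in N :\: [set z in c]; [rewrite e in_set|rewrite in_setD => /andP[]].
  by exfalso; apply: (nonadj_free _ _ _ uv vw uw); apply: inN; rewrite !inE eqxx ?orbT.
case/orP: tri => [/orP[]|] nh.
- have [|eN uq] := full w u v; first by rewrite (perm_catCA [:: w] [:: u; v] [::]).
  exact: (five_cycle_split eN uq h01 h12 h23 h34 h40 nh).
- have [|eN uq] := full u v w; first exact: perm_refl.
  exact: (five_cycle_split eN uq h01 h12 h23 h34 h40 nh).
- have [|eN uq] := full v u w; first by rewrite (perm_catCA [:: v] [:: u] [:: w]).
  exact: (five_cycle_split eN uq h01 h12 h23 h34 h40 nh).
Qed.

(** A chord of the cycle in the complement would close a triangle or a five-cycle. The eighth vertex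
    [w] absorbs the outside and [c0], [c2] are merged; what is missing is the path [c3], [c4], [c5],
    [c6] and the common non-neighbour [c1], four pairs. *)
Lemma seven_cycle c0 c1 c2 c3 c4 c5 c6 : uniq [:: c0; c1; c2; c3; c4; c5; c6] ->
  {subset [:: c0; c1; c2; c3; c4; c5; c6] <= N} ->
  h c0 c1 -> h c1 c2 -> h c2 c3 -> h c3 c4 -> h c4 c5 -> h c5 c6 -> h c6 c0 -> False.
Proof.
move=> us sub h01 h12 h23 h34 h45 h56 h60; pose c := [:: c0; c1; c2; c3; c4; c5; c6].
have [w wN wc] : exists2 w, w \in N & w \notin c.
  have : ~~ (N \subset [set z in c]).
    by apply/negP => /subset_leq_card; rewrite x8 cardsE (card_uniqP us).
  by case/subsetPn => w wN; rewrite in_set => wc; exists w.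
have cN z : z \in c -> z \in N := sub z.
have tri a b d : a \in c -> b \in c -> d \in c -> h a b -> h b d -> h a d = false.
  by move=> /cN ha /cN hb /cN hd ab bd; apply/negP => /(nonadj_free ha hb hd ab bd).
have mem i : i < 7 -> nth c0 c i \in c by move=> i7; rewrite mem_nth.
have m0 := mem 0 isT; have m1 := mem 1 isT; have m2 := mem 2 isT; have m3 := mem 3 isT.
have m4 := mem 4 isT; have m5 := mem 5 isT; have m6 := mem 6 isT.
have five i : i < 7 -> h (nth c0 c ((i + 0) %% 7)) (nth c0 c ((i + 1) %% 7)) ->
    h (nth c0 c ((i + 1) %% 7)) (nth c0 c ((i + 2) %% 7)) -> h (nth c0 c ((i + 2) %% 7)) (nth c0 c ((i + 3) %% 7)) ->
    h (nth c0 c ((i + 3) %% 7)) (nth c0 c ((i + 4) %% 7)) ->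
    h (nth c0 c ((i + 4) %% 7)) (nth c0 c ((i + 0) %% 7)) = false.
  move=> i7 e0 e1 e2 e3; apply/negP => e4; apply: (five_cycle _ _ e0 e1 e2 e3 e4).
    rewrite -[[:: _; _; _; _; _]]/(map (nth c0 c) (map (fun k => (i + k) %% 7) (iota 0 5))).
    rewrite map_inj_in_uniq.
      by move: i i7 {e0 e1 e2 e3 e4}; do 7 (case => //).
    move=> k l hk hl /eqP; rewrite nth_uniq //; first by move/eqP.
      by case/mapP: hk => ? _ ->; exact: ltn_pmod.
    by case/mapP: hl => ? _ ->; exact: ltn_pmod.
  move=> z hz; have /mapP[k /mapP[l _ ->] ->] :
    z \in map (nth c0 c) (map (fun k => (i + k) %% 7) (iota 0 5)) := hz.
  by apply: cN; apply: mem; exact: ltn_pmod.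
have n02 := tri c0 c1 c2 m0 m1 m2 h01 h12.
have n13 := tri c1 c2 c3 m1 m2 m3 h12 h23.
have n35 := tri c3 c4 c5 m3 m4 m5 h34 h45.
have n46 := tri c4 c5 c6 m4 m5 m6 h45 h56.
have n50 := tri c5 c6 c0 m5 m6 m0 h56 h60.
have n61 := tri c6 c0 c1 m6 m0 m1 h60 h01.
have n40 : h c4 c0 = false := five 0 isT h01 h12 h23 h34.
have n51 : h c5 c1 = false := five 1 isT h12 h23 h34 h45.
have n62 : h c6 c2 = false := five 2 isT h23 h34 h45 h56.
have n03 : h c0 c3 = false := five 3 isT h34 h45 h56 h60.
have n14 : h c1 c4 = false := five 4 isT h45 h56 h60 h01.
have n36 : h c3 c6 = false := five 6 isT h60 h01 h12 h23.
have ind a b : a \in c -> b \in c -> h a b -> ~~ (h w a && h w b).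
  by move=> /cN aN /cN bN ab; apply/negP => /andP[wa wb]; exact: (nonadj_free wN aN bN wa ab wb).
have wc' a : a \in c -> w != a by move=> ac; apply: contraNneq wc => ->.
have pair a b : a \in c -> b \in c -> h a b -> ~~ h w a && ~~ h w b ->
    exists a b, [/\ a \in N, b \in N, h a b & ~~ h w a /\ ~~ h w b /\ w != a /\ w != b].
  by move=> ac bc ab /andP[wa wb]; exists a, b; split=> //; rewrite ?cN // !wc'.
apply: (@star_merge_seq w c0 c2 [:: c1; c3; c4; c5; c6]).
- move=> z; apply/idP/idP; last first.
    rewrite inE => /orP[/eqP->//|zc]; apply: cN.
    by move: zc; rewrite !inE; do 7 (case: (z == _); rewrite ?orbT //).
  have eN : N = w |: [set z in c].
    apply/eqP; rewrite eq_sym eqEcard subUset sub1set wN; apply/andP; split.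
      by apply/subsetP => t; rewrite in_set => /cN.
    by rewrite x8 cardsU1 in_set wc cardsE (card_uniqP us).
  rewrite eN in_setU1 in_set !inE; do 8 (case: (z == _); rewrite ?orbT //).
- rewrite (perm_uniq (s2 := w :: c)); first by rewrite /= wc.
  apply/seq.permP => P /=; clear; lia.
- have d02 : c0 != c2.
    by move: us => /= /andP[]; rewrite !inE !negb_or => /and5P[_ ->].
  by move/negbT: n02; rewrite /h /compl_rel d02 negbK.
- have : [|| ~~ h w c0 && ~~ h w c1, ~~ h w c1 && ~~ h w c2, ~~ h w c2 && ~~ h w c3,
     ~~ h w c3 && ~~ h w c4, ~~ h w c4 && ~~ h w c5, ~~ h w c5 && ~~ h w c6 | ~~ h w c6 && ~~ h w c0].
    have := ind _ _ m0 m1 h01; have := ind _ _ m1 m2 h12; have := ind _ _ m2 m3 h23.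
    have := ind _ _ m3 m4 h34; have := ind _ _ m4 m5 h45; have := ind _ _ m5 m6 h56; have := ind _ _ m6 m0 h60.
    rewrite /=; clear.
    by case: (h w c0) (h w c1) (h w c2) (h w c3) (h w c4) (h w c5) (h w c6) => [] [] [] [] [] [] [].
  case/or4P=> [| | |/or4P[]]; [exact: (pair _ _ m0 m1 h01)|exact: (pair _ _ m1 m2 h12)|exact: (pair _ _ m2 m3 h23)|
    exact: (pair _ _ m3 m4 h34)|exact: (pair _ _ m4 m5 h45)|exact: (pair _ _ m5 m6 h56)|exact: (pair _ _ m6 m0 h60)].
- have irr z : h z z = false by rewrite /h /compl_rel eqxx.
  rewrite !big_cons !big_nil /= !irr [h c3 c1]hC n13 [h c4 c1]hC n14 [h c1 c5]hC n51 [h c1 c6]hC n61.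
  rewrite [h c4 c3]hC h34 [h c5 c3]hC n35 [h c6 c3]hC n36 [h c5 c4]hC h45 [h c6 c4]hC n46 [h c6 c5]hC h56.
  by rewrite n03 [h c0 c4]hC n40 [h c0 c5]hC n50 [h c2 c6]hC n62 !andbF /=; case: (_ && _).
Qed.

(** A repeated vertex splits a closed odd walk into two closed walks, one of them odd. Without
    repetition the length is 1, 3, 5 or 7, and each is excluded. *)
Lemma odd_walk z s : {subset s <= N} -> path h z s -> last z s = z -> odd (size s) -> False.
Proof.
have [n] := ubnP (size s); elim: n z s => // n IH z s sn sN ps ls os.
have [us|/split_repeat[v [s1 [s2 [s3 e]]]]] := boolP (uniq s); last first.
  move: ps ls os sn sN; rewrite e cat_path /= cat_path last_cat /= last_cat /=.
  move=> /and3P[p1 hv /and3P[p2 hv' p3]] l3 os sn sN.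
  have sz : size (s1 ++ v :: s2 ++ v :: s3) = size (rcons s2 v) + size (s1 ++ v :: s3).
    by rewrite !size_cat /= size_cat size_rcons /=; clear; lia.
  rewrite sz oddD in os.
  have [o2|o2] := boolP (odd (size (rcons s2 v))).
    apply: (IH v (rcons s2 v)) => //.
    - by move: sn; rewrite sz size_cat /=; clear; lia.
    - move=> t; rewrite mem_rcons inE => ts; apply: sN; rewrite mem_cat inE mem_cat inE.
      by case/orP: ts => [->|->]; rewrite ?orbT.
    - by rewrite rcons_path p2.
    - by rewrite last_rcons.
  rewrite (negPf o2) /= in os; apply: (IH z (s1 ++ v :: s3)) => //.
  - by move: sn; rewrite sz size_rcons; clear; lia.
  - move=> t; rewrite mem_cat inE => ts; apply: sN; rewrite mem_cat inE mem_cat inE.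
    by case/or3P: ts => [->|->|->]; rewrite ?orbT.
  - by rewrite cat_path p1 /= hv.
  - by rewrite last_cat.
have s8 : size s <= 8.
  rewrite -x8 -(card_uniqP us); apply: subset_leq_card; apply/subsetP => t; exact: sN.
move: ps ls us sN os s8 {sn IH}.
case: s => [|c0 [|c1 [|c2 [|c3 [|c4 [|c5 [|c6 [|c7 [|]]]]]]]]] //=.
- by move=> /andP[+ _] e; rewrite e /h /compl_rel eqxx.
- move=> /and4P[h0 h1 h2 _] e _ sN _ _; rewrite -e in h0.
  by apply: (nonadj_free _ _ _ h1 h2); rewrite 1?hC // sN // !inE eqxx ?orbT.
- move=> /and5P[h0 h1 h2 h3 /andP[h4 _]] e us sN _ _; rewrite -e in h0.
  exact: (five_cycle us sN h1 h2 h3 h4 h0).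
- move=> /and5P[h0 h1 h2 h3 /and4P[h4 h5 h6 _]] e us sN _ _; rewrite -e in h0.
  exact: (seven_cycle us sN h1 h2 h3 h4 h5 h6 h0).
Qed.

Lemma two_cliques : exists A : {set G}, [/\ A \subset N, clique A & clique (N :\: A)].
Proof.
pose e0 : rel G := fun u v => [&& u \in N, v \in N & h u v].
(* Bipartite double cover of the complement on [N]. Since no closed walk is odd, [(v, false)] and
   [(v, true)] are never connected, and the parity relative to a root of each component yields the
   two sides. *)
pose e : rel (G * bool) := fun p q => e0 p.1 q.1 && (p.2 != q.2).
have e0C : symmetric e0 by move=> u v; rewrite /e0 hC; case: (u \in N); case: (v \in N).
have eC : symmetric e by move=> p q; rewrite /e e0C eq_sym.
have cs0 := sym_connect_sym e0C; have cs := sym_connect_sym eC.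
have odd_false v : connect e (v, false) (v, true) -> False.
  case/connectP => p pp lp; apply: (@odd_walk v (map fst p)).
  - move=> t /mapP[q qp ->] {lp}; elim: p (v, false) pp qp => //= a p IHp b /andP[eb pp].
    rewrite inE => /orP[/eqP->|]; last exact: IHp pp.
    by case/andP: eb => /and3P[].
  - have : forall b, path e b p -> path h b.1 (map fst p).
      by elim: p {pp lp} => //= a p IHp b /andP[/andP[/and3P[_ _ ->] _] /IHp->].
    by move/(_ _ pp).
  - by rewrite (last_map fst p (v, false)) -lp.
  - rewrite size_map; have par : forall b, path e b p -> (last b p).2 = b.2 (+) odd (size p).
      elim: p {pp lp} => [|a p IHp] b /=; first by rewrite addbF.
      move=> /andP[/andP[_ ab] pa]; rewrite (IHp a pa) addbN -addNb; congr (_ (+) _).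
      by move: ab; case: a.2 b.2 => [] [].
    by have := par _ pp; rewrite -lp /= => <-.
have lift u v : connect e0 u v -> exists b, connect e (u, false) (v, b).
  case/connectP => p; elim/last_ind: p v => [|p w IHp] v; first by move=> _ ->; exists false.
  rewrite rcons_path last_rcons => /andP[pp ew] ->; have [b cb] := IHp _ pp erefl.
  exists (~~ b); apply: connect_trans cb (connect1 _).
  by rewrite /e ew /=; case: b.
pose r v := fingraph.root e0 v.
pose A := [set v in N | connect e (r v, false) (v, false)].
have rr u v : u \in N -> v \in N -> h u v -> r u = r v.
  by move=> uN vN uv; apply/eqP; rewrite root_connect //; apply: connect1; rewrite /e0 uN vN.
have step u v b : u \in N -> v \in N -> h u v -> connect e (u, b) (v, ~~ b).
  by move=> uN vN uv; apply: connect1; rewrite /e /e0 uN vN uv; case: b.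
exists A; split.
- by apply/subsetP => v; rewrite in_set => /andP[].
- move=> u v; rewrite ![_ \in A]in_set => /andP[uN cu] /andP[vN cv] uv; apply: contraT => nuv; exfalso.
  have huv : h u v by rewrite /h /compl_rel uv.
  apply: (odd_false v); apply: (@connect_trans _ e (r v, false)); first by rewrite cs.
  rewrite -(rr u v) //; exact: connect_trans cu (step u v false uN vN huv).
- have oddB u : u \in N -> u \notin A -> connect e (r u, false) (u, true).
    move=> uN; rewrite [u \in A]in_set uN /= => nu; have [|b] := lift (r u) u; first by rewrite cs0 connect_root.
    by case: b => // h'; rewrite h' in nu.
  move=> u v; rewrite !in_setD => /andP[uA uN] /andP[vA vN] uv; apply: contraT => nuv; exfalso.
  have huv : h u v by rewrite /h /compl_rel uv.
  case/negP: vA; rewrite [v \in A]in_set vN -(rr u v) //=.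
  exact: connect_trans (oddB u uN uA) (step u v true uN vN huv).
Qed.
End OddCycles.

(** * Rails between cliques *)

Definition nad (G : sgraph) (X Y : {set G}) := (X != Y) && ~~ adjs X Y.

Lemma nad_sym (G : sgraph) (X Y : {set G}) : nad X Y = nad Y X.
Proof. by rewrite /nad eq_sym adjs_sym. Qed.

Lemma hasK_list (G : sgraph) (r : seq {set G}) : size r = 8 -> (forall X, X \in r -> conn X) ->
  pairwise (fun X Y : {set G} => [disjoint X & Y]) r ->
  \sum_(X <- r) \sum_(Y <- r) (nad X Y : nat) <= 8 -> hasK G.
Proof.
move=> r8 cr dr le; pose m (i : 'I_8) := nth set0 r i.
have mr i : m i \in r by rewrite mem_nth // r8.
have dm i j : i != j -> [disjoint m i & m j].
  move: dr => /(pairwiseP set0) dr; rewrite neq_ltn => /orP[] lt.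
    by apply: dr; rewrite ?inE ?r8.
  by rewrite disjoint_sym; apply: dr; rewrite ?inE ?r8.
exists m; split=> //; first by move=> i; exact: cr.
have e : \sum_(X <- r) \sum_(Y <- r) (nad X Y : nat) = \sum_(i < 8) \sum_(j < 8) (nad (m i) (m j) : nat).
  rewrite (big_nth set0) r8 big_mkord; apply: eq_bigr => i _.
  by rewrite (big_nth set0) r8 big_mkord.
rewrite e in le; have all56 : \sum_(i < 8) \sum_(j < 8) (i != j : nat) = 56.
  rewrite (eq_bigr (fun=> 7)) ?sum_nat_const ?card_ord // => i _.
  transitivity #|predC1 i|; last by rewrite cardC1 card_ord.
  rewrite -sum1_card [RHS]big_mkcond.
  by apply: eq_bigr => j _; rewrite !inE eq_sym; case: eqP.
have -> : #|[set p : 'I_8 * 'I_8 | (p.1 != p.2) && adjs (m p.1) (m p.2)]| =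
    \sum_(i < 8) \sum_(j < 8) ((i != j) && adjs (m i) (m j) : nat).
  rewrite pair_bigA -sum1_card big_mkcond /=; apply: eq_bigr => p _.
  by rewrite inE; case: (_ && _).
have : \sum_(i < 8) \sum_(j < 8) (i != j : nat) <= \sum_(i < 8) \sum_(j < 8) ((i != j) && adjs (m i) (m j) : nat) +
    \sum_(i < 8) \sum_(j < 8) (nad (m i) (m j) : nat).
  rewrite -big_split; apply: leq_sum => i _; rewrite -big_split; apply: leq_sum => j _ /=.
  have [//|ij /=] := eqVneq i j; have [//|na] := boolP (adjs (m i) (m j)).
  rewrite /nad na andbT; suff -> : m i != m j by [].
  apply/eqP => em; have := dm i j ij; rewrite em -setI_eq0 setIid.
  by case: (cr _ (mr j)) => /negPf->.
by rewrite all56; move: le; clear; lia.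
Qed.

Section Rails.
Variable G : sgraph.
Hypothesis cG : critical G.
Implicit Types (A B L Q S U : {set G}) (x y z : G).

(** By [clique_sep] the vertices outside [Q] form a connected set, and each vertex of [Q] has a
    neighbour there by its degree; contracting that set completes a [K_8]. *)
Lemma no_K7 Q : clique Q -> #|Q| = 7 -> False.
Proof.
move=> cQ Q7; case: (cG) => nK _ _; apply: nK.
have out v : v \in Q -> exists2 w, w \notin Q & v -- w.
  move=> vQ; have : ~~ (nbr v \subset Q :\ v).
    apply/negP => /subset_leq_card; have := cardsD1 v Q; rewrite vQ Q7 add1n => -[<-].
    by have := degree_ge8 cG v; case: #|nbr v| => [|[|[|[|[|[|[|]]]]]]].
  case/subsetPn => w; rewrite inE => vw; rewrite in_setD1 negb_and negbK eq_sym => /orP[/eqP e|wQ].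
    by rewrite e adj_irrefl in vw.
  by exists w.
have [v vQ] : exists v, v \in Q by apply/card_gt0P; rewrite Q7.
have [z zQ _] := out v vQ.
apply: (@hasK_add_set _ Q (~: Q)) => //.
- suff -> : ~: Q = component (~: Q) z by exact: component_conn.
  apply/eqP; rewrite eqEsubset; apply/andP; split; last by apply: component_sub; rewrite in_setC.
  by apply/subsetP => t; rewrite in_setC; exact: clique_sep.
- by rewrite -setI_eq0 setICr.
- rewrite msum_clique // [X in 2 * X](_ : _ = 0) //; apply/eqP; rewrite cards_eq0 -subset0.
  apply/subsetP => u; rewrite in_set => /andP[uQ] /negP[]; have [w wQ uw] := out u uQ.
  by rewrite adjs1; apply/existsP; exists w; rewrite in_setC wQ.
Qed.

Definition halves x A B := [/\ A :|: B = nbr x, [disjoint A & B], clique A & clique B].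

Lemma halves_sym x A B : halves x A B -> halves x B A.
Proof. by case=> e d cA cB; split=> //; rewrite 1?setUC // disjoint_sym. Qed.

Lemma cn_clique_half x A B : halves x A B -> clique (x |: A).
Proof.
case=> e _ cA _; have xA u : u \in A -> x -- u by move=> uA; rewrite -nbrE -e in_setU uA.
move=> u v /setU1P[->|uA] /setU1P[->|vA]; rewrite ?eqxx // => uv.
- exact: xA.
- by rewrite adj_sym; exact: xA.
- exact: cA.
Qed.

Lemma half_le5 x A B : halves x A B -> #|A| <= 5.
Proof.
move=> hx; rewrite leqNgt; apply/negP => A6; have := cn_clique_half hx.
have xA : x \notin A by case: hx => e _ _ _; apply/negP => xA; have := nbr_irr x; rewrite -e in_setU xA.
have [|Q _ [QA Q7]] := @exists_subset_card _ set0 (x |: A) 7 (sub0set _).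
  by rewrite cards0 cardsU1 xA.
by move=> c; exact: no_K7 (clique_sub QA c) Q7.
Qed.

Lemma halves_exist x : #|nbr x| = 8 -> exists A B, halves x A B /\
  ((#|A| = 4 /\ #|B| = 4) \/ (#|A| = 3 /\ #|B| = 5)).
Proof.
move=> x8; have [A [AN cA cB]] := two_cliques cG x8.
have hx : halves x A (nbr x :\: A).
  split=> //; first by apply/setP => v; rewrite in_setU in_setD; have [/(subsetP AN)->|] := boolP (v \in A).
  by apply/pred0P => v; rewrite /= in_setD; case: (v \in A).
have a5 := half_le5 hx; have b5 := half_le5 (halves_sym hx).
have s : #|A| + #|nbr x :\: A| = 8 by rewrite -x8 -(cardsID A (nbr x)) (setIidPr AN).
have : [\/ #|A| = 4 /\ #|nbr x :\: A| = 4, #|A| = 3 /\ #|nbr x :\: A| = 5 | #|nbr x :\: A| = 3 /\ #|A| = 5].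
  move: a5 b5 s; clear; move: #|A| #|_ :\: _| => a b; move=> h1 h2 h3.
  have : a = 3 \/ a = 4 \/ a = 5 by lia.
  by case=> [?|[?|?]]; subst; [constructor 2|constructor 1|constructor 3]; lia.
case=> h; [exists A, (nbr x :\: A)|exists A, (nbr x :\: A)|exists (nbr x :\: A), A].
- by split=> //; left.
- by split=> //; right.
- by split; [exact: halves_sym|right].
Qed.

Lemma no_twin (x y : G) : x != y -> ~~ (x -- y) -> nbr y \subset nbr x -> False.
Proof.
move=> xy nxy /subsetP sub; have [|c pc] := @colour_sub G cG [set~ y].
  by rewrite cardsC1; have := card_ge8 cG; case: #|G|.
apply: (@not_proper _ cG (fun v => if v == y then c x else c v)) => u v _ _ uv.
have key w : y -- w -> c x != c w.
  move=> yw; apply: pc; rewrite ?inE //; first by rewrite eq_sym adj_neq.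
  by have := sub w; rewrite !inE; apply.
have [e|uy] := eqVneq u y; have [e'|vy] := eqVneq v y.
- by rewrite e e' adj_irrefl in uv.
- by apply: key; rewrite -e.
- by rewrite eq_sym; apply: key; rewrite -e' adj_sym.
- by apply: pc; rewrite ?inE.
Qed.

(** The bound 3 leaves two vertices of [L] outside either side, as needed for two disjoint paths to
    one side that avoid the other. *)
Definition third_clique x A B L :=
  [/\ #|L| = 5, clique L, x \notin L, #|L :&: A| <= 3 & #|L :&: B| <= 3].

Lemma disjoint_card A B Q : [disjoint A & B] -> #|Q :&: A| + #|Q :&: B| <= #|Q|.
Proof.
move=> d; rewrite -card_disjU.
  by apply: subset_leq_card; rewrite -setIUr subsetIl.
by apply: disjointWl (disjointWr _ d); exact: subsetIr.
Qed.

(** [y |: B'] is a clique on six vertices, and [y] lies in neither side of [x]. If a side contains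
    four vertices of [B'], one of them is traded for [y]. *)
Lemma third_from_five x A B y A' B' : halves x A B -> halves y A' B' -> x != y -> ~~ (x -- y) ->
  #|B'| = 5 -> #|B' :&: A| <= 4 -> #|B' :&: B| <= 4 -> exists L, third_clique x A B L.
Proof.
move=> hx hy xy nxy B5 iA iB; have cC := cn_clique_half (halves_sym hy).
have [e d _ _] := hx; have [e' d' _ cB'] := hy.
have yB : y \notin B' by apply/negP => yB; have := nbr_irr y; rewrite -e' in_setU yB orbT.
have xC : x \notin y |: B'.
  rewrite in_setU1 negb_or xy; apply: contra nxy => xB.
  by rewrite adj_sym -nbrE -e' in_setU xB orbT.
have yN : y \notin A :|: B by rewrite e nbrE.
have [yA yBB] : y \notin A /\ y \notin B by move: yN; rewrite in_setU negb_or => /andP.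
have sm := disjoint_card B' d; rewrite B5 in sm.
have swap t Q : t \in B' -> t \in Q -> y \notin Q -> #|B' :&: Q| <= 4 -> #|((y |: B') :\ t) :&: Q| <= 3.
  move=> tB tQ yQ le; have -> : ((y |: B') :\ t) :&: Q = (B' :&: Q) :\ t.
    by apply/setP => v; rewrite !inE; case: (v =P y) => [->|]; rewrite ?(negPf yQ) ?andbF //= andbA.
  by move: le; rewrite (cardsD1 t (B' :&: Q)) in_setI tB tQ.
have mk t : t \in B' -> #|((y |: B') :\ t) :&: A| <= 3 -> #|((y |: B') :\ t) :&: B| <= 3 ->
    exists L, third_clique x A B L.
  move=> tB h1 h2; exists ((y |: B') :\ t); split=> //.
  - have := cardsD1 t (y |: B'); rewrite in_setU1 tB orbT cardsU1 yB B5 !add1n => -[<-] //.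
  - by apply: clique_sub cC; exact: subsetDl.
  - by rewrite in_setD1 negb_and xC orbT.
have other t Q : t \in B' -> y \notin Q -> #|B' :&: Q| <= 1 -> #|((y |: B') :\ t) :&: Q| <= 3.
  move=> tB yQ le; apply: leq_trans (_ : _ <= 1) _ => //; apply: leq_trans le; apply: subset_leq_card.
  apply/subsetP => v; rewrite in_setI in_setD1 => /andP[/andP[_ /setU1P[->|vB]] vQ].
    by rewrite vQ in yQ.
  by rewrite in_setI vB.
have [A3|A4] := leqP #|B' :&: A| 3; last first.
  have [t /setIP[tB tA]] : exists t, t \in B' :&: A by apply/card_gt0P; move: A4; clear; lia.
  apply: (mk t) => //; first exact: swap.
  by apply: other => //; move: sm A4; clear; lia.
have [B3|B4] := leqP #|B' :&: B| 3; last first.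
  have [t /setIP[tB tA]] : exists t, t \in B' :&: B by apply/card_gt0P; move: B4; clear; lia.
  apply: (mk t) => //; last exact: swap.
  by apply: other => //; move: sm B4; clear; lia.
exists B'; split=> //; by move: xC; rewrite in_setU1 negb_or => /andP[].
Qed.

(** A side of [y] other than [A] and [B], together with [y], is the clique. If both sides of [y]
    were among [A] and [B], then [x] and [y] would have the same neighbours, against [no_twin]. *)
Lemma third_from_four x A B y A' B' : halves x A B -> halves y A' B' -> x != y -> ~~ (x -- y) ->
  #|A| = 4 -> #|B| = 4 -> #|A'| = 4 -> #|B'| = 4 -> exists L, third_clique x A B L.
Proof.
move=> hx hy xy nxy A4 B4 A'4 B'4.
have [e d _ _] := hx; have [e' d' _ _] := hy.
have [yA yB] : y \notin A /\ y \notin B.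
  by apply/andP; rewrite -negb_or -in_setU e nbrE.
have mk A0 B0 : halves y A0 B0 -> #|A0| = 4 -> A0 != A -> A0 != B -> exists L, third_clique x A B L.
  move=> h0 A04 nA nB; have [e0 _ _ _] := h0.
  have sml Q : #|Q| = 4 -> A0 != Q -> y \notin Q -> #|(y |: A0) :&: Q| <= 3.
    move=> Q4 ne yQ; have -> : (y |: A0) :&: Q = A0 :&: Q.
      by apply/setP => v; rewrite !inE; case: (v =P y) => // ->; rewrite (negPf yQ) !andbF.
    rewrite -ltnS -[X in _ < X]A04 ltn_neqAle subset_leq_card ?subsetIl // andbT.
    apply: contra ne => /eqP ec; have /eqP e1 : A0 :&: Q == A0 by rewrite eqEcard subsetIl ec leqnn.
    by rewrite eqEcard Q4 A04 leqnn andbT; apply/setIidPl.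
  exists (y |: A0); split; rewrite ?sml //.
  - rewrite cardsU1 A04; suff -> : y \notin A0 by [].
    by apply/negP => yA0; have := nbr_irr y; rewrite -e0 in_setU yA0.
  - exact: cn_clique_half h0.
  - rewrite in_setU1 negb_or xy; apply: contra nxy => xA.
    by rewrite adj_sym -nbrE -e0 in_setU xA.
have [/andP[nA nB]|] := boolP ((A' != A) && (A' != B)); first exact: mk hy A'4 nA nB.
have [/andP[nA nB] _|] := boolP ((B' != A) && (B' != B)); first exact: mk (halves_sym hy) B'4 nA nB.
rewrite !negb_and !negbK => hB hA; exfalso; apply: (no_twin xy nxy); rewrite -e -e'.
have eqd (C : {set G}) : A' = C -> B' = C -> False.
  by move=> e1 e2; move: d'; rewrite e1 e2 -setI_eq0 setIid -cards_eq0 -e1 A'4.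
case/orP: hA => /eqP hA; case/orP: hB => /eqP hB; rewrite hA hB ?subxx //.
- by case: (eqd A).
- by rewrite setUC.
- by case: (eqd B).
Qed.

(** Take [x], [y], [z] of degree 8 with [y] and [z] not adjacent to [x]. The preceding two lemmas
    settle everything except one 5-clique [B] that is a side of all three; then [B] with [x], [y],
    [z] misses at most three pairs and is the minor itself. *)
Lemma third_exists : exists x A B L, [/\ halves x A B, (#|A| = 4 /\ #|B| = 4) \/ (#|A| = 3 /\ #|B| = 5) &
  third_clique x A B L].
Proof.
have low := card_low cG; set D := [set x | _] in low.
have D8 v : v \in D -> #|nbr v| = 8 by rewrite inE => /eqP.
have pick (E : {set G}) : #|E| <= 24 -> exists2 v, v \in D & v \notin E.
  move=> E24; apply/subsetPn; apply: contraL low => /subset_leq_card le.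
  by rewrite -leqNgt (leq_trans le).
have [x xD _] := pick set0 (ltac:(by rewrite cards0)).
have [y yD yx] := pick (cn x) (ltac:(by rewrite card_cn D8)).
have [z zD zxy] := pick (y |: cn x) (ltac:(by rewrite cardsU1 card_cn D8 //; case: (_ \notin _))).
have nonadj_of w : w \notin cn x -> x != w /\ ~~ (x -- w).
  by rewrite cnE negb_or eq_sym => /andP.
have [xy nxy] := nonadj_of y yx.
have [zy zx] : z != y /\ z \notin cn x by apply/andP; rewrite -negb_or -in_setU1.
have [xz nxz] := nonadj_of z zx.
have [A [B [hx tx]]] := halves_exist (D8 _ xD).
have [A' [B' [hy ty]]] := halves_exist (D8 _ yD).
have [A2 [B2 [hz tz]]] := halves_exist (D8 _ zD).
have small (Q C : {set G}) : #|Q| <= 4 -> #|C :&: Q| <= 4 by apply: leq_trans; rewrite subset_leq_card ?subsetIr.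
case: tx => [[A4 B4]|[A3 B5]].
  exists x, A, B; case: ty => [[A'4 B'4]|[A'3 B'5]].
    have [L tL] := third_from_four hx hy xy nxy A4 B4 A'4 B'4.
    by exists L; split=> //; left.
  have [||L tL] := third_from_five hx hy xy nxy B'5; try by apply: small; rewrite ?A4 ?B4.
  by exists L; split=> //; left.
have swap w Aw Bw : halves w Aw Bw -> x != w -> ~~ (x -- w) -> #|Aw| = 4 -> #|Bw| = 4 ->
    exists x A B L, [/\ halves x A B, (#|A| = 4 /\ #|B| = 4) \/ (#|A| = 3 /\ #|B| = 5) & third_clique x A B L].
  move=> hw xw nxw Aw4 Bw4; exists w, Aw, Bw.
  rewrite eq_sym in xw; rewrite adj_sym in nxw.
  have [||L tL] := third_from_five hw hx xw nxw B5; try by apply: small; rewrite ?Aw4 ?Bw4.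
  by exists L; split=> //; left.
have five w Aw Bw : halves w Aw Bw -> x != w -> ~~ (x -- w) -> #|Bw| = 5 -> Bw != B ->
    exists x A B L, [/\ halves x A B, (#|A| = 4 /\ #|B| = 4) \/ (#|A| = 3 /\ #|B| = 5) & third_clique x A B L].
  move=> hw xw nxw Bw5 ne; exists x, A, B.
  have [||L tL] := third_from_five hx hw xw nxw Bw5; first by apply: small; rewrite A3.
    rewrite -ltnS -[X in _ < X]Bw5 ltn_neqAle subset_leq_card ?subsetIl // andbT.
    apply: contra ne => /eqP ec; have /eqP e1 : Bw :&: B == Bw by rewrite eqEcard subsetIl ec leqnn.
    by rewrite eqEcard B5 Bw5 leqnn andbT; apply/setIidPl.
  by exists L; split=> //; right.
case: ty => [[A'4 B'4]|[A'3 B'5]]; first exact: swap hy xy nxy A'4 B'4.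
case: tz => [[A24 B24]|[A23 B25]]; first exact: swap hz xz nxz A24 B24.
have [eB|] := eqVneq B' B; last exact: five hy xy nxy B'5.
have [eB2|] := eqVneq B2 B; last exact: five hz xz nxz B25.
case: (cG) => nK _ _; exfalso; apply: nK; rewrite eB in hy; rewrite eB2 in hz.
have nB w Aw : halves w Aw B -> w \notin B.
  by move=> [e _ _ _]; apply/negP => wB; have := nbr_irr w; rewrite -e in_setU wB orbT.
have adjB w Aw v : halves w Aw B -> v \in B -> w -- v.
  by move=> [e _ _ _] vB; rewrite -nbrE -e in_setU vB orbT.
have xB := nB _ _ hx; have yB := nB _ _ hy; have zB := nB _ _ hz.
apply: (@hasK_direct _ (x |: (y |: (z |: B)))).
  rewrite cardsU1 !in_setU1 !negb_or xy xz xB cardsU1 in_setU1 negb_or yB eq_sym zy.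
  by rewrite cardsU1 zB B5.
have mB : msum B = 0 by apply: msum_clique; case: hx.
have none w Aw : halves w Aw B -> non w :&: B = set0.
  move=> hw; apply/eqP; rewrite -subset0; apply/subsetP => v; rewrite in_setI nonE => /andP[/andP[_ nwv] vB].
  by rewrite (adjB _ _ _ hw vB) in nwv.
have m1 (w : G) Q : w \notin Q -> msum (w |: Q) = msum Q + 2 * #|non w :&: Q|.
  move=> wQ; rewrite (msumD1 (setU11 w Q)) setU1K //; congr (_ + 2 * #|pred_of_set _|).
  apply/setP => v; rewrite !in_setI in_setU1; case: (v =P w) => [->|] //.
  by rewrite nonE eqxx.
have le (w : G) Aw Q : halves w Aw B -> #|non w :&: (Q :|: B)| <= #|Q|.
  move=> hw; rewrite setIUr (none _ _ hw) setU0; apply: subset_leq_card; exact: subsetIr.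
rewrite m1; last by rewrite !in_setU1 !negb_or xy xz.
rewrite m1; last by rewrite in_setU1 negb_or eq_sym zy.
rewrite m1 // mB (none _ _ hz) cards0.
have l1 := le x A [set y; z] hx; have l2 := le y A' [set z] hy.
rewrite cards2 eq_sym zy -setUA in l1; rewrite cards1 in l2.
by move: l1 l2; clear; lia.
Qed.
End Rails.

Section Linkages.
Variable G : sgraph.
Implicit Types (U A B S : {set G}) (p q : G * seq G) (ps : seq (G * seq G)).

Lemma target_verts p : target p \in verts p.
Proof. exact: mem_last. Qed.

Lemma linkage_target_uniq U A B ps : linkage U A B ps -> uniq (map (@target G) ps).
Proof.
case/andP=> _; elim: ps => //= p ps IH; rewrite -[_ && _]/(uniq (verts p ++ _)) cat_uniq.
case/and3P=> _ /hasPn d /IH->; rewrite andbT; apply/mapP => -[q qps e].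
have /d/negP[] : target q \in flatten (map (@verts G) ps).
  by apply/flattenP; exists (verts q); rewrite ?map_f ?target_verts.
by rewrite /= -e target_verts.
Qed.

Lemma linkage_disjoint U A B ps p q v : linkage U A B ps -> p \in ps -> q \in ps ->
  v \in verts p -> v \in verts q -> p = q.
Proof.
case/andP=> _ u pps qps vp vq; apply/eqP; apply: contraT => ne.
have pm := perm_to_rem pps; have qps' : q \in rem p ps.
  by have := perm_mem pm q; rewrite qps inE eq_sym (negPf ne).
move: u; rewrite (perm_uniq (perm_flatten (perm_map (@verts G) pm))) /=.
rewrite -[_ && _]/(uniq (verts p ++ _)) cat_uniq => /and3P[_ /hasPn d _].
have /d/negP[] : v \in flatten (map (@verts G) (rem p ps)) by apply/flattenP; exists (verts q); rewrite ?map_f.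
by [].
Qed.

Lemma linkage_uniq U A B ps : linkage U A B ps -> uniq ps.
Proof. by move/linkage_target_uniq/map_uniq. Qed.

(** The easy half of Menger's theorem: one linkage certifies the hypothesis needed to augment
    another. *)
Lemma linkage_avoid U A B ps S : linkage U A B ps -> #|S| < size ps ->
  exists p, link U A B p /\ ~~ has (mem S) (verts p).
Proof.
move=> lps lt; have [/hasP[p pps np]|all] := boolP (has (fun p => ~~ has (mem S) (verts p)) ps).
  by exists p; split=> //; have /andP[/allP ok _] := lps; exact: ok.
exfalso; have {}all p : p \in ps -> exists2 v, v \in S & v \in verts p.
  by move=> pps; have /hasPn/(_ p pps) := all; rewrite negbK => /hasP[v vp vS]; exists v.
have : size ps <= #|S|; last by rewrite leqNgt lt.
pose f p := if [pick v in S | v \in verts p] is Some v then v else p.1.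
have fP p : p \in ps -> f p \in S /\ f p \in verts p.
  move=> pps; rewrite /f; case: pickP => [v /andP[]//|no].
  by have [v vS vp] := all p pps; have := no v; rewrite vS vp.
have uf : uniq (map f ps).
  rewrite map_inj_in_uniq; first exact: linkage_uniq lps.
  move=> p q pps qps e; have [_ fp] := fP p pps; have [_ fq] := fP q qps.
  by apply: (linkage_disjoint lps pps qps fp); rewrite e.
rewrite -(size_map f) -(card_uniqP uf); apply: subset_leq_card; apply/subsetP => v.
by case/mapP => p /fP[fS _] ->.
Qed.

Lemma link_mono U U' A B B' p : link U A B p -> {subset verts p <= U'} -> target p \in B' ->
  {in belast p.1 p.2, forall v, v \notin B'} -> link U' A B' p.
Proof.
move=> /andP[pA /and5P[h1 _ _ _ h5]] hU hB hn; apply/andP; split=> //; apply/and5P; split=> //.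
  by apply/allP => v; exact: hU.
by apply/allP => v /hn.
Qed.

Lemma belast_verts p v : v \in belast p.1 p.2 -> v \in verts p.
Proof. by move=> h; rewrite /verts lastI mem_rcons inE h orbT. Qed.

Lemma verts_split p v : v \in verts p -> v = target p \/ v \in belast p.1 p.2.
Proof. by rewrite /verts lastI mem_rcons inE => /orP[/eqP|]; [left|right]. Qed.

Lemma linkage_sub U U' A B B' ps : linkage U A B ps -> {in ps, forall p, link U' A B' p} ->
  linkage U' A B' ps.
Proof. by case/andP=> _ u h; rewrite /linkage u andbT; apply/allP. Qed.

Definition path_rev p : G * seq G := (target p, rev (belast p.1 p.2)).

Lemma verts_rev p : verts (path_rev p) = rev (verts p).
Proof. by rewrite /verts /path_rev /= [in RHS]lastI rev_rcons. Qed.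

Lemma target_rev p : target (path_rev p) = p.1.
Proof.
rewrite /path_rev /target /=; case: p => a s /=; rewrite -[LHS](last_cons a).
by rewrite -rev_rcons -lastI rev_cons last_rcons.
Qed.

Lemma belast_rev p : belast (path_rev p).1 (path_rev p).2 = rev p.2.
Proof.
have := lastI (path_rev p).1 (path_rev p).2.
rewrite -/(target (path_rev p)) target_rev -/(verts (path_rev p)) verts_rev /verts rev_cons.
by move/rcons_inj => [].
Qed.

Lemma path_of_rev p : path (@adj G) p.1 p.2 -> path (@adj G) (path_rev p).1 (path_rev p).2.
Proof.
move=> h; rewrite /path_rev /= rev_path; apply: sub_path h => u v /=.
by rewrite adj_sym.
Qed.
End Linkages.

(** * Five disjoint rails with balanced ends *)

Section Final.
Variable G : sgraph.
Hypothesis cG : critical G.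
Implicit Types (A B L Q S U : {set G}) (x y z v : G).

Lemma half_nbr x A B v : halves x A B -> v \in A -> x -- v.
Proof. by case=> e _ _ _ vA; rewrite -nbrE -e in_setU vA. Qed.

Lemma half_self x A B : halves x A B -> x \notin A.
Proof. by move=> hx; apply/negP => /(half_nbr hx); rewrite adj_irrefl. Qed.

Lemma conn_nbr (D : {set G}) x l : conn D -> x \in D -> l \in D -> l != x -> exists2 v, v \in D & x -- v.
Proof.
move=> [_ cut] xD lD lx; case: (cut [set x]) => [||u [v [/setIP[_ /set1P->] /setDP[vD _] xv]]].
- by apply/set0Pn; exists x; rewrite in_setI xD set11.
- by apply/set0Pn; exists l; rewrite in_setD in_set1 lx.
- by exists v.
Qed.

(** Otherwise a single vertex [v] would separate [L] from [A] outside [B]. But [near_clique_sep]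
    keeps the graph connected without [v |: B], and [L] has a vertex there. From it [x] is reached,
    hence a neighbour of [x] in [A]; if [v] is [x], a vertex of [A] is reached directly. *)
Lemma two_links x A B L : halves x A B -> 1 < #|A| -> #|L| = 5 -> x \notin L -> #|L :&: B| <= 3 ->
  exists ps, linkage (~: B) L A ps /\ size ps = 2.
Proof.
move=> hx A2 L5 xL LB; have [e d cA cB] := hx.
have [||S S2|ps [lps sz _]] := @augment_to G 2 (~: B) L A [::] => //; last by exists ps.
apply: unsep_link; apply/negP => sS.
have [v [Sv Sx]] : exists v, S \subset [set v] /\ (v = x \/ v != x).
  have [S0|[v vS]] := set_0Vmem S; first by exists x; rewrite S0 sub0set; split=> //; left.
  exists v; split; last by have [->|] := eqVneq v x; [left|right].
  have /cards1P[w ew] : #|S| == 1 by rewrite eqn_leq -ltnS S2 card_gt0; apply/set0Pn; exists v.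
  by move: vS; rewrite ew => /set1P->.
have [z zL] : exists2 z, z \in L & z \notin v |: B.
  have : ~~ (L \subset v |: (L :&: B)).
    apply/negP => /subset_leq_card; rewrite L5 cardsU1; move: LB; case: (v \notin _); clear; lia.
  by case/subsetPn => z zL; rewrite in_setU1 in_setI zL => h; exists z; rewrite // in_setU1.
move=> zvB; have zC : z \in ~: (v |: B) by rewrite in_setC.
pose C := component (~: (v |: B)) z.
have CvB : C \subset ~: (v |: B) := component_sub zC.
have fin : C :&: A != set0 -> False.
  move=> CA; apply: (sepP sS (component_conn (~: (v |: B)) z)) => //.
  - by apply: subset_trans CvB _; rewrite setCS subsetUr.
  - apply: disjointWr Sv _; rewrite disjoint_sym disjoints1; apply/negP => /(subsetP CvB).
    by rewrite in_setC setU11.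
  - by apply/set0Pn; exists z; rewrite in_setI component_self.
case: Sx => [vx|vx].
  have [p pA] : exists p, p \in A by apply/card_gt0P; exact: ltnW.
  have pB : p \notin B by rewrite (disjointFr d).
  apply: fin; apply/set0Pn; exists p; rewrite in_setI pA andbT.
  apply: near_clique_sep => //; rewrite in_setU1 negb_or pB andbT vx.
  by apply: contraNneq (half_self hx) => <-.
have xC : x \in C.
  apply: near_clique_sep => //; rewrite in_setU1 negb_or eq_sym vx.
  exact: half_self (halves_sym hx).
have zx : z != x by apply: contraNneq xL => <-.
have [w wC xw] := conn_nbr (component_conn _ _) xC (component_self _ z) zx.
apply: fin; apply/set0Pn; exists w; rewrite in_setI wC /=.
have := subsetP CvB _ wC; rewrite in_setC in_setU1 negb_or => /andP[_ wB].
by move: xw; rewrite -nbrE -e in_setU (negPf wB) orbF.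
Qed.

(** Reaching [x] means reaching a neighbour of [x], so such an [S] would also separate [L] from the
    clique [x |: B]. Both cliques have at least five vertices, so [S] cannot equal either of
    them. *)
Lemma no_small_sep x A B L S : halves x A B -> 4 <= #|B| -> #|L| = 5 -> clique L -> x \notin L -> #|S| < 5 ->
  ~~ sep setT S L (nbr x).
Proof.
move=> hx B4 L5 cL xL S5; apply/negP => sS; have [e d cA cB] := hx.
have cxB := cn_clique_half (halves_sym hx); have xB := half_self (halves_sym hx).
have xB5 : 5 <= #|x |: B| by rewrite cardsU1 xB.
have sx : sep setT S L (x |: B).
  apply/forall_inP => l; rewrite in_setD in_setI => /and3P[lS lL lT].
  set D := component _ l; have lD : l \in setT :\: S by rewrite in_setD lS.
  have DS : D \subset setT :\: S := component_sub lD.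
  apply/pred0P => b /=; apply/negP => /andP[bD bB].
  have fin v : v \in D -> v \in nbr x -> False.
    move=> vD vN; apply: (sepP sS (component_conn (setT :\: S) l)) => //.
    - by rewrite disjoint_sym -setI_eq0 -subset0; apply/subsetP => t /setIP[tS /(subsetP DS)]; rewrite in_setD tS.
    - by apply/set0Pn; exists l; rewrite in_setI component_self.
    - by apply/set0Pn; exists v; rewrite in_setI vD.
  move: bB => /setU1P[ebx|bB]; last by apply: (fin b bD); rewrite -e in_setU bB orbT.
  rewrite ebx in bD; have lx : l != x by apply: contraNneq xL => <-.
  have [w wD bw] := conn_nbr (component_conn _ _) bD (component_self _ l) lx.
  by apply: (fin w wD); rewrite nbrE.
have S5' : #|S| <= #|L| by rewrite L5 ltnW.
case: (clique_separator cG cL cxB sx S5' (leq_trans (ltnW S5) xB5)) => eS; move: S5; rewrite eS.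
  by rewrite L5.
by rewrite ltnNge xB5.
Qed.

(** At most three ends in [A] bound the defects of the final minor; the two spare vertices of [B]
    are where two further paths start. *)
Definition rails x A B L ps := [/\ linkage setT L (nbr x) ps, size ps = 5 &
  count (fun p => target p \in A) ps <= 3 /\ count (fun p => target p \in B) ps + 2 <= #|B|].

Lemma count_targets ps A : count (fun p => target p \in A) ps = count (mem A) (map (@target G) ps).
Proof. by rewrite count_map. Qed.

Lemma count_le_card ps U V A Q : linkage U V Q ps -> count (fun p => target p \in A) ps <= #|A|.
Proof.
move=> lps; rewrite count_targets -size_filter -(card_uniqP (filter_uniq _ (linkage_target_uniq lps))).
by apply: subset_leq_card; apply/subsetP => v; rewrite mem_filter => /andP[].
Qed.

Lemma count_halves x A B ps U L : halves x A B -> linkage U L (nbr x) ps ->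
  count (fun p => target p \in A) ps + count (fun p => target p \in B) ps = size ps.
Proof.
case=> e d _ _ /andP[/allP ok _]; rewrite -(count_predC (fun p => target p \in A)); congr (_ + _).
apply: eq_in_count => p pps /=; have /andP[_ /and5P[_ _ + _ _]] := ok p pps.
by rewrite -/(target p) -e in_setU; have [tA|] := boolP (target p \in A); rewrite ?(disjointFr d tA).
Qed.

Lemma count_sub ps qs A U V Q : linkage U V Q ps -> {subset map (@target G) ps <= map (@target G) qs} ->
  count (fun p => target p \in A) ps <= count (fun p => target p \in A) qs.
Proof.
move=> lps sub; rewrite !count_targets -!size_filter.
rewrite uniq_leq_size //; first exact: filter_uniq (linkage_target_uniq lps).
by move=> v; rewrite !mem_filter => /andP[-> /sub].
Qed.

(** Augmenting keeps the ends already reached, so starting from two paths into [A] secures two ends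
    there. *)
Lemma extend_rails x A B L : halves x A B -> (#|A| = 4 /\ #|B| = 4) \/ (#|A| = 3 /\ #|B| = 5) ->
  third_clique x A B L -> exists ps, [/\ linkage setT L (nbr x) ps, size ps = 5 &
    2 <= count (fun p => target p \in A) ps].
Proof.
move=> hx t [L5 cL xL LA LB]; have [e d _ _] := hx.
have A2 : 1 < #|A| by case: t => -[-> _].
have B4 : 4 <= #|B| by case: t => -[_ ->].
have [ps [lps sz]] := two_links hx A2 L5 xL LB.
have /andP[/allP ok _] := lps.
have tA p : p \in ps -> target p \in A by move=> /ok/andP[_ /and5P[]].
have lps' : linkage setT L (nbr x) ps.
  apply: (linkage_sub lps) => p pps; have lp := ok p pps.
  apply: (link_mono lp); first by move=> v; rewrite in_setT.
    by rewrite -e in_setU tA.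
  have /andP[_ /and5P[_ /allP hU _ /allP hA _]] := lp => v vb.
  have := hU v (belast_verts vb); have := hA v vb; rewrite /= inE => h1 h2.
  by rewrite -e in_setU negb_or h1.
have [|S S5|qs [lqs szq sub]] := augment_to (k := 5) lps'; first by rewrite sz.
  by apply: unsep_link; exact: no_small_sep hx B4 L5 cL xL S5.
exists qs; split=> //; apply: leq_trans (count_sub A lps' sub).
rewrite -sz -[X in X <= _]count_predT; apply: eq_leq; apply: eq_in_count => p /tA.
by rewrite /= => ->.
Qed.

(* If the rails use all of [A], they are exchanged against two rails ending in [B]: augmenting the latter
   inside the set of ends already used leaves at most three ends in [B]. *)
Lemma exchange_rails x A B L : halves x A B -> #|A| = 4 -> #|B| = 4 -> third_clique x A B L ->
  exists ps, [/\ linkage setT L (nbr x) ps, size ps = 5, 2 <= count (fun p => target p \in A) ps &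
    2 <= count (fun p => target p \in B) ps].
Proof.
move=> hx A4 B4 tc; have [L5 cL xL LA LB] := tc; have [e d _ _] := hx.
have [ps [lps sz rA]] := extend_rails hx (or_introl (conj A4 B4)) tc.
have [rB|rB] := leqP 2 (count (fun p => target p \in B) ps); first by exists ps; split.
have hy := halves_sym hx; have B2 : 1 < #|B| by rewrite B4.
have [js [ljs sj]] := two_links hy B2 L5 xL LA.
(* Only ends used by one of the two linkages stay as targets; the other neighbours of [x] are
   removed. The five rails [ps] show that fewer than five vertices do not separate [L] from [Y]. *)
pose Y := [set v in map (@target G) js ++ map (@target G) ps].
pose U := ~: (nbr x :\: Y).
have /andP[/allP okp _] := lps; have /andP[/allP okj _] := ljs.
have YN : {subset Y <= nbr x}.
  move=> v; rewrite in_set mem_cat => /orP[] /mapP[p pps ->].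
    by have /andP[_ /and5P[_ _ h _ _]] := okj p pps; rewrite -e in_setU orbC [_ \in B]h.
  by have /andP[_ /and5P[]] := okp p pps.
have ps' : linkage U L Y ps.
  apply: (linkage_sub lps) => p pps; have lp := okp p pps.
  have tY : target p \in Y by rewrite in_set mem_cat (map_f (@target G) pps) orbT.
  have /andP[_ /and5P[_ _ _ /allP hN _]] := lp.
  apply: (link_mono lp) => // v; last by move=> vb; apply: contra (hN v vb); exact: YN.
  rewrite in_setC in_setD negb_and negbK => /verts_split[->|/hN /= h]; first by rewrite tY.
  by rewrite h orbT.
have js' : linkage U L Y js.
  apply: (linkage_sub ljs) => p pps; have lp := okj p pps.
  have tY : target p \in Y by rewrite in_set mem_cat (map_f (@target G) pps).
  have /andP[_ /and5P[_ /allP hU _ /allP hB _]] := lp.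
  have hN v : v \in belast p.1 p.2 -> v \notin nbr x.
    move=> vb; have := hU v (belast_verts vb); have := hB v vb.
    by rewrite /= inE => h1 h2; rewrite -e in_setU negb_or h1 h2.
  apply: (link_mono lp) => // v; last by move=> vb; apply: contra (hN v vb); exact: YN.
  by rewrite in_setC in_setD negb_and negbK => /verts_split[->|/hN->]; rewrite ?tY ?orbT.
have [|S S5|qs [lqs szq sub]] := augment_to (k := 5) js'; first by rewrite sj.
  by apply: (linkage_avoid ps'); rewrite sz.
have /andP[/allP okq _] := lqs.
have lqs' : linkage setT L (nbr x) qs.
  apply: (linkage_sub lqs) => p pps; have lp := okq p pps.
  have /andP[_ /and5P[_ /allP hU hT /allP hY _]] := lp.
  apply: (link_mono lp); first by move=> v; rewrite in_setT.
    exact: YN hT.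
  move=> v vb; have /= vY := hY v vb; have vU : v \in U := hU v (belast_verts vb).
  by move: vU; rewrite in_setC in_setD vY.
have jB : 2 <= count (fun p => target p \in B) js.
  rewrite -sj -[X in X <= _]count_predT; apply: eq_leq; apply: eq_in_count => p pps /=.
  by have /andP[_ /and5P[_ _ h _ _]] := okj p pps; rewrite [_ \in B]h.
have cB := leq_trans jB (count_sub B js' sub).
exists qs; split=> //.
(* Ends in [B] are among the two ends of [js] and the at most one end of [ps] in [B]. *)
have le3 : count (fun p => target p \in B) qs <= 3.
  rewrite count_targets -size_filter.
  apply: (@leq_trans (size (filter (mem B) (map (@target G) js ++ map (@target G) ps)))).
    apply: uniq_leq_size; first exact: filter_uniq (linkage_target_uniq lqs).
    move=> v; rewrite !mem_filter => /andP[-> /mapP[q qqs ->]] /=.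
    by have /andP[_ /and5P[_ _ + _ _]] := okq q qqs; rewrite in_set.
  rewrite filter_cat size_cat !size_filter -!count_targets.
  apply: (@leq_trans (2 + 1)) => //; apply: leq_add => //.
  by rewrite -sj; exact: count_size.
by have := count_halves hx lqs'; rewrite szq; move: le3; clear; lia.
Qed.

(** For sides 4, 4 the ends split as 3 and 2, and the side with two ends is named [B]. For sides 3,
    5 two ends in [A] leave at most three in [B]. *)
Lemma rails_exist : exists x A B L ps, [/\ halves x A B, #|L| = 5 /\ #|B| <= 5, clique L, x \notin L & rails x A B L ps].
Proof.
have [x [A [B [L [hx t tc]]]]] := third_exists cG.
have [L5 cL xL LA LB] := tc.
case: (t) => [[A4 B4]|[A3 B5]]; last first.
  have [ps [lps sz rA]] := extend_rails hx t tc.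
  exists x, A, B, L, ps; split; rewrite ?B5 //; split=> //.
  have := count_halves hx lps; have := count_le_card A lps; rewrite A3 sz B5; move: rA; clear.
  by move: (count _ _) (count _ _) => a b; lia.
have [ps [lps sz rA rB]] := exchange_rails hx A4 B4 tc.
have s := count_halves hx lps; rewrite sz in s.
have [A3|A3] := leqP 3 (count (fun p => target p \in A) ps).
  exists x, A, B, L, ps; split; rewrite ?B4 //; split=> //.
  by rewrite B4; move: s rB A3; clear; lia.
exists x, B, A, L, ps; split; rewrite ?A4 //; first exact: halves_sym.
split=> //; rewrite A4; move: s rA A3; clear; lia.
Qed.

Lemma link_avoids x U L ps p : linkage U L (nbr x) ps -> p \in ps -> x \notin L -> x \notin verts p.
Proof.
move=> /andP[/allP ok _] pps xL; have /andP[pL /and5P[hp _ _ /allP hn _]] := ok p pps.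
apply/negP; rewrite /verts inE => /orP[/eqP e|xp]; first by rewrite e pL in xL.
move: hp hn; case/splitPr: xp => s1 s2; rewrite cat_path /= => /and3P[_ sx _] hn.
have /hn : last p.1 s1 \in belast p.1 (s1 ++ x :: s2) by rewrite belast_cat mem_cat /= mem_head orbT.
by rewrite /= nbrE adj_sym sx.
Qed.

End Final.

Lemma pairwise_uniq (T : eqType) (U : Type) (f : T -> U) (R : rel U) (s : seq T) : uniq s ->
  {in s &, forall p q, p != q -> R (f p) (f q)} -> pairwise R (map f s).
Proof.
elim: s => //= p s IH /andP[ps us] h; apply/andP; split.
  rewrite all_map; apply/allP => q qs /=; apply: h; rewrite ?inE ?eqxx ?qs ?orbT //.
  by apply: contraNneq ps => ->.
by apply: IH => // q q' qs qs'; apply: h; rewrite inE ?qs ?qs' orbT.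
Qed.

Lemma pairwise_mem (T : eqType) (R : rel T) (s : seq T) a b : symmetric R -> pairwise R s ->
  a \in s -> b \in s -> a != b -> R a b.
Proof.
move=> sR; elim: s => //= c s IH /andP[/allP cs ps]; rewrite !inE.
case/orP=> [/eqP->|as_] /orP[/eqP->|bs] ab; first by rewrite eqxx in ab.
- exact: cs.
- by rewrite sR; exact: cs.
- exact: IH.
Qed.

Lemma count_lt_size (T : eqType) (a : pred T) (s : seq T) x : x \in s -> ~~ a x -> count a s < size s.
Proof.
move=> xs nax; rewrite -(count_predC a s) -[X in X < _]addn0 ltn_add2l -has_count.
by apply/hasP; exists x.
Qed.

Lemma path_belast (T : Type) (e : rel T) x y s : path e x (y :: s) -> path e x (belast y s).
Proof. by elim: s x y => //= z s IH x y /andP[xy /IH]; rewrite xy. Qed.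

(** * The minor built from the rails *)

Section RailsModel.
Variable G : sgraph.
Hypothesis cG : critical G.
Implicit Types (A B L Q S U X Y : {set G}) (p q : G * seq G).

Definition vset p := [set v in verts p].
Definition bset p := [set v in belast p.1 p.2].

Lemma conn_vset p : path (@adj G) p.1 p.2 -> conn (vset p).
Proof. exact: conn_path. Qed.

Lemma conn_bset p : path (@adj G) p.1 p.2 -> p.2 != [::] -> conn (bset p).
Proof. by rewrite /bset; case: p => x [|y s] //= h _; apply: conn_path; apply: path_belast. Qed.

Lemma bset_target p : path (@adj G) p.1 p.2 -> p.2 != [::] -> adjs (bset p) [set target p].
Proof.
rewrite /bset /target; case: p => x s /= + ne; case/lastP: s ne => // s y _.
rewrite rcons_path last_rcons belast_rcons => /andP[_ e]; apply/adjsP; exists (last x s), y.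
by rewrite in_set mem_last set11.
Qed.

Lemma adjs_clique L X Y a b : clique L -> [disjoint X & Y] -> a \in X -> b \in Y -> a \in L -> b \in L ->
  adjs X Y.
Proof.
move=> cL d aX bY aL bL; apply/adjsP; exists a, b; split=> //; apply: cL => //.
by apply: contraTneq bY => <-; rewrite (disjointFr d).
Qed.

Lemma linkage_filter U A B (a : pred (G * seq G)) ps : linkage U A B ps -> linkage U A B (filter a ps).
Proof.
move=> lps; have /andP[ok un] := lps; apply/andP; split.
  by apply/allP => p; rewrite mem_filter => /andP[_ /(allP ok)].
have pm : perm_eq (filter a ps ++ filter (predC a) ps) ps by rewrite perm_filterC.
move: un; rewrite -(perm_uniq (perm_flatten (perm_map (@verts G) pm))) map_cat flatten_cat cat_uniq.
by case/andP.
Qed.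

(* The rails ending in [B] are reversed and augmented by two paths from [B] to the other rails. The branch
   sets are the five rails, [x] and the two new paths without their last vertices; only the two
   new paths and the at most three rails ending in [A] can fail to be adjacent. *)
Lemma rails_hasK x A B L ps : halves x A B -> #|L| = 5 -> #|B| <= 5 -> clique L -> x \notin L ->
  rails x A B L ps -> hasK G.
Proof.
move=> hx L5 B5 cL xL [lps sz [rA rB]]; have [e d cA cB] := hx.
have /andP[/allP ok un] := lps.
pose psA := filter (fun p => target p \in A) ps; pose psB := filter (fun p => target p \in B) ps.
have cnt := count_halves hx lps; rewrite sz in cnt.
have pL p : p \in ps -> p.1 \in L by move=> /ok/andP[].
have path_p p : p \in ps -> path (@adj G) p.1 p.2 by move=> /ok/andP[_ /and5P[]].
have usp p : p \in ps -> uniq (verts p) by move=> /ok/andP[_ /and5P[]].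
have nT p v : p \in ps -> v \in belast p.1 p.2 -> v \notin nbr x.
  by move=> /ok/andP[_ /and5P[_ _ _ /allP h _]] /h.
have dis := linkage_disjoint lps.
have sA p : p \in psA -> p \in ps /\ target p \in A by rewrite mem_filter => /andP[].
have sB p : p \in psB -> p \in ps /\ target p \in B by rewrite mem_filter => /andP[].
have AB p v : p \in psA -> v \in psB -> p = v -> False.
  move=> /sA[_ pA] /sB[_ vB] pv; by move: vB; rewrite -pv (disjointFr d).
have vp1 p : p.1 \in verts p by exact: mem_head.
have ustart : uniq (map fst ps).
  rewrite map_inj_in_uniq; first exact: linkage_uniq lps.
  by move=> p q pps qps epq; apply: (dis p q p.1) => //; rewrite epq.
have start l : l \in L -> exists2 p, p \in ps & p.1 = l.
  move=> lL; have : L \subset [set v in map fst ps].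
    have sub : [set v in map fst ps] \subset L by apply/subsetP => v; rewrite in_set => /mapP[p /pL pl ->].
    suff <- : [set v in map fst ps] = L by [].
    by apply/eqP; rewrite eqEcard sub L5 cardsE (card_uniqP ustart) size_map sz.
  by move=> /subsetP/(_ l lL); rewrite in_set => /mapP[p pps ->]; exists p.
have Lstart p l : p \in ps -> l \in L -> l \in verts p -> l = p.1.
  move=> pps lL lp; have [q qps eq] := start l lL.
  by rewrite -eq; congr fst; apply/esym/(dis _ _ l) => //; rewrite -eq.
pose VA := [set v in flatten (map (@verts G) psA)].
have VAP v : v \in VA -> exists2 p, p \in psA & v \in verts p.
  by rewrite in_set => /flattenP[_ /mapP[p pA ->] vp]; exists p.
have inVA p v : p \in psA -> v \in verts p -> v \in VA.
  by move=> pA vp; rewrite in_set; apply/flattenP; exists (verts p); rewrite ?map_f.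
have VA_B v : v \in VA -> v \notin B.
  move=> /VAP[p /sA[pps tA] /verts_split[->|vb]]; first by rewrite (disjointFr d).
  by have := nT p v pps vb; rewrite -e in_setU negb_or => /andP[].
(* Paths from [B] may stop in [L] or anywhere on a rail ending in [A]. The reversed rails of [B]
   form a linkage to these targets that avoids [x]. *)
pose Y := L :|: VA.
have xB := half_self (halves_sym hx).
have jb : linkage [set~ x] B Y (map (@path_rev G) psB).
  apply/andP; split.
    rewrite all_map; apply/allP => p pB /=; have [pps tB] := sB p pB.
    apply/andP; split=> //; apply/and5P; split.
    - exact: path_of_rev (path_p p pps).
    - apply/allP => v; rewrite -/(verts (path_rev p)) verts_rev mem_rev => vp; rewrite /= in_setC in_set1.
      by apply: contraTneq vp => ->; exact: link_avoids lps pps xL.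
    - by rewrite -/(target (path_rev p)) target_rev in_setU pL.
    - rewrite belast_rev; apply/allP => v; rewrite mem_rev inE /= => vp.
      have vv : v \in verts p by rewrite inE vp orbT.
      rewrite in_setU negb_or; apply/andP; split.
        apply/negP => vL; have := usp p pps; rewrite /verts /= -(Lstart p v pps vL vv) => /andP[].
        by rewrite vp.
      apply/negP => /VAP[q qA vq]; have [qps _] := sA q qA.
      exact: (AB q p qA pB (dis q p v qps pps vq vv)).
    - by rewrite -/(verts (path_rev p)) verts_rev rev_uniq usp.
  have /andP[_ uB] := linkage_filter (fun p => target p \in B) lps.
  rewrite -/psB in uB; rewrite -map_comp; suff -> : uniq (flatten (map (@verts G \o @path_rev G) psB)) = uniq (flatten (map (@verts G) psB)) by [].
  apply: perm_uniq; apply/seq.permP => a; rewrite !count_flatten -!map_comp; congr sumn.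
  apply: eq_map => p; change (count a (verts (path_rev p)) = count a (verts p)).
  by rewrite verts_rev count_rev.
pose rb := count (fun p => target p \in B) ps.
have szB : size psB = rb by rewrite size_filter.
have [||qs [lqs szq subq]] := augment_to (k := rb + 2) jb; first by rewrite size_map szB leq_addr.
  move=> S Sk; apply: unsep_link; apply/negP => sS.
  (* A separator of at most [rb + 1] vertices, enlarged by [x], would separate the cliques [B] and
     [L] without exceeding either, hence equal one of them; but neither contains [x]. *)
  have sS' : sep setT (x |: S) B L.
    apply/forall_inP => b; rewrite in_setD in_setI => /and3P[bS bB bT].
    set D := component _ b; have bU : b \in setT :\: (x |: S) by rewrite in_setD bS.
    have DU : D \subset setT :\: (x |: S) := component_sub bU.
    apply/pred0P => l /=; apply/negP => /andP[lD lL].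
    apply: (sepP sS (component_conn (setT :\: (x |: S)) b)).
    - apply/subsetP => v /(subsetP DU); rewrite in_setD in_setU1 negb_or in_setC in_set1.
      by case/andP=> /andP[].
    - rewrite disjoint_sym -setI_eq0 -subset0; apply/subsetP => v /setIP[vS /(subsetP DU)].
      by rewrite in_setD in_setU1 vS orbT.
    - by apply/set0Pn; exists b; rewrite in_setI component_self.
    - by apply/set0Pn; exists l; rewrite in_setI lD in_setU lL.
  have sxS : #|x |: S| <= #|B|.
    apply: leq_trans rB; rewrite cardsU1 -/rb; apply: leq_trans (leq_add (leq_b1 _) (leqnn _)) _.
    by rewrite add1n.
  have [] := clique_separator cG cB cL sS' sxS (leq_trans sxS (leq_trans B5 (eq_leq (esym L5)))).
    by move=> eB; move: xB; rewrite -eB setU11.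
  by move=> eL; move: xL; rewrite -eL setU11.
have /andP[/allP okq uq] := lqs.
pose s0 := map fst psB.
have s0L v : v \in s0 -> v \in L by move=> /mapP[p /sB[/pL pl _] ->].
have jbt : map (@target G) (map (@path_rev G) psB) = s0.
  by rewrite -map_comp; apply: eq_map => p /=; rewrite target_rev.
rewrite jbt in subq.
have us0 : uniq s0 by rewrite -jbt; exact: linkage_target_uniq jb.
(* The paths in [qB] replace the rails of [B]: they start in [B] and end in the same vertices of
   [L]. The other two, [qC], are the new paths. *)
pose qB := filter (fun q => target q \in s0) qs; pose qC := filter (predC (fun q => target q \in s0)) qs.
have szqB : size qB = rb.
  have : perm_eq (map (@target G) qB) s0.
    rewrite /qB -filter_map; apply: uniq_perm => //.
      exact: filter_uniq (linkage_target_uniq lqs).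
    move=> v; rewrite mem_filter; apply/andP/idP => [[]//|vs]; split=> //.
    exact: subq.
  by move/perm_size; rewrite !size_map szB.
have szqC : size qC = 2.
  have := size_filter (fun q => target q \in s0) qs; have := count_predC (fun q => target q \in s0) qs.
  by rewrite -!size_filter -/qB -/qC szqB szq; move: (size qC); clear; lia.
have [q1 [q2 eqC]] : exists q1 q2, qC = [:: q1; q2] by move: szqC; case: qC => [|q1 [|q2 []]] // _; exists q1, q2.
have qC_qs q : q \in qC -> [/\ q \in qs & target q \notin s0] by rewrite mem_filter => /andP[].
have qB_qs q : q \in qB -> [/\ q \in qs & target q \in s0] by rewrite mem_filter => /andP[].
have pathq q : q \in qs -> path (@adj G) q.1 q.2 by move=> /okq/andP[_ /and5P[]].
have startq q : q \in qs -> q.1 \in B by move=> /okq/andP[].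
have nYq q v : q \in qs -> v \in belast q.1 q.2 -> v \notin Y.
  by move=> /okq/andP[_ /and5P[_ _ _ /allP h _]] /h.
have tYq q : q \in qs -> target q \in Y by move=> /okq/andP[_ /and5P[]].
have xq q v : q \in qs -> v \in verts q -> v != x.
  by move=> /okq/andP[_ /and5P[_ /allP h _ _ _]] /h; rewrite /= !inE.
have disq := linkage_disjoint lqs.
have tVA q : q \in qC -> target q \in VA.
  move=> /qC_qs[qqs ns]; have := tYq q qqs; rewrite in_setU => /orP[tL|//].
  have [p pps ep] := start _ tL; have := ok p pps => /andP[_ /and5P[_ _ tp _ _]].
  have [tA|tA] := boolP (target p \in A).
    by apply: (inVA p); rewrite ?mem_filter ?tA // -ep.
  case/negP: ns; rewrite -ep; apply: map_f; rewrite mem_filter pps andbT.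
  by move: tp; rewrite -/(target p) -e in_setU (negPf tA).
have neC q : q \in qC -> q.2 != [::].
  move=> qC'; have [qqs _] := qC_qs q qC'; apply: contraTneq (tVA q qC') => eq2.
  by apply/negP => /VA_B; rewrite /target eq2 /= startq.
have q1C : q1 \in qC by rewrite eqC mem_head.
have q2C : q2 \in qC by rewrite eqC !inE eqxx orbT.
have [[q1s _] [q2s _]] := (qC_qs q1 q1C, qC_qs q2 q2C).
have q12 : q1 != q2.
  have : uniq qC by apply: filter_uniq; exact: linkage_uniq lqs.
  by rewrite eqC /= inE andbT.
pose b1 := bset q1; pose b2 := bset q2.
pose rA' := map vset psA; pose rB' := map vset qB.
pose r := rA' ++ rB' ++ [:: [set x]; b1; b2].
have inb q v : v \in bset q -> v \in verts q by rewrite in_set; exact: belast_verts.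
have xps p : p \in ps -> x \notin verts p by move=> pps; exact: link_avoids lps pps xL.
have dAB p q : p \in psA -> q \in qB -> [disjoint vset p & vset q].
  move=> pA /qB_qs[qqs /mapP[p' p'B et]]; apply/pred0P => v /=; rewrite !in_set; apply/negP => /andP[vp vq].
  have [p's _] := sB p' p'B; have [pps _] := sA p pA.
  case: (verts_split vq) => [ev|vb].
    by apply: (AB p p' pA p'B); apply: (dis p p' v) => //; rewrite ev et.
  by have := nYq q v qqs vb; rewrite in_setU negb_or (inVA p v pA vp) andbF.
have dAC p q : p \in psA -> q \in qC -> [disjoint vset p & bset q].
  move=> pA /qC_qs[qqs _]; apply/pred0P => v /=; rewrite !in_set; apply/negP => /andP[vp vb].
  by have := nYq q v qqs vb; rewrite in_setU negb_or (inVA p v pA vp) andbF.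
have dBC q q' : q \in qB -> q' \in qC -> [disjoint vset q & bset q'].
  move=> /qB_qs[qqs t0] /qC_qs[q's nt]; apply/pred0P => v /=; apply/negP => /andP[].
  rewrite in_set => vq /inb vq'; case/negP: nt.
  by rewrite -(disq q q' v qqs q's vq vq').
have pw : pairwise (fun X Y : {set G} => [disjoint X & Y]) r.
  rewrite /r !pairwise_cat; apply/and5P; split.
  - rewrite allrel_catr; apply/andP; split.
      by apply/allrelP => _ _ /mapP[p pA ->] /mapP[q qB' ->]; exact: dAB.
    apply/allrelP => _ X /mapP[p pA ->]; rewrite !inE => /or3P[] /eqP->; [|exact: dAC|exact: dAC].
    by rewrite disjoint_sym disjoints1 in_set xps //; case: (sA p pA).
  - apply: pairwise_uniq; first exact: filter_uniq (linkage_uniq lps).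
    move=> p q /sA[pps _] /sA[qps _] pq; apply/pred0P => v /=; rewrite !in_set; apply/negP => /andP[vp vq].
    by rewrite (dis p q v) ?eqxx in pq.
  - apply/allrelP => _ X /mapP[q qB' ->]; rewrite !inE => /or3P[] /eqP->; [|exact: dBC|exact: dBC].
    rewrite disjoint_sym disjoints1 in_set; apply/negP => xv; have [qqs _] := qB_qs q qB'.
    by have := xq q x qqs xv; rewrite eqxx.
  - apply: pairwise_uniq; first exact: filter_uniq (linkage_uniq lqs).
    move=> p q /qB_qs[pps _] /qB_qs[qps _] pq; apply/pred0P => v /=; rewrite !in_set; apply/negP => /andP[vp vq].
    by rewrite (disq p q v) ?eqxx in pq.
  - have xb q : q \in qs -> [disjoint [set x] & bset q].
      by move=> qqs; rewrite disjoints1; apply/negP => /inb/(xq q x qqs); rewrite eqxx.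
    rewrite /= !andbT !xb //=; apply/pred0P => v /=; apply/negP => /andP[/inb v1 /inb v2].
    by move: q12; rewrite (disq q1 q2 v) ?eqxx.
have symd : symmetric (fun X Y : {set G} => [disjoint X & Y]) by move=> X Z; exact: disjoint_sym.
have nadL X Z C a b : clique C -> X \in r -> Z \in r -> a \in X -> a \in C -> b \in Z -> b \in C -> nad X Z = false.
  move=> cC Xr Zr aX aC bZ bC; rewrite /nad; have [//|ne /=] := eqVneq X Z.
  by apply/negbF; apply: (adjs_clique cC _ aX bZ aC bC); exact: (pairwise_mem symd pw Xr Zr ne).
have mrA X : X \in rA' -> X \in r by rewrite /r !mem_cat => ->.
have mrB X : X \in rB' -> X \in r by rewrite /r !mem_cat => ->; rewrite orbT.
have mx : [set x] \in r by rewrite /r !mem_cat !inE eqxx !orbT.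
have m1 : b1 \in r by rewrite /r !mem_cat !inE eqxx !orbT.
have m2 : b2 \in r by rewrite /r !mem_cat !inE eqxx !orbT.
have repL X : X \in rA' ++ rB' -> exists2 a, a \in X & a \in L.
  rewrite mem_cat => /orP[] /mapP[p pX ->].
    by have [pps _] := sA p pX; exists p.1; rewrite ?in_set ?vp1 ?pL.
  by have [_ t0] := qB_qs p pX; exists (target p); rewrite ?in_set ?target_verts ?s0L.
have bq1 q : q \in qC -> q.1 \in bset q.
  by move/neC; rewrite /bset in_set; case: q => a [|b s] //= _; rewrite mem_head.
have repB X : X \in rB' ++ [:: b1; b2] -> exists2 a, a \in X & a \in B.
  rewrite mem_cat => /orP[/mapP[q qB' ->]|].
    by have [qqs _] := qB_qs q qB'; exists q.1; rewrite ?in_set ?mem_head ?startq.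
  by rewrite !inE => /orP[] /eqP->; [exists q1.1|exists q2.1]; rewrite ?bq1 ?startq.
have repN X : X \in rA' ++ rB' ++ [:: b1; b2] -> adjs [set x] X.
  rewrite mem_cat => /orP[/mapP[p pX ->]|/repB[a aX aB]].
    have [pps tA] := sA p pX; rewrite adjs1; apply/existsP; exists (target p).
    by rewrite in_set target_verts (half_nbr hx tA).
  by rewrite adjs1; apply/existsP; exists a; rewrite aX (half_nbr (halves_sym hx) aB).
have sub_r X : X \in rA' ++ rB' ++ [:: b1; b2] -> X \in r.
  by rewrite /r !mem_cat => /or3P[->|->|]; rewrite ?orbT // !inE => ->; rewrite !orbT.
have nadx X : X \in r -> nad [set x] X = false.
  move=> Xr; rewrite /nad; have [//|ne /=] := eqVneq [set x] X; apply/negbF; apply: repN.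
  move: Xr ne; rewrite /r !mem_cat => /or3P[->//|->|]; rewrite ?orbT // in_cons.
  by case/orP=> [/eqP->|->]; rewrite ?eqxx ?orbT.
have nadLL X Z : X \in rA' ++ rB' -> Z \in rA' ++ rB' -> nad X Z = false.
  move=> hX hZ; have [a aX aL] := repL X hX; have [b bZ bL] := repL Z hZ.
  have sub T : T \in rA' ++ rB' -> T \in r by rewrite mem_cat => /orP[/mrA|/mrB].
  exact: (nadL X Z L a b cL (sub X hX) (sub Z hZ)).
have nadBB X Z : X \in rB' ++ [:: b1; b2] -> Z \in rB' ++ [:: b1; b2] -> nad X Z = false.
  move=> hX hZ; have [a aX aB] := repB X hX; have [b bZ bB] := repB Z hZ.
  have sub T : T \in rB' ++ [:: b1; b2] -> T \in r.
    by move=> hT; apply: sub_r; rewrite mem_cat hT orbT.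
  exact: (nadL X Z B a b cB (sub X hX) (sub Z hZ)).
have sum0 X (s : seq {set G}) : {in s, forall Z, nad X Z = false} -> \sum_(Z <- s) (nad X Z : nat) = 0.
  by move=> h; apply: big1_seq => Z /andP[_ Zs]; rewrite h.
have inA X : X \in rA' -> X \in rA' ++ rB' by rewrite mem_cat => ->.
have inB1 X : X \in rB' -> X \in rA' ++ rB' by rewrite mem_cat orbC => ->.
have inB2 X : X \in rB' -> X \in rB' ++ [:: b1; b2] by rewrite mem_cat => ->.
have [c1 c2] : b1 \in rB' ++ [:: b1; b2] /\ b2 \in rB' ++ [:: b1; b2].
  by rewrite !mem_cat !inE !eqxx !orbT.
(* There are at most three rails ending in [A], and the path stops on one of them, so it misses at
   most two. *)
have cst q : q \in qC -> \sum_(X <- rA') (nad X (bset q) : nat) <= 2.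
  move=> qC'; have [qqs _] := qC_qs q qC'.
  have -> : \sum_(X <- rA') (nad X (bset q) : nat) = count (fun X => nad X (bset q)) rA'.
    by rewrite -sum1_count [RHS]big_mkcond; apply: eq_bigr => X _; case: (nad _ _).
  have [p pA tp] := VAP _ (tVA q qC'); rewrite -ltnS.
  apply: (@leq_trans (size rA')); last by rewrite size_map size_filter.
  apply: (@count_lt_size _ _ _ (vset p)); first exact: map_f.
  rewrite /nad negb_and negbK; apply/orP; right; rewrite adjs_sym negbK.
  apply: adjs_sub (bset_target (pathq q qqs) (neC q qC')) => //.
  by rewrite sub1set in_set.
apply: (@hasK_list G r).
- rewrite /r !size_cat !size_map szqB size_filter /=; move: cnt; rewrite -/rb.
  by move: (rb) => m; clear; lia.
- move=> X; rewrite /r !mem_cat => /or3P[/mapP[p pA ->]|/mapP[q qB' ->]|].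
  + by apply: conn_vset; apply: path_p; case: (sA p pA).
  + by apply: conn_vset; apply: pathq; case: (qB_qs q qB').
  + rewrite !inE => /or3P[] /eqP->; first exact: conn1.
      by apply: conn_bset; [exact: pathq|exact: neC].
    by apply: conn_bset; [exact: pathq|exact: neC].
- exact: pw.
have FA X : X \in rA' -> \sum_(Z <- r) (nad X Z : nat) = nad X b1 + nad X b2.
  move=> XA; rewrite /r !big_cat !big_cons big_nil /= (nad_sym X [set x]) nadx ?mrA // addn0.
  rewrite !sum0 // => Z hZ; apply: nadLL; by [exact: inA|exact: inB1].
have FB X : X \in rB' -> \sum_(Z <- r) (nad X Z : nat) = 0.
  move=> XB; rewrite /r !big_cat !big_cons big_nil /= (nad_sym X [set x]) nadx ?mrB // addn0.
  rewrite (nadBB X b1 (inB2 X XB) c1) (nadBB X b2 (inB2 X XB) c2) !sum0 // => Z hZ; apply: nadLL; by [exact: inA|exact: inB1].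
have FC b : b \in r -> b \in rB' ++ [:: b1; b2] ->
    \sum_(Z <- r) (nad b Z : nat) = \sum_(X <- rA') (nad X b : nat).
  move=> br hb; rewrite /r !big_cat !big_cons big_nil /= (nad_sym b [set x]) nadx //.
  rewrite (nadBB b b1 hb c1) (nadBB b b2 hb c2) (sum0 b rB') ?addn0; first by apply: eq_bigr => X _; rewrite nad_sym.
  by move=> Z hZ; apply: nadBB hb (inB2 Z hZ).
have Fx : \sum_(Z <- r) (nad [set x] Z : nat) = 0 by apply: sum0 => Z; exact: nadx.
rewrite {1}/r !big_cat !big_cons big_nil /= Fx (FC b1) // (FC b2) //.
rewrite [X in _ + (X + _)]big1_seq; last by move=> X /andP[_]; exact: FB.
have -> : \sum_(X <- rA') \sum_(Z <- r) (nad X Z : nat) = \sum_(X <- rA') (nad X b1 : nat) + \sum_(X <- rA') (nad X b2 : nat).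
  by rewrite -big_split; apply: eq_big_seq => X; exact: FA.
by have := cst q1 q1C; have := cst q2 q2C; rewrite -/b1 -/b2;
  move: (\sum_(X <- rA') _) (\sum_(X <- rA') _); clear; lia.
Qed.

Theorem not_critical : False.
Proof.
have [x [A [B [L [ps [hx [L5 B5] cL xL r]]]]]] := rails_exist cG.
case: (cG) => nK _ _; apply: nK; exact: rails_hasK hx L5 B5 cL xL r.
Qed.
End RailsModel.

Theorem theorem1p5 (G : sgraph) (hG : has_no_minor_in (Kminus 8 4) G) :
  colorable 7 G.
Proof.
have {hG} : ~ hasK G by move=> /hasK_minor[H KH mH]; exact: hG KH mH.
have [n] := ubnP #|G|; elim: n G => // n IH G Gn nK.
(* Passing to finite functions makes colourability decidable. A graph that is not colourable here is
   critical, because smaller minors inherit the absence of the forbidden minors. *)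
have [/existsP[c /forallP hc]|/existsPn no] :=
    boolP [exists c : {ffun G -> 'I_7}, [forall u, forall v, (u -- v) ==> (c u != c v)]].
  by exists c => u v uv; have /forallP/(_ v)/implyP := hc u; apply.
exfalso; apply: (@not_critical G); split=> //.
  case=> c hc; have /negP := no [ffun v => c v]; apply.
  by apply/forallP => u; apply/forallP => v; apply/implyP => uv; rewrite !ffunE hc.
move=> H m mm HG; apply: IH; first exact: leq_trans HG _.
by move=> hK; apply: nK; exact: hasK_model mm hK.
Qed.
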